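(* Let $T$ be a separable $\mathbb{R}$-tree, and let $A$ be an infinite subset of $T$ such that $\mathrm{Br}(T)\subset\bar{A}$, where $\bar A$ is the closure of $A$ in $T$. If $\bar{A}$ has length measure $0$, then $\mathcal{F}(A)$ is linearly isometric to $\ell_1$. If $\bar{A}$ has positive length measure, then $\mathcal{F}(A)$ is linearly isomorphic to $L_1$.
   Context: All Banach spaces are real, and $L_1$ denotes the usual Lebesgue space $L_1([0,1])$ (isometric to $L_1(\mathbb{R})$). For a pointed metric space $M$ (with origin $0$), $\mathrm{Lip}_0(M)$ is the Banach space of real-valued Lipschitz functions on $M$ vanishing at $0$, normed by the best Lipschitz constant. The Lipschitz-free space $\mathcal{F}(M)$ is the closed linear span in $\mathrm{Lip}_0(M)^*$ of the evaluation functionals $\delta_x:f\mapsto f(x)$, $x\in M$. Different base points yield isometric Lipschitz-free spaces, so the choice of base point is irrelevant. An $\mathbb{R}$-tree is a metric space $T$ such that: (i) for any $a,b\in T$ there is a unique isometry $\phi_{ab}$ of $[0,d(a,b)]$ into $T$ with $\phi_{ab}(0)=a$, $\phi_{ab}(d(a,b))=b$; (ii) any one-to-one continuous map $\varphi:[0,1]\to T$ has the same range as $\phi_{ab}$ with $a=\varphi(0)$, $b=\varphi(1)$. The range of $\phi_{xy}$ is denoted $[x,y]$ and called a segment. A point $t\in T$ is a branching point if $T\setminus\{t\}$ has at least three connected components; $\mathrm{Br}(T)$ is the set of branching points. Length measure: a subset $B\subset T$ is measurable if $\phi_{xy}^{-1}(B)$ is Lebesgue measurable for all $x,y\in T$.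 For a segment $S=[x,y]$ put $\lambda_S(B)=\lambda(\phi_{xy}^{-1}(B))$, with $\lambda$ Lebesgue measure on $\mathbb{R}$. For $R=\bigcup_{k=1}^n S_k$ a finite union of disjoint segments put $\lambda_R(B)=\sum_{k=1}^n\lambda_{S_k}(B)$. The length measure is $\lambda_T(B)=\sup_R\lambda_R(B)$, the supremum being over all such finite disjoint unions $R$; it is a measure on the $\sigma$-algebra of measurable subsets of $T$. *)

(* Defs.v *)
From HB Require Import structures.
From mathcomp Require Import all_boot all_order all_algebra.
From mathcomp Require Import all_classical all_reals all_analysis.
From mathcomp Require Import measurable_realfun ess_sup_inf.

Set Implicit Arguments.
Unset Strict Implicit.
Unset Printing Implicit Defensive.

Import Order.TTheory GRing.Theory Num.Theory.
Import numFieldNormedType.Exports.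

Local Open Scope classical_set_scope.
Local Open Scope ring_scope.

Section Isomorphisms.
Context {R : realType}.

Definition linearly_isometric (V W : normedModType R) : Prop :=
  exists phi : {linear V -> W},
    (forall x, `|phi x| = `|x|) /\ (forall y, exists x, phi x = y).

Definition linearly_isomorphic (V W : normedModType R) : Prop :=
  exists (phi : {linear V -> W}) (psi : {linear W -> V}),
    [/\ cancel phi psi, cancel psi phi, continuous phi & continuous psi].

End Isomorphisms.

Section Dual.
Context {R : realType} (V : normedModType R).

Definition dual_pred : {pred (V -> R^o)} :=
  mem [set f : V -> R^o | linear f /\ continuous f].

Lemma dual_submod_closed : submod_closed dual_pred.
Proof.
split.
  rewrite inE/=; split; last by move=> x; exact: cvg_cst.
  by move=> a u v /=; rewrite /GRing.zero/= scaler0 addr0.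
move=> a f g /[!inE]/= -[lf cf] [lg cg]; split.
  move=> b u v /=; rewrite !fctE [in LHS]lf [in LHS]lg.
  by rewrite !scalerDr !scalerA (mulrC a b) addrACA.
move=> x; apply: cvgD; last exact: cg.
by apply: cvgZr; exact: cf.
Qed.

HB.instance Definition _ := GRing.isSubmodClosed.Build R _ dual_pred
  dual_submod_closed.

Definition dual_space : Type := {f : V -> R^o | f \in dual_pred}.
HB.instance Definition _ := Choice.on dual_space.
HB.instance Definition _ := SubType.on dual_space.
HB.instance Definition _ := [SubChoice_isSubLmodule of dual_space by <:].

Definition dual_fun (f : dual_space) : V -> R^o := val f.
Coercion dual_fun : dual_space >-> Funclass.

Lemma dual_linear (f : dual_space) : linear f.
Proof. by have := valP f; rewrite inE => -[]. Qed.

Lemma dual_continuous (f : dual_space) : continuous f.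
Proof. by have := valP f; rewrite inE => -[]. Qed.

HB.instance Definition _ (f : dual_space) :=
  GRing.isLinear.Build R V R^o _ (dual_fun f) (@dual_linear f).

Definition dual_norm (f : dual_space) : R :=
  sup [set `|f x| | x in [set x : V | `|x| <= 1]].

Lemma dual_norm_has_sup (f : dual_space) :
  has_sup [set `|f x| | x in [set x : V | `|x| <= 1]].
Proof.
split; first by exists `|f 0|, 0 => //=; rewrite normr0.
have : bounded_near (dual_fun f) (nbhs (0 : V)).
  by apply/linear_bounded_continuous; exact: dual_continuous.
by move=> /bounded_funP/(_ 1)[M fM]; exists M => _ [x /= x1 <-]; exact: fM.
Qed.

Lemma dual_norm_ub (f : dual_space) x : `|f x| <= dual_norm f * `|x|.
Proof.
have [->|x0] := eqVneq x 0; first by rewrite raddf0 !normr0 mulr0.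
have nx0 : 0 < `|x| by rewrite normr_gt0.
rewrite -ler_pdivrMr//; apply: (sup_upper_bound (dual_norm_has_sup f)).
exists (`|x|^-1 *: x); first by rewrite /= normrZ normfV normr_id mulVf ?gt_eqF.
by rewrite linearZ/= normrM normfV normr_id mulrC.
Qed.

Lemma dual_norm_le (f : dual_space) k : 0 <= k ->
  (forall x, `|f x| <= k * `|x|) -> dual_norm f <= k.
Proof.
move=> k0 fk; apply: ge_sup; first by case: (dual_norm_has_sup f).
by move=> _ [x /= x1 <-]; rewrite (le_trans (fk x))// ler_piMr.
Qed.

Let dual_norm_ge0 f : 0 <= dual_norm f.
Proof.
apply: le_trans (normr_ge0 (f 0)) _.
apply: (sup_upper_bound (dual_norm_has_sup f)).
by exists 0 => //=; rewrite normr0.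
Qed.

Let dual_normD f g : dual_norm (f + g) <= dual_norm f + dual_norm g.
Proof.
apply: dual_norm_le => [|x]; first by rewrite addr_ge0.
rewrite mulrDl (le_trans (ler_normD _ _))//.
by rewrite lerD// dual_norm_ub.
Qed.

Let dual_normZ_le a f : dual_norm (a *: f) <= `|a| * dual_norm f.
Proof.
apply: dual_norm_le => [|x]; first by rewrite mulr_ge0.
by rewrite [X in `|X|]/(a *: val f x) normrM -mulrA ler_wpM2l// dual_norm_ub.
Qed.

Let dual_normZ a f : dual_norm (a *: f) = `|a| * dual_norm f.
Proof.
apply/eqP; rewrite eq_le dual_normZ_le/=.
have [->|a0] := eqVneq a 0; first by rewrite normr0 mul0r.
rewrite -ler_pdivlMl ?normr_gt0// -normfV.
by apply: le_trans (dual_normZ_le _ _); rewrite scalerA mulVf// scale1r.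
Qed.

Let dual_norm0_eq0 f : dual_norm f = 0 -> f = 0.
Proof.
move=> f0; apply/val_inj/funext => x /=; apply/normr0_eq0/eqP.
by rewrite eq_le normr_ge0 andbT -(mul0r `|x|) -f0 dual_norm_ub.
Qed.

HB.instance Definition _ := Lmodule_isNormed.Build R dual_space
  dual_normD dual_normZ dual_norm0_eq0.

End Dual.

Section ClosedSpan.
Context {R : realType} (V : normedModType R).

Definition linear_span (S : set V) : set V :=
  [set v | exists (n : nat) (c : 'I_n -> R) (s : 'I_n -> V),
    (forall i, S (s i)) /\ v = \sum_(i < n) c i *: s i].

Definition closed_span_pred (S : set V) : {pred V} :=
  mem (closure (linear_span S)).

Lemma linear_span_lin S a u v :
  linear_span S u -> linear_span S v -> linear_span S (a *: u + v).
Proof.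
move=> [n [c [s [Ss ->]]]] [m [d [t [St ->]]]].
exists (n + m)%N,
  (fun i : 'I_(n + m) =>
     match fintype.split i with inl i => a * c i | inr j => d j end),
  (fun i : 'I_(n + m) =>
     match fintype.split i with inl i => s i | inr j => t j end).
split; first by move=> i; case: fintype.split.
rewrite big_split_ord/= scaler_sumr; congr +%R; apply: eq_bigr => i _.
  by rewrite -/(unsplit (inl i)) unsplitK scalerA.
by rewrite -/(unsplit (inr i)) unsplitK.
Qed.

Lemma closed_span_submod_closed S : submod_closed (closed_span_pred S).
Proof.
split.
  rewrite inE; apply: subset_closure.
  exists 0%N, (fun=> 0), (fun=> 0); split; first by case.
  by rewrite big_ord0.
move=> a u v /[!inE] uS vS B.
have cf : {for (u, v), continuous (fun p : V * V => a *: p.1 + p.2)}.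
  apply: (@cvgD _ _ _ (nbhs (u, v))); last exact: cvg_snd.
  by apply: cvgZr; exact: cvg_fst.
move=> /cf [[/= P Q] [Pu Qv]] PQB.
have [x [xS Px]] := uS _ Pu; have [y [yS Qy]] := vS _ Qv.
exists (a *: x + y); split; first exact: linear_span_lin.
exact: (PQB (x, y)).
Qed.

HB.instance Definition _ S := GRing.isSubmodClosed.Build R V
  (closed_span_pred S)
  (closed_span_submod_closed S).

Definition closed_span (S : set V) : Type := {v : V | v \in closed_span_pred S}.

Section Norm.
Variable S : set V.

HB.instance Definition _ := Choice.on (closed_span S).
HB.instance Definition _ := SubType.on (closed_span S).
HB.instance Definition _ := [SubChoice_isSubLmodule of closed_span S by <:].

Let span_norm (v : closed_span S) : R := `|val v|.

Let span_normD u v : span_norm (u + v) <= span_norm u + span_norm v.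
Proof. exact: ler_normD. Qed.

Let span_normZ a v : span_norm (a *: v) = `|a| * span_norm v.
Proof. exact: normrZ. Qed.

Let span_norm0_eq0 v : span_norm v = 0 -> v = 0.
Proof. by move=> v0; apply/val_inj/normr0_eq0. Qed.

HB.instance Definition _ := Lmodule_isNormed.Build R (closed_span S)
  span_normD span_normZ span_norm0_eq0.

End Norm.
End ClosedSpan.

Section Lip0.
Context {R : realType} {M : metricType R}.

Definition is_lipschitz (k : R) (f : M -> R) : Prop :=
  forall x y, `|f x - f y| <= k * mdist x y.

Variable o : M.

Definition lip0_pred : {pred (M -> R^o)} :=
  mem [set f : M -> R^o | (exists k, is_lipschitz k f) /\ f o = 0].

Lemma is_lipschitzW k l f : k <= l -> is_lipschitz k f -> is_lipschitz l f.
Proof.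
by move=> kl fk x y; rewrite (le_trans (fk x y))// ler_wpM2r// mdist_ge0.
Qed.

Lemma is_lipschitz_lin a k l (f g : M -> R^o) :
  is_lipschitz k f -> is_lipschitz l g ->
  is_lipschitz (`|a| * k + l) (a *: f + g).
Proof.
move=> fk gl x y; rewrite !fctE opprD addrACA -scalerBr.
rewrite (le_trans (ler_normD _ _))// mulrDl lerD//.
by rewrite normrM -mulrA ler_wpM2l.
Qed.

Lemma lip0_submod_closed : submod_closed lip0_pred.
Proof.
split.
  rewrite inE/=; split=> //; exists 0 => x y.
  by rewrite mul0r [X in `|X - _|]/(0 : R) subrr normr0.
move=> a f g /[!inE]/= -[[k fk] fo] [[l gl] go]; split.
  by exists (`|a| * k + l); exact: is_lipschitz_lin.
by rewrite !fctE fo go scaler0 addr0.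
Qed.

HB.instance Definition _ := GRing.isSubmodClosed.Build R _ lip0_pred
  lip0_submod_closed.

Definition lip0 : Type := {f : M -> R^o | f \in lip0_pred}.
HB.instance Definition _ := Choice.on lip0.
HB.instance Definition _ := SubType.on lip0.
HB.instance Definition _ := [SubChoice_isSubLmodule of lip0 by <:].

(* The constraint 0 <= k only matters when M is a single point. *)
Definition lip0_norm (f : lip0) : R :=
  inf [set k | 0 <= k /\ is_lipschitz k (val f)].

Lemma lip0_has_inf (f : lip0) :
  has_inf [set k | 0 <= k /\ is_lipschitz k (val f)].
Proof.
split; last by exists 0 => k [].
have := valP f; rewrite inE/= => -[[k fk] _]; exists `|k|; split => //.
by apply: is_lipschitzW fk; exact: ler_norm.
Qed.

Lemma lip0_norm_le (f : lip0) k : 0 <= k -> is_lipschitz k (val f) ->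
  lip0_norm f <= k.
Proof. by move=> k0 fk; apply: ge_inf => //; case: (lip0_has_inf f). Qed.

Lemma lip0_norm_ge0 f : 0 <= lip0_norm f.
Proof. by apply: lb_le_inf => [|k []//]; case: (lip0_has_inf f). Qed.

Lemma lip0_normP (f : lip0) : is_lipschitz (lip0_norm f) (val f).
Proof.
move=> x y; have [->|xy] := eqVneq x y.
  by rewrite subrr normr0 mdistxx mulr0.
rewrite -ler_pdivrMr ?mdist_gt0//; apply: lb_le_inf.
  by case: (lip0_has_inf f).
by move=> k [_ fk]; rewrite ler_pdivrMr ?mdist_gt0.
Qed.

Let lip0_normD f g : lip0_norm (f + g) <= lip0_norm f + lip0_norm g.
Proof.
apply: lip0_norm_le => [|x y]; first by rewrite addr_ge0 ?lip0_norm_ge0.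
have := is_lipschitz_lin 1 (@lip0_normP f) (@lip0_normP g).
by rewrite normr1 mul1r scale1r; exact.
Qed.

Let lip0_normZ_le a f : lip0_norm (a *: f) <= `|a| * lip0_norm f.
Proof.
apply: lip0_norm_le => [|x y]; first by rewrite mulr_ge0 ?lip0_norm_ge0.
rewrite [X in `|X|](_ : _ = a * (val f x - val f y)); last by rewrite mulrBr.
by rewrite normrM -mulrA ler_wpM2l// lip0_normP.
Qed.

Let lip0_normZ a f : lip0_norm (a *: f) = `|a| * lip0_norm f.
Proof.
apply/eqP; rewrite eq_le lip0_normZ_le/=.
have [->|a0] := eqVneq a 0; first by rewrite normr0 mul0r lip0_norm_ge0.
rewrite -ler_pdivlMl ?normr_gt0// -normfV.
by apply: le_trans (lip0_normZ_le _ _); rewrite scalerA mulVf// scale1r.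
Qed.

Let lip0_norm0_eq0 f : lip0_norm f = 0 -> f = 0.
Proof.
move=> f0; apply/val_inj/funext => x /=.
have fo : val f o = 0 by have := valP f; rewrite inE => -[].
have := @lip0_normP f x o; rewrite f0 mul0r fo subr0 normr_le0.
by move/eqP.
Qed.

HB.instance Definition _ := Lmodule_isNormed.Build R lip0
  lip0_normD lip0_normZ lip0_norm0_eq0.

Definition lip0_eval (x : M) : lip0 -> R^o := fun f => val f x.

Lemma lip0_eval_dual x : lip0_eval x \in @dual_pred R lip0.
Proof.
rewrite inE/=.
have le : linear (lip0_eval x) by [].
split=> //; pose L := GRing.isLinear.Build R lip0 R^o _ (lip0_eval x) le.
pose e : {linear lip0 -> R^o} := HB.pack (lip0_eval x) L.
apply: (@bounded_linear_continuous _ _ _ e); apply/bounded_funP => r.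
exists (r * mdist x o) => f fr; rewrite /= /lip0_eval.
have fo : val f o = 0 by have := valP f; rewrite inE => -[].
rewrite -[val f x]subr0 -fo (le_trans (lip0_normP _ _ _))//.
by rewrite ler_wpM2r// mdist_ge0.
Qed.

Definition delta (x : M) : dual_space lip0 :=
  exist _ (lip0_eval x) (lip0_eval_dual x).

Definition lipschitz_free : normedModType R := closed_span (range delta).

End Lip0.

(* The library defines the type LspaceType mu p1 of classes of functions modulo
   equality almost everywhere, without its vector space structure or norm. *)
Section LspaceNormed.
Local Open Scope quotient_scope.
Context d (T : measurableType d) (R : realType).
Variables (mu : {measure set T -> \bar R}) (p : \bar R) (p1 : (1 <= p)%E).

Notation Lsp := (LspaceType mu p1).
Notation Lfn := (LfunType mu p1).
Notation cls := {mfun_ mu, T >-> measurableTypeR R}.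

HB.instance Definition _ := gen_eqMixin Lsp.
HB.instance Definition _ := gen_choiceMixin Lsp.

Definition Lspace_mfun (f : Lsp) : {mfun T >-> measurableTypeR R} :=
  repr (f : cls).

Lemma Lspace_fun_Lfun f : (Lspace_mfun f : T -> R) \in Lfun mu p.
Proof.
apply/andP; split.
  rewrite inE/=.
  exact: (@measurable_funPT _ _ T (measurableTypeR R) (Lspace_mfun f)).
by rewrite inE; exact: Lebesgue_finite.
Qed.

Definition Lspace_repr (f : Lsp) : Lfn := Lfun_Sub p1 (Lspace_fun_Lfun f).


Definition Lfun_mfun (f : Lfn) : {mfun T >-> measurableTypeR R} :=
  MeasurableFun.Pack
    (MeasurableFun.Class (isMeasurableFun.Build _ _ T (measurableTypeR R) f
       (@measurable_funPT _ _ T R f))).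

Definition Lfun_class (f : Lfn) : cls := \pi_cls (Lfun_mfun f).

Lemma Lnorm_ae_eq (f g : T -> R) : measurable_fun setT f ->
  measurable_fun setT g -> f = g %[ae mu] ->
  'N[mu]_p[EFin \o f]%E = 'N[mu]_p[EFin \o g]%E.
Proof.
move=> mf mg fg; have fg' x : (setT x -> f x = g x) -> f x = g x by exact.
rewrite unlock /Lnorm; case: p p1 => [r _|_|].
- have mpow (h : T -> R) : measurable_fun setT h ->
      measurable_fun setT (fun x => (`|(EFin \o h) x| `^ r)%E).
    move=> mh; apply/measurable_EFinP/(measurableT_comp (measurable_powR r)).
    exact: measurableT_comp.
  congr poweR; apply: ae_eq_integral; first exact: measurableT.
  + exact: mpow.
  + exact: mpow.
  + by apply: filterS fg => x /fg' /= ->.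
- case: ifPn => [_|//]; apply: eq_ess_sup.
  by apply: filterS fg => x /fg' /= ->.
- by rewrite leeNy_eq.
Qed.

Lemma Lfun_class_ae (f : Lfn) : (f : T -> R) = (Lfun_class f : T -> R) %[ae mu].
Proof.
have /eqP := reprK (Lfun_class f); rewrite /Lfun_class eqmodE => /asboolP.
by apply: filterS => x fx _; rewrite -fx.
Qed.

Lemma Lfun_class_finite (f : Lfn) : finite_norm mu p (Lfun_class f : T -> R).
Proof.
rewrite /finite_norm -(@Lnorm_ae_eq f); [exact: Lfunction_finite|by []| |].
  exact: (@measurable_funPT _ _ T (measurableTypeR R) (repr (Lfun_class f))).
exact: Lfun_class_ae.
Qed.

HB.instance Definition _ (f : Lfn) :=
  isFinLebesgue.Build d T R mu p p1 (Lfun_class f) (Lfun_class_finite f).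

Definition Lspace_pi (f : Lfn) : Lsp := Lfun_class f.

Lemma Lspace_inj (f g : Lsp) : f = g :> cls -> f = g.
Proof.
case: f g => [f [[ff]]] [g [[gf]]] /= fg; subst g.
by have -> : ff = gf by exact: Prop_irrelevance.
Qed.

Lemma Lspace_piP (f g : Lfn) :
  (f : T -> R) = g %[ae mu] -> Lspace_pi f = Lspace_pi g.
Proof. by move=> fg; apply/Lspace_inj/eqmodP/asboolP. Qed.

Lemma Lspace_reprK : cancel Lspace_repr Lspace_pi.
Proof.
move=> f; apply/Lspace_inj; rewrite /= -[RHS](reprK (f : cls)).
by apply/eqmodP/asboolP/aeW.
Qed.

Lemma Lspace_piK (f : Lfn) : (f : T -> R) = Lspace_repr (Lspace_pi f) %[ae mu].
Proof. exact: Lfun_class_ae. Qed.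

Definition Lspace0 : Lsp := Lspace_pi 0.
Definition Lspace_opp (f : Lsp) : Lsp := Lspace_pi (- Lspace_repr f).
Definition Lspace_add (f g : Lsp) : Lsp :=
  Lspace_pi (Lspace_repr f + Lspace_repr g).
Definition Lspace_scale (a : R) (f : Lsp) : Lsp :=
  Lspace_pi (a *: Lspace_repr f).
Definition Lspace_norm (f : Lsp) : R :=
  fine 'N[mu]_p[EFin \o Lspace_repr f]%E.

Lemma Lspace_pi_add f g :
  Lspace_add (Lspace_pi f) (Lspace_pi g) = Lspace_pi (f + g).
Proof.
apply: Lspace_piP; have := Lspace_piK f; have := Lspace_piK g.
apply: filterS2 => x /= /(_ I) + /(_ I) + _ => gx fx.
by rewrite [LHS]/(_ + _) -fx -gx.
Qed.

Lemma Lspace_pi_scale a f :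
  Lspace_scale a (Lspace_pi f) = Lspace_pi (a *: f).
Proof.
apply: Lspace_piP; have := Lspace_piK f.
by apply: filterS => x /= /(_ I) + _ => fx; rewrite [LHS]/(_ * _) -fx.
Qed.

Lemma Lspace_pi_norm f :
  Lspace_norm (Lspace_pi f) = fine 'N[mu]_p[EFin \o f]%E.
Proof.
by congr fine; apply: Lnorm_ae_eq => //; apply: ae_eq_sym; exact: Lspace_piK.
Qed.

Lemma Lspace_addA : associative Lspace_add.
Proof.
move=> f g h; rewrite -(Lspace_reprK f) -(Lspace_reprK g) -(Lspace_reprK h).
by rewrite !Lspace_pi_add addrA.
Qed.

Lemma Lspace_addC : commutative Lspace_add.
Proof. by move=> f g; rewrite /Lspace_add addrC. Qed.

Lemma Lspace_add0 : left_id Lspace0 Lspace_add.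
Proof. by move=> f; rewrite -(Lspace_reprK f) Lspace_pi_add add0r. Qed.

Lemma Lspace_addN : left_inverse Lspace0 Lspace_opp Lspace_add.
Proof.
by move=> f; rewrite -[X in Lspace_add _ X]Lspace_reprK Lspace_pi_add addNr.
Qed.

HB.instance Definition _ := GRing.isZmodule.Build Lsp
  Lspace_addA Lspace_addC Lspace_add0 Lspace_addN.

Lemma Lspace_scaleA a b f :
  Lspace_scale a (Lspace_scale b f) = Lspace_scale (a * b) f.
Proof. by rewrite Lspace_pi_scale scalerA. Qed.

Lemma Lspace_scale1 : left_id 1 Lspace_scale.
Proof. by move=> f; rewrite /Lspace_scale scale1r Lspace_reprK. Qed.

Lemma Lspace_scaleDr : right_distributive Lspace_scale +%R.
Proof.
by move=> a f g; rewrite Lspace_pi_scale scalerDr [RHS]Lspace_pi_add.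
Qed.

Lemma Lspace_scaleDl f : {morph Lspace_scale^~ f : a b / a + b}.
Proof. by move=> a b; rewrite /Lspace_scale scalerDl [RHS]Lspace_pi_add. Qed.

HB.instance Definition _ := GRing.Zmodule_isLmodule.Build R Lsp
  Lspace_scaleA Lspace_scale1 Lspace_scaleDr Lspace_scaleDl.

Lemma Lspace_normD f g : Lspace_norm (f + g) <= Lspace_norm f + Lspace_norm g.
Proof. by rewrite Lspace_pi_norm; exact: ler_LnormD. Qed.

Lemma Lspace_normZ a f : Lspace_norm (a *: f) = `|a| * Lspace_norm f.
Proof. by rewrite Lspace_pi_norm LnormZ -finite_norm_fine -EFinM. Qed.

Lemma Lspace_norm0_eq0 f : Lspace_norm f = 0 -> f = 0.
Proof.
by move=> /fine_Lnormr_eq0 f0; rewrite -(Lspace_reprK f); exact: Lspace_piP.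
Qed.

HB.instance Definition _ := Lmodule_isNormed.Build R Lsp
  Lspace_normD Lspace_normZ Lspace_norm0_eq0.

End LspaceNormed.

(* L_1([0, 1]): functions on R modulo equality almost everywhere on [0, 1]. *)
Definition L1_unit_interval (R : realType) : normedModType R :=
  LspaceType1 (mrestr (@lebesgue_measure R) (measurable_itv `[0, 1])).

(* ell_1 is L_1 of nat with the counting measure; its norm is spelled out in
   ell1_normE. *)
Definition ell1 (R : realType) : normedModType R :=
  LspaceType1 (@counting nat R).

Lemma ell1_normE (R : realType) (u : ell1 R) :
  (`|u|%:E = \sum_(n <oo) `|(Lspace_repr u n)%:E|)%E.
Proof.
by rewrite finite_norm_fine Lnorm1 ge0_integral_count.
Qed.

Section SubMetric.
Context {R : realType} {T : metricType R} (A : set T).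

Let sub_dist (x y : A) : R := mdist (set_val x) (set_val y).

Let sub_dist_ge0 x y : 0 <= sub_dist x y.
Proof. exact: mdist_ge0. Qed.

Let sub_dist_positivity x y : sub_dist x y = 0 -> x = y.
Proof. by move=> /mdist_positivity/val_inj. Qed.

Let sub_ballEmdist (x : A) d : ball x d = [set y | sub_dist x y < d].
Proof.
by apply/seteqP; split=> y /=; rewrite /ball/= /initial_ball ballEmdist.
Qed.

HB.instance Definition _ := PseudoMetric_isMetric.Build R (A : Type)
  sub_dist_ge0 sub_dist_positivity sub_ballEmdist.

End SubMetric.

Definition separable (T : topologicalType) : Prop :=
  exists2 D : set T, countable D & dense D.

Section RTree.
Context {R : realType} {T : metricType R}.
Local Notation lambda := (@lebesgue_measure R).

(* Only the values of f on [0, mdist a b] are relevant. *)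
Definition geodesic (a b : T) (f : R -> T) : Prop :=
  [/\ {in `[0, mdist a b] &, forall s t, mdist (f s) (f t) = `|s - t|},
      f 0 = a & f (mdist a b) = b].

Definition is_rtree : Prop :=
  [/\ forall a b, exists f, geodesic a b f,
      forall a b f g, geodesic a b f -> geodesic a b g ->
        {in `[0, mdist a b], f =1 g} &
      forall g : R -> T,
        {within `[0, 1], continuous g} -> {in `[0, 1] &, injective g} ->
        forall f, geodesic (g 0) (g 1) f ->
          g @` `[0, 1] = f @` `[0, mdist (g 0) (g 1)]].

Definition segment_map (a b : T) : R -> T := xget (cst a) (geodesic a b).

Definition segment (a b : T) : set T := segment_map a b @` `[0, mdist a b].

Definition branching_points : set T :=
  [set t | (`I_3 #<=
    [set connected_component (~` [set t]) x | x in ~` [set t]])%card].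

Definition segment_preimage (a b : T) (B : set T) : set R :=
  `[0, mdist a b] `&` segment_map a b @^-1` B.

Definition length_measurable (B : set T) : Prop :=
  forall a b, (completed_algebra_gen lambda).-sigma.-measurable
    (segment_preimage a b B).

(* lambda is total on subsets of R: it is the Lebesgue outer measure, which is
   the Lebesgue measure on all Lebesgue measurable sets. *)
Definition segment_measure (a b : T) (B : set T) : \bar R :=
  lambda (segment_preimage a b B).

(* A finite family of segments is given by the pairs of their end points. *)
Definition length_measure (B : set T) : \bar R :=
  ereal_sup [set l | exists (n : nat) (s : 'I_n -> T * T),
    trivIset setT (fun k => segment (s k).1 (s k).2) /\
    l = (\sum_(k < n) segment_measure (s k).1 (s k).2 B)%E].

Lemma segment_mapP a b : is_rtree -> geodesic a b (segment_map a b).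
Proof. by case=> ex _ _; exact: xgetPex (ex a b). Qed.

Lemma segment_map_continuous a b : is_rtree ->
  {within `[0, mdist a b], continuous (segment_map a b)}.
Proof.
move=> tree; have [iso _ _] := segment_mapP a b tree.
apply/subspace_continuousP => x abx.
apply/metricType_numDomainType.cvgrPdist_lt => e e0.
rewrite near_withinE; near=> y => aby.
by rewrite iso//; near: y; exact: cvgr_dist_lt.
Unshelve. all: by end_near. Qed.

Lemma closed_length_measurable (B : set T) :
  is_rtree -> closed B -> length_measurable B.
Proof.
move=> tree cB a b.
have cp : closed (segment_preimage a b B).
  have := @segment_map_continuous a b tree.
  move=> /continuous_closedP/(_ B cB).
  by rewrite closed_setSI//; exact: itv_closed.
rewrite completed_caratheodory_measurable; apply: sub_caratheodory.
exact: closed_measurable.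
Qed.

End RTree.
Arguments is_rtree {R} T.
Arguments branching_points {R} T.

(* Main.v *)
Require Import Defs.
From HB Require Import structures.
From mathcomp Require Import all_boot all_order all_algebra.
From mathcomp Require Import all_classical all_reals all_analysis.
From mathcomp Require Import measurable_realfun ring lra.
Set Implicit Arguments.
Unset Strict Implicit.
Unset Printing Implicit Defensive.
Import Order.TTheory GRing.Theory Num.Theory.
Import numFieldNormedType.Exports HBSimple.
Local Open Scope classical_set_scope.
Local Open Scope ring_scope.

(** Fix a point [o] of [A], a sequence [a n] dense in the closure [B] of [A], and
    let [X] be the Lipschitz-free space of [A].  Point masses depend continuously
    on the point, so they extend to [B], and [X] is also the free space of [B]
    (mass_free).  What is used of this is recorded in [is_free]: increments of
    point masses are dominated by distances, every 1-Lipschitz function on [B] is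
    integrated by a functional of norm at most 1, and increments are total.

    Flattening the tree.  Let [low n] be the height above [o] at which the segment
    from [o] to [a n] leaves the segments to [a k], k < n.  The arcs of heights
    [low n, height n] do not overlap, and every point of [B] is a limit of points
    [a n], hence is reached through these arcs.  The foot of an arc is a meeting
    point of two segments, so it is [o], an end point or a branching point; in all
    cases it is in [B] (meet_mem).  Consequently a 1-Lipschitz function on [B] is
    the same thing as an independent choice of a 1-Lipschitz function on the trace
    of [B] on each arc: the coordinates [tau n] along the arcs satisfy
    \sum_n |tau n x - tau n y| <= d x y (tau_sum).  Scaling an arc does not change
    the free space of its trace, so the arcs may be scaled to summable lengths and
    laid end to end on the real line.  This gives a compact set [glued] of reals
    for which [X] is again the free space (glue_free), and which is null exactly
    when [B] has length measure 0, because Lipschitz images of null sets are null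
    (length_null, length_pos).

    Closed sets of reals.  Let K be closed in [0, L], with 0 and L in K.  For t in
    K the number t is the sum of [theta t], the measure of K below t, and of the
    lengths of the gaps of K below t (nu_series).  A 1-Lipschitz function on K has
    arbitrary slopes of modulus at most 1 on the gaps, plus an arbitrary
    1-Lipschitz function of [theta] (structure_functional).  Dually, [X] is
    generated by the normalised increments [atom i] across the gaps and by a curve
    [diffuse] that moves at most as fast as [theta] (structure_span): it is the
    direct sum, in the l1 sense, of l1 over the gaps and of L1 over [0, theta L].

    Null case.  If K is null, [diffuse] vanishes, and K, being infinite, has
    infinitely many gaps.  The atoms then behave exactly as the unit vectors of l1
    (isometric_case).

    Positive case.  The indicators of ]0, u] generate L1, and among all families
    that move at most as fast as u their combinations have the largest norm, with
    equality for [diffuse] (comb_bounds).  The set of gaps may be empty, finite or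
    infinite, so l1 over the gaps has to be absorbed by L1.  The normalised
    indicators of the intervals ]2^-(n+1), 2^-n] are the unit vectors of a
    complemented copy of l1 in L1; moving them along an injection of the indices
    ([hotel]) leaves as many of them free as there are gaps.  This changes norms by
    bounded factors only (isomorphic_case).

    In both cases the isomorphism is built by generators_iso: two total families
    whose finite combinations have comparable norms span isomorphic spaces. *)

(** * Geodesics and medians *)

Section Tripod.
Context {R : realType} {T : metricType R}.
Local Notation d := (@mdist R T).

Lemma geodesic_dist (a b : T) f s t : geodesic a b f ->
  0 <= s <= d a b -> 0 <= t <= d a b -> d (f s) (f t) = `|s - t|.
Proof. by move=> [iso _ _] hs ht; apply: iso; rewrite in_itv. Qed.

Lemma geodesic_distl (a b : T) f s : geodesic a b f -> 0 <= s <= d a b ->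
  d a (f s) = s.
Proof.
move=> gf hs; have [_ f0 _] := gf; rewrite -[X in d X _]f0.
rewrite (geodesic_dist gf)// ?lexx ?mdist_ge0// sub0r normrN ger0_norm//.
by case/andP: hs.
Qed.

Lemma geodesic_distr (a b : T) f s : geodesic a b f -> 0 <= s <= d a b ->
  d (f s) b = d a b - s.
Proof.
move=> gf hs; have [_ _ f1] := gf; rewrite -[X in d _ X]f1.
rewrite (geodesic_dist gf)// ?lexx ?mdist_ge0// distrC ger0_norm//.
by case/andP: hs; rewrite subr_ge0.
Qed.

(** The two geodesics from [x] have a last common point [m], at distance
    s = sup of the parameters where they agree.  Running backwards from [y] to [m]
    along the first one and then from [m] to [z] along the second one is injective
    by the choice of [s], and injective paths in a tree run along segments, so its
    range is the segment from [y] to [z]; this puts [m] between [y] and [z]. *)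
Lemma tripod (tree : is_rtree T) (x y z : T) : exists m,
  [/\ d x m + d m y = d x y, d x m + d m z = d x z & d y m + d m z = d y z].
Proof.
have [ex un arc] := tree.
have [f gf] := ex x y; have [g gg] := ex x z.
pose S := [set s | [/\ 0 <= s, s <= d x y, s <= d x z & f s = g s]].
have S0 : S 0.
  by split; rewrite ?mdist_ge0//; case: gf => _ -> _; case: gg => _ -> _.
have supS : has_sup S by split; [exists 0 | exists (d x y) => s []].
pose s := sup S.
have s0 : 0 <= s by apply: sup_upper_bound.
have sxy : s <= d x y by apply: ge_sup; [exists 0|move=> t []].
have sxz : s <= d x z by apply: ge_sup; [exists 0|move=> t []].
have fs : f s = g s.
  apply/mdist_positivity/eqP; rewrite eq_le mdist_ge0 andbT.
  apply/ler_addgt0Pl => e e0; rewrite addr0.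
  have [t [t0 txy txz ft] st] := sup_adherent (divr_gt0 e0 (ltr0Sn _ 1)) supS.
  have ts : t <= s by apply: sup_upper_bound.
  rewrite (le_trans (metric_triangle _ (f t) _))// {2}ft.
  rewrite (geodesic_dist gf) ?s0 ?t0// (geodesic_dist gg) ?s0 ?t0//.
  rewrite -/s in st.
  by rewrite ger0_norm ?subr_ge0// ler0_norm ?subr_le0//; lra.
have Ss t : S t -> t <= s by move=> St; apply: sup_upper_bound.
have xm := geodesic_distl gf (introT andP (conj s0 sxy)).
have my := geodesic_distr gf (introT andP (conj s0 sxy)).
have mz := geodesic_distr gg (introT andP (conj s0 sxz)).
exists (f s); split; [by rewrite xm my; ring|by rewrite xm {1}fs mz; ring|].
have [sy|nsy] := eqVneq s (d x y).
  by case: gf => _ _ fy; rewrite sy fy mdistxx add0r.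
have [sz|nsz] := eqVneq s (d x z).
  by case: gg => _ _ gz; rewrite fs sz gz mdistxx addr0.
pose a := d x y - s; pose b := d x z - s.
have a0 : 0 < a by rewrite subr_gt0 lt_neqAle nsy.
have b0 : 0 < b by rewrite subr_gt0 lt_neqAle nsz.
(* Affine parameter of the concatenated path: v runs over [-a, b] when u runs over
   [0, 1], and v = 0 is the point m. *)
pose v u := u * (a + b) - a.
pose k u := if v u <= 0 then f (s - v u) else g (s + v u).
have vb u : 0 <= u <= 1 -> - a <= v u <= b.
  move=> /andP[u0 u1]; rewrite /v; apply/andP; split; nra.
have k0 : k 0 = y.
  have -> : k 0 = f (d x y).
    rewrite /k /v mul0r sub0r oppr_le0 (ltW a0); congr f.
    by rewrite opprK /a; ring.
  by case: gf.
have k1 : k 1 = z.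
  have -> : k 1 = g (d x z).
    rewrite /k /v mul1r addrC addKr leNgt b0/=; congr g.
    by rewrite /b; ring.
  by case: gg.
have kopp u u' : 0 <= u <= 1 -> 0 <= u' <= 1 -> v u <= 0 -> 0 < v u' ->
    d (k u) (k u') <= v u' - v u.
  move=> hu hu' vu vu'; rewrite /k vu (lt_geF vu')/=.
  have /andP[h1 h2] := vb _ hu; have /andP[h3 h4] := vb _ hu'.
  rewrite (le_trans (metric_triangle _ (f s) _))// {2}fs.
  rewrite (geodesic_dist gf) ?(geodesic_dist gg) ?s0//.
  - have -> : s - v u - s = - v u by ring.
    have -> : s - (s + v u') = - v u' by ring.
    by rewrite !normrN ler0_norm// gtr0_norm//; lra.
  - by move: h4; rewrite /b; lra.
  - by move: h1; rewrite /a; lra.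
have ksame1 u u' : 0 <= u <= 1 -> 0 <= u' <= 1 -> v u <= 0 -> v u' <= 0 ->
    d (k u) (k u') = `|v u' - v u|.
  move=> hu hu' vu vu'; rewrite /k vu vu'/=.
  have /andP[h1 h2] := vb _ hu; have /andP[h3 h4] := vb _ hu'.
  rewrite (geodesic_dist gf); first by congr (`|_|); ring.
  - by move: h1; rewrite /a; lra.
  - by move: h3; rewrite /a; lra.
have ksame2 u u' : 0 <= u <= 1 -> 0 <= u' <= 1 -> 0 < v u -> 0 < v u' ->
    d (k u) (k u') = `|v u' - v u|.
  move=> hu hu' vu vu'; rewrite /k !leNgt vu vu'/=.
  have /andP[h1 h2] := vb _ hu; have /andP[h3 h4] := vb _ hu'.
  rewrite (geodesic_dist gg); first by rewrite distrC; congr (`|_|); ring.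
  - by move: h2; rewrite /b; lra.
  - by move: h4; rewrite /b; lra.
have klip u u' : 0 <= u <= 1 -> 0 <= u' <= 1 -> d (k u) (k u') <= `|v u' - v u|.
  move=> hu hu'; have [vu|vu] := leP (v u) 0; have [vu'|vu'] := leP (v u') 0.
  - by rewrite ksame1.
  - by apply: le_trans (kopp _ _ hu hu' vu vu') _; rewrite ler_norm.
  - rewrite metric_sym distrC.
    by apply: le_trans (kopp _ _ hu' hu vu' vu) _; rewrite ler_norm.
  - by rewrite ksame2.
have kcont : {within `[0, 1], continuous k}.
  apply/subspace_continuousP => u u01.
  apply/metricType_numDomainType.cvgrPdist_lt => e e0.
  rewrite near_withinE; near=> w => w01.
  apply: le_lt_trans (klip _ _ _ _) _; [by move: u01; rewrite /= in_itv|by move: w01; rewrite /= in_itv|].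
  have -> : v w - v u = (w - u) * (a + b) by rewrite /v; ring.
  rewrite normrM (gtr0_norm (addr_gt0 a0 b0)).
  rewrite -(ltr_pdivlMr _ _ (addr_gt0 a0 b0)) distrC; near: w.
  by apply: cvgr_dist_lt => //; rewrite divr_gt0// addr_gt0.
have kopp' u u' : 0 <= u <= 1 -> 0 <= u' <= 1 -> v u <= 0 -> 0 < v u' ->
    k u <> k u'.
  move=> hu hu' vu vu'; have /andP[h1 h2] := vb _ hu; have /andP[h3 h4] := vb _ hu'.
  rewrite /k vu (lt_geF vu')/= => e; have := congr1 (d x) e.
  have hsu : 0 <= s - v u <= d x y by move: h1; rewrite /a; lra.
  have hsu' : 0 <= s + v u' <= d x z by move: h4; rewrite /b; lra.
  rewrite (geodesic_distl gf hsu) (geodesic_distl gg hsu') => eqs.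
  rewrite eqs in e hsu; suff: s + v u' <= s by lra.
  by apply: Ss; split => //; lra.
have vinj u u' : `|v u' - v u| = 0 -> u = u'.
  have -> : v u' - v u = (u' - u) * (a + b) by rewrite /v; ring.
  move=> /normr0_eq0/eqP.
  by rewrite mulf_eq0 (gt_eqF (addr_gt0 a0 b0)) orbF subr_eq0 => /eqP.
have kinj : {in `[0, 1] &, injective k}.
  move=> u u'; rewrite !in_itv/= => hu hu' e.
  have [vu|vu] := leP (v u) 0; have [vu'|vu'] := leP (v u') 0.
  - by apply: vinj; rewrite -ksame1// e mdistxx.
  - by case: (kopp' u u').
  - by case: (kopp' u' u).
  - by apply: vinj; rewrite -ksame2// e mdistxx.
have [h gh] := ex y z.
have := arc k kcont kinj h; rewrite k0 k1 => /(_ gh) range.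
have : (k @` `[0, 1]) (f s).
  exists (a / (a + b)).
    rewrite /= in_itv/=; apply/andP; split.
      by rewrite divr_ge0 ?(ltW a0)// ltW// addr_gt0.
    by rewrite (ler_pdivrMr _ _ (addr_gt0 a0 b0)) mul1r lerDl ltW.
  have abn0 : a + b != 0 by rewrite gt_eqF// addr_gt0.
  by rewrite /k /v divfK// subrr lexx subr0.
rewrite range => -[t]; rewrite /= in_itv/= => ht <-.
by rewrite (geodesic_distl gh)// (geodesic_distr gh)//; ring.
Unshelve. all: by end_near. Qed.

End Tripod.

(** * The Gromov product *)

Section Gromov.
Context {R : realType} {T : metricType R}.
Local Notation d := (@mdist R T).

Definition gprod (p x y : T) : R := (d p x + d p y - d x y) / 2.

Lemma gprodC p x y : gprod p x y = gprod p y x.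
Proof. by rewrite /gprod (addrC (d p x)) (metric_sym x). Qed.

Lemma gprod_ge0 p x y : 0 <= gprod p x y.
Proof.
rewrite /gprod divr_ge0// subr_ge0 (le_trans (metric_triangle _ p _))//.
by rewrite (metric_sym x).
Qed.

Lemma gprod_le p x y : gprod p x y <= d p x.
Proof. by have := metric_triangle p x y; rewrite /gprod; lra. Qed.

Lemma gprod_ler p x y : gprod p x y <= d p y.
Proof. by rewrite gprodC gprod_le. Qed.

Lemma gprodxx p x : gprod p x x = d p x.
Proof. by rewrite /gprod mdistxx subr0; field. Qed.

Lemma gprodpx p x : gprod p p x = 0.
Proof. by rewrite /gprod mdistxx add0r subrr mul0r. Qed.

Lemma gprod_lip p x y z : `|gprod p x y - gprod p x z| <= d y z.
Proof.
have h1 := metric_triangle p y z; have h2 := metric_triangle p z y.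
have h3 := metric_triangle x y z; have h4 := metric_triangle x z y.
rewrite (metric_sym z y) in h2 h4.
by rewrite /gprod ler_norml; lra.
Qed.

Hypothesis tree : is_rtree T.

(** Geodesics from [a] to [m] and from [m] to [b] concatenate to a geodesic, and
    geodesics are unique. *)
Lemma between_segment a b m : d a m + d m b = d a b ->
  m = segment_map a b (d a m).
Proof.
move=> amb; have gf := segment_mapP a m tree; have gg := segment_mapP m b tree.
set f := segment_map a m in gf; set g := segment_map m b in gg.
have a0 : 0 <= d a m := mdist_ge0 _ _; have b0 : 0 <= d m b := mdist_ge0 _ _.
have fm : f (d a m) = m by case: gf.
have gm : g 0 = m by case: gg.
pose h s := if s <= d a m then f s else g (s - d a m).
have h1 s : 0 <= s -> s <= d a m -> h s = f s by rewrite /h => _ ->.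
have h2 s : d a m <= s -> h s = g (s - d a m).
  rewrite /h; have [sm ms|//] := leP s (d a m).
  have -> : s = d a m by apply/le_anti/andP.
  by rewrite subrr gm.
have hh s t : 0 <= s -> s <= d a m -> d a m <= t -> t <= d a b ->
    d (h s) (h t) = t - s.
  move=> s0 sm mt tb; rewrite h1// h2//.
  have s0m : 0 <= s <= d a m by rewrite s0.
  have t0m : 0 <= t - d a m <= d m b by rewrite subr_ge0 mt; lra.
  have e1 := geodesic_distl gf s0m; have e2 := geodesic_distr gf s0m.
  have e3 := geodesic_distl gg t0m; have e4 := geodesic_distr gg t0m.
  have i1 := metric_triangle (f s) m (g (t - d a m)).
  have i2 := metric_triangle a (f s) b.
  have i3 := metric_triangle (f s) (g (t - d a m)) b.
  by apply/le_anti/andP; split; lra.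
have gh : geodesic a b h.
  split.
  - move=> s t; rewrite !in_itv/= => /andP[s0 sb] /andP[t0 tb].
    have [sm|ms] := leP s (d a m); have [tm|mt] := leP t (d a m).
    + by rewrite !h1// (geodesic_dist gf) ?s0 ?t0.
    + by rewrite hh ?(ltW mt)// distrC ger0_norm//; lra.
    + by rewrite metric_sym hh ?(ltW ms)// ger0_norm//; lra.
    + rewrite !h2 ?ltW// (geodesic_dist gg); [|lra|lra].
      by congr (`|_|); ring.
  - by rewrite h1//; case: gf.
  - rewrite h2 -?amb ?lerDl// addrC addKr; by case: gg.
have [_ un _] := tree.
have /(_ (d a m)) := un _ _ _ _ (segment_mapP a b tree) gh.
rewrite in_itv/= a0 -amb lerDl b0 => /(_ isT) ->.
by rewrite h1.
Qed.

Lemma segment_dist a b s t : 0 <= s <= d a b -> 0 <= t <= d a b ->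
  d (segment_map a b s) (segment_map a b t) = `|s - t|.
Proof. exact: geodesic_dist (segment_mapP a b tree). Qed.

Lemma segment_distl a b s : 0 <= s <= d a b -> d a (segment_map a b s) = s.
Proof. exact: geodesic_distl (segment_mapP a b tree). Qed.

Lemma segment_distr a b s : 0 <= s <= d a b ->
  d (segment_map a b s) b = d a b - s.
Proof. exact: geodesic_distr (segment_mapP a b tree). Qed.

Lemma segment_map0 (a b : T) : segment_map a b 0 = a.
Proof. by case: (segment_mapP a b tree). Qed.

Lemma segment_map1 (a b : T) : segment_map a b (d a b) = b.
Proof. by case: (segment_mapP a b tree). Qed.

(** The Gromov product of [x] and [y] is the distance from [p] to their median.  The
    medians of [p, x, y] and of [p, y, z] both lie on the segment from [p] to [y],
    so their distance is the difference of the two products; the triangle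
    inequality along x, m, n, z gives the claim. *)
Lemma gprod_ultra p x y z :
  Num.min (gprod p x y) (gprod p y z) <= gprod p x z.
Proof.
have [m [pmx pmy xmy]] := tripod tree p x y.
have [n [pny pnz ynz]] := tripod tree p y z.
have em : gprod p x y = d p m.
  by rewrite /gprod -pmx -pmy -xmy (metric_sym x m); field.
have en : gprod p y z = d p n.
  by rewrite /gprod -pny -pnz -ynz (metric_sym y n); field.
have mn : d m n = `|d p m - d p n|.
  rewrite {1}(between_segment pmy) {1}(between_segment pny) segment_dist//.
  - by rewrite mdist_ge0 -pmy lerDl mdist_ge0.
  - by rewrite mdist_ge0 -pny lerDl mdist_ge0.
have i1 := metric_triangle x m z; have i2 := metric_triangle m n z.
rewrite em en ge_min {1 2}/gprod -pmx -pnz.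
rewrite (metric_sym x m) mn in i1 i2.
have [h|h] := leP (d p m) (d p n).
  by rewrite ler0_norm in i2; lra.
by rewrite gtr0_norm in i2; lra.
Qed.

(** In the complement of [m], the points whose Gromov product with [x] is positive
    form an open set.  By gprod_ultra its complement is open as well: points closer
    to each other than to [m] have a positive product.  Hence this set is a union of
    components; it contains [x] and not [y]. *)
Lemma gprod_separates (m x y : T) : m <> x -> m <> y -> gprod m x y = 0 ->
  connected_component (~` [set m]) x <> connected_component (~` [set m]) y.
Proof.
move=> mx my xy0 exy.
have : connected_component (~` [set m]) x y.
  by rewrite exy; apply: connected_component_refl; apply: nesym.
move=> [C [Cx Cm cC] Cy].
pose U := [set p | 0 < gprod m x p].
have oU : open U.
  rewrite openE => p /= Up; apply/metricType_numDomainType.nbhs_mdistP.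
  exists (gprod m x p) => // q /= pq.
  by have := gprod_lip m x p q; rewrite ler_norml /U/=; lra.
have cl : C `&` U = C.
  apply: cC; first by exists x; split => //=; rewrite /U/= gprodxx mdist_gt0; apply/eqP.
  - by exists U.
  exists (~` [set q | m <> q /\ gprod m x q <= 0]).
    apply: open_closedC; rewrite openE => p /= [mp Vp].
    apply/metricType_numDomainType.nbhs_mdistP.
    exists (d m p); first by rewrite /= mdist_gt0; apply/eqP.
    move=> q /= pq; split.
      by move=> mq; rewrite mq metric_sym ltxx in pq.
    have := gprod_ultra m x q p; rewrite ge_min => /orP[]; first by move/le_trans; apply.
    have : 0 < gprod m q p.
      rewrite /gprod (metric_sym q p) divr_gt0//.
      by have := mdist_ge0 m q; lra.
    lra.
  apply/seteqP; split=> p /= [Cp]; rewrite /U/=.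
    by move=> Up; split => // -[_]; lra.
  move=> h; split => //; rewrite ltNge; apply/negP => Vp; apply: h; split => //.
  by move=> mp; apply: (Cm p) => //=; rewrite mp.
have [_] : (C `&` U) y by rewrite cl.
by rewrite /U/= xy0 ltxx.
Qed.

(** A point that lies between any two of three points other than itself separates
    them pairwise. *)
Lemma tripod_branching (m x y z : T) : m <> x -> m <> y -> m <> z ->
  gprod m x y = 0 -> gprod m x z = 0 -> gprod m y z = 0 ->
  branching_points T m.
Proof.
move=> mx my mz xy xz yz; rewrite /branching_points/=.
pose c := connected_component (~` [set m]).
pose f i := c (nth x [:: x; y; z] i).
have finj : {in `I_3 &, injective f}.
  have nxy := gprod_separates mx my xy.
  have nxz := gprod_separates mx mz xz.
  have nyz := gprod_separates my mz yz.
  move=> i j; rewrite !inE/= => hi hj.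
  case: i hi => [|[|[|//]]] _; case: j hj => [|[|[|//]]] _; rewrite /f/= => e //;
    by [case: (nxy e)|case: (nxy (esym e))|case: (nxz e)|case: (nxz (esym e))
       |case: (nyz e)|case: (nyz (esym e))].
apply: (@card_le_trans _ _ _ (f @` `I_3)).
  by have := inj_card_eq finj; rewrite card_eq_le => /andP[].
apply: subset_card_le => _ [i /= i3 <-].
exists (nth x [:: x; y; z] i) => //.
by case: i i3 => [|[|[|//]]] _ /=; apply: nesym.
Qed.

End Gromov.

(** * Sums of increments over disjoint intervals *)

Lemma max_lip (R : realDomainType) (a x y : R) :
  `|Num.max a x - Num.max a y| <= `|x - y|.
Proof.
wlog xy : x y / x <= y.
  move=> W; case: (leP x y) => h; first exact: W.
  by rewrite distrC [leRHS]distrC; apply: W; exact: ltW.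
rewrite distrC [leRHS]distrC !ger0_norm ?subr_ge0 ?le_max2//.
by case: (leP a x) => h1; case: (leP a y) => h2; lra.
Qed.

Lemma min_lip (R : realDomainType) (a x y : R) :
  `|Num.min x a - Num.min y a| <= `|x - y|.
Proof.
wlog xy : x y / x <= y.
  move=> W; case: (leP x y) => h; first exact: W.
  by rewrite distrC [leRHS]distrC; apply: W; exact: ltW.
rewrite distrC [leRHS]distrC !ger0_norm ?subr_ge0 ?le_min2//.
by case: (leP x a) => h1; case: (leP y a) => h2; lra.
Qed.

Section Gaps.
Context {R : realType}.

Lemma gap_split (V : zmodType) (a b c e A C : V) :
  a - b - (c - e + (A + C)) = (e - b - A) + (a - c - C).
Proof.
by rewrite !opprD !opprK !addrA [LHS](ACl (4*2*5*1*3*6)).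
Qed.

(** Removing disjoint intervals [u i, v i] from [t, t'] leaves finitely many
    intervals with end points in [K]; the increments of [E] over those are bounded
    by their lengths.  The induction splits at one of the intervals into the parts
    on its left and on its right. *)
Lemma gap_sum (V : normedModType R) (E : R -> V) (K : set R) (I : eqType)
    (s : seq I) (u v : I -> R) (t t' : R) :
  (forall x y, K x -> K y -> `|E x - E y| <= `|x - y|) ->
  K t -> K t' -> t <= t' ->
  {in s, forall i, [/\ K (u i), K (v i), t <= u i, u i <= v i & v i <= t']} ->
  {in s &, forall i j, i != j -> v i <= u j \/ v j <= u i} -> uniq s ->
  `|E t' - E t - \sum_(i <- s) (E (v i) - E (u i))|
    <= t' - t - \sum_(i <- s) (v i - u i).
Proof.
move=> Elip; have [n] := ubnP (size s).
elim: n s t t' => // n IH [|i s] t t' sn Kt Kt' tt' hs ds us.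
  by rewrite !big_nil !subr0 (le_trans (Elip _ _ Kt' Kt))// ger0_norm ?subr_ge0.
have [Kui Kvi tui uvi vit'] := hs i (mem_head _ _).
have /andP[nis us'] : (i \notin s) && uniq s by [].
pose s1 := [seq j <- s | v j <= u i]; pose s2 := [seq j <- s | ~~ (v j <= u i)].
have mem_tl j : j \in s -> j \in i :: s by rewrite inE orbC => ->.
have ss1 : (size s1 < n)%N by rewrite size_filter (leq_ltn_trans (count_size _ _)).
have ss2 : (size s2 < n)%N by rewrite size_filter (leq_ltn_trans (count_size _ _)).
have h1 : `|E (u i) - E t - \sum_(i <- s1) (E (v i) - E (u i))|
    <= u i - t - \sum_(i <- s1) (v i - u i).
  apply: IH => //.
  - move=> j; rewrite mem_filter => /andP[vj js].
    by have [? ? ? ? ?] := hs j (mem_tl _ js); split.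
  - move=> j k; rewrite !mem_filter => /andP[_ js] /andP[_ ks].
    by apply: ds; exact: mem_tl.
  - exact: filter_uniq.
have h2 : `|E t' - E (v i) - \sum_(i <- s2) (E (v i) - E (u i))|
    <= t' - v i - \sum_(i <- s2) (v i - u i).
  apply: IH => //.
  - move=> j; rewrite mem_filter => /andP[vj js].
    have [? ? ? ? ?] := hs j (mem_tl _ js); split => //.
    have ij : i != j by apply: contraNneq nis => ->.
    have [//|vju] := ds i j (mem_head _ _) (mem_tl _ js) ij.
    by rewrite vju in vj.
  - move=> j k; rewrite !mem_filter => /andP[_ js] /andP[_ ks].
    by apply: ds; exact: mem_tl.
  - exact: filter_uniq.
have spl (W : nmodType) (F : I -> W) :
    \sum_(j <- s) F j = \sum_(j <- s1) F j + \sum_(j <- s2) F j.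
  by rewrite (bigID (fun j => v j <= u i))/= !big_filter.
rewrite !big_cons !spl gap_split.
apply: (le_trans (ler_normD _ _)); apply: (le_trans (lerD h1 h2)).
by rewrite [leRHS]gap_split.
Qed.

End Gaps.

Section Rooted.
Context {R : realType} {T : metricType R}.
Local Notation d := (@mdist R T).
Hypothesis tree : is_rtree T.
Variable o : T.

Definition gp x y := gprod o x y.
Definition phi y t := segment_map o y t.

Lemma gpC x y : gp x y = gp y x. Proof. exact: gprodC. Qed.

Lemma gp_ultra y x z t : t <= gp x y -> t <= gp y z -> t <= gp x z.
Proof.
move=> h1 h2; apply: le_trans (gprod_ultra tree o x y z).
by rewrite le_min h1 h2.
Qed.

Lemma phi_height y t : 0 <= t <= d o y -> d o (phi y t) = t.
Proof. exact: segment_distl. Qed.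

Lemma gp_phi_self y t : 0 <= t <= d o y -> gp (phi y t) y = t.
Proof.
by move=> ht; rewrite /gp /gprod segment_distl// segment_distr//; field.
Qed.

(** Seen from the root, [phi y t] is the point of the segment to [y] at height [t].
    The segments to [x] and [y] agree up to height gp x y, which explains the
    minimum; both inequalities are instances of the ultrametric inequality. *)
Lemma gp_phi x y t : 0 <= t <= d o y -> gp x (phi y t) = Num.min t (gp x y).
Proof.
move=> ht; have e := gp_phi_self ht.
have le_t : gp x (phi y t) <= t by rewrite -[leRHS](phi_height ht) gprod_ler.
apply/le_anti/andP; split.
  rewrite le_min le_t/=; apply: (@gp_ultra (phi y t)) => //.
  by rewrite e.
apply: (@gp_ultra y); first by rewrite ge_min lexx orbT.
by rewrite [leRHS]gpC e ge_min lexx.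
Qed.

Lemma phi_eq x y t : 0 <= t <= gp x y -> phi x t = phi y t.
Proof.
move=> /andP[t0 txy].
have tx : 0 <= t <= d o x by rewrite t0 (le_trans txy)// gprod_le.
have ty : 0 <= t <= d o y by rewrite t0 (le_trans txy)// gprod_ler.
apply: mdist_positivity.
have : gp (phi x t) (phi y t) = t.
  by rewrite gp_phi// gpC gp_phi// gpC (min_idPl txy) minxx.
by rewrite /gp /gprod !phi_height//; lra.
Qed.

Lemma phi_dist y s t : 0 <= s <= d o y -> 0 <= t <= d o y ->
  d (phi y s) (phi y t) = `|s - t|.
Proof. exact: segment_dist. Qed.

Lemma phi0 y : phi y 0 = o. Proof. exact: segment_map0. Qed.

Lemma phi1 y : phi y (d o y) = y. Proof. exact: segment_map1. Qed.

(** The point where the segments to [x] and [y] part is the median of o, x and y,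
    hence one of them or a branching point. *)
Lemma meet_mem (B : set T) x y : branching_points T `<=` B -> B o -> B x ->
  B y -> B (phi y (gp x y)).
Proof.
move=> brB Bo Bx By; set m := phi y _.
have h : 0 <= gp x y <= d o y by rewrite gprod_ge0 gprod_ler.
have dom : d o m = gp x y by exact: phi_height.
have dmy : d m y = d o y - gp x y by exact: segment_distr.
have dxm : d m x = d o x - gp x y.
  have : gp x m = gp x y by rewrite gp_phi// minxx.
  by rewrite {1}/gp /gprod dom (metric_sym m); lra.
have [->//|mo] := pselect (m = o).
have [->//|mx] := pselect (m = x).
have [->//|my] := pselect (m = y).
apply: brB; apply: (tripod_branching tree mo mx my).
- by rewrite /gprod metric_sym dom dxm; field.
- by rewrite /gprod metric_sym dom dmy; field.
- by rewrite /gprod dxm dmy /gp /gprod; field.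
Qed.

End Rooted.

(** * Decomposition of a tree into arcs *)

Section Pieces.
Context {R : realType} {T : metricType R}.
Local Notation d := (@mdist R T).
Hypothesis tree : is_rtree T.
Variables (o : T) (B : set T).
Hypotheses (brB : branching_points T `<=` B) (Bo : B o).
Variable a : nat -> T.
Hypothesis aB : forall n, B (a n).
Local Notation gp := (gp o).
Local Notation phi := (phi o).

(** The n-th arc is the part of the segment from [o] to [a n] that is not on an
    earlier segment from [o] to [a k]; it occupies the heights between [low n] and
    [height n].  [tau n x] is the height of the projection of [x] to this arc. *)
Definition height n : R := d o (a n).
Definition low n : R := \big[Num.max/0]_(k < n) gp (a k) (a n).
Definition tau n x : R := Num.max (low n) (gp x (a n)).

Lemma low_ge0 n : 0 <= low n.
Proof.
rewrite /low; elim/big_ind: _ => [//|x y x0 y0|k _]; last exact: gprod_ge0.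
by rewrite le_max x0.
Qed.

Lemma low_ge k n : (k < n)%N -> gp (a k) (a n) <= low n.
Proof. by move=> kn; apply: (le_bigmax _ (fun k : 'I_n => _) (Ordinal kn)). Qed.

Lemma low_cases n : low n = 0 \/ exists2 k, (k < n)%N & low n = gp (a k) (a n).
Proof.
rewrite /low; elim/big_ind: _ => [|x y|k _]; [by left| |by right; exists k].
by case: (leP x y).
Qed.

Lemma low_le n : low n <= height n.
Proof.
have [->|[k _ ->]] := low_cases n; [exact: mdist_ge0|exact: gprod_ler].
Qed.

Lemma height_itv n t : low n <= t <= height n -> 0 <= t <= d o (a n).
Proof. by case/andP => lt ->; rewrite (le_trans (low_ge0 n)). Qed.

Lemma tau_itv n x : low n <= tau n x <= height n.
Proof. by rewrite le_max lexx/= ge_max low_le gprod_ler. Qed.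

Lemma low_mem n : B (phi (a n) (low n)).
Proof.
have [->|[k _ ->]] := low_cases n; first by rewrite phi0.
exact: meet_mem.
Qed.

Lemma tau_mem n x : B x -> B (phi (a n) (tau n x)).
Proof.
move=> Bx; rewrite /tau; case: leP => _; [exact: meet_mem|exact: low_mem].
Qed.

Lemma tau_o n : tau n o = low n.
Proof. by rewrite /tau /(gp _ _) gprodpx; apply/max_idPl/low_ge0. Qed.

(** Along the segment from [o] to [y], a coordinate [tau n] exceeds its value at [x]
    only above the point where the segment to [x] is left, that is between the
    heights gp x y and d o y.  The intervals of heights where this happens are
    disjoint for distinct n: at a height common to two of them, the segments to
    [a n] and [a m] would still agree above [low m]. *)
Lemma tau_incr N x y :
  \sum_(0 <= n < N | tau n x < tau n y) (tau n y - tau n x) <= d o y - gp x y.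
Proof.
have gpy : gp x y <= d o y by exact: gprod_ler.
pose s := [seq n <- index_iota 0 N | tau n x < tau n y].
have key n t : tau n x < t -> t <= tau n y -> [/\ low n < t, t <= gp y (a n) & gp x y <= tau n x].
  move=> xt ty; have lt : low n < t by rewrite (le_lt_trans _ xt)// le_max lexx.
  have ya : t <= gp y (a n) by move: ty; rewrite le_max leNgt lt.
  have xa : gp x (a n) < t by rewrite (le_lt_trans _ xt)// le_max lexx orbT.
  split => //; rewrite leNgt; apply/negP => h.
  have hh : gp x (a n) < Num.min (gp x y) t.
    by rewrite lt_min xa andbT (le_lt_trans _ h)// le_max lexx orbT.
  have := @gp_ultra _ _ tree o y x (a n) (Num.min (gp x y) t).
  rewrite ge_min lexx => /(_ isT); rewrite ge_min ya orbT => /(_ isT).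
  by rewrite leNgt hh.
have := @gap_sum R R^o id setT _ s (tau ^~ x) (tau ^~ y) (gp x y) (d o y).
move=> /(_ _ _ _ gpy) H.
rewrite -subr_ge0 -big_filter -/s.
apply: (le_trans (normr_ge0 _) (H _ _ _ _ _ _)) => //.
- move=> n; rewrite mem_filter => /andP[xy _]; split => //.
  + by have [] := key n (tau n y) xy (lexx _).
  + exact: ltW.
  + by have [_ h _] := key n (tau n y) xy (lexx _); rewrite (le_trans h)// gprod_le.
- move=> n m; rewrite !mem_filter => /andP[n1 _] /andP[m1 _].
  wlog nm : n m n1 m1 / (n < m)%N.
    move=> W; rewrite neq_ltn => /orP[nm|nm].
      by apply: W => //; rewrite neq_ltn nm.
    by rewrite orC; apply: W => //; rewrite neq_ltn nm.
  move=> _; apply: contrapT => /not_orP[/negP h1 /negP h2].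
  rewrite -!ltNge in h1 h2.
  pose t := Num.min (tau n y) (tau m y).
  have [] := key n t; [by rewrite lt_min n1 h2|by rewrite ge_min lexx|].
  move=> _ tn _.
  have [] := key m t; [by rewrite lt_min m1 h1|by rewrite ge_min lexx orbT|].
  move=> lt tm _.
  have : t <= gp (a n) (a m) by apply: (gp_ultra tree _ tm); rewrite gpC.
  by rewrite leNgt (le_lt_trans (low_ge nm) lt).
- by rewrite filter_uniq// iota_uniq.
Qed.

(** Increasing and decreasing coordinates are bounded by the two sides of the tripod
    of o, x and y. *)
Lemma tau_sum N x y : \sum_(0 <= n < N) `|tau n x - tau n y| <= d x y.
Proof.
have -> : \sum_(0 <= n < N) `|tau n x - tau n y| =
    \sum_(0 <= n < N | tau n x < tau n y) (tau n y - tau n x) +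
    \sum_(0 <= n < N | tau n y < tau n x) (tau n x - tau n y).
  rewrite 2!(big_mkcond (fun n => tau n _ < tau n _)) -big_split/=.
  apply: eq_bigr => n _; case: ltgtP => h; rewrite ?addr0 ?add0r.
  - by rewrite ltr0_norm ?opprB// subr_lt0.
  - by rewrite gtr0_norm// subr_gt0.
  - by rewrite h subrr normr0.
apply: le_trans (lerD (tau_incr _ _ _) (tau_incr _ _ _)) _.
by rewrite (gpC o y x) /(gp _ _) /gprod; lra.
Qed.

Lemma tau_phi n s : low n <= s <= height n -> tau n (phi (a n) s) = s.
Proof.
move=> hs; rewrite /tau gp_phi_self//; last exact: height_itv.
by apply/max_idPr; case/andP: hs.
Qed.

(** Between two points of the n-th arc the n-th coordinate already uses up the whole
    distance in tau_sum. *)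
Lemma tau_other n m s t : low n <= s <= height n -> low n <= t <= height n ->
  m <> n -> tau m (phi (a n) s) = tau m (phi (a n) t).
Proof.
move=> hs ht mn; apply/eqP; rewrite -subr_eq0 -normr_eq0 eq_le normr_ge0 andbT.
set x := phi _ s; set y := phi _ t.
have := tau_sum (maxn m n).+1 x y.
rewrite phi_dist//; try exact: height_itv.
rewrite (bigD1_seq n) ?mem_index_iota ?iota_uniq ?leq0n ?ltnS ?leq_maxr//=.
rewrite !tau_phi// gerDl => h; apply: (le_trans _ h).
rewrite big_mkcond (bigD1_seq m) ?mem_index_iota ?iota_uniq ?leq0n ?ltnS ?leq_maxl//=.
by rewrite ifT ?lerDl ?sumr_ge0//; [move=> i _; case: ifP|apply/eqP].
Qed.

End Pieces.

(** * Series, closed spans and free spaces *)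

Section Halves.
Context {R : realType}.

Lemma half_gt0 n : 0 < 2^-1 ^+ n :> R. Proof. by rewrite exprn_gt0 ?invr_gt0. Qed.

Lemma half_cvg : (fun n => 2^-1 ^+ n : R) @ \oo --> (0 : R).
Proof. by apply: cvg_expr; rewrite ger0_norm ?invr_ge0// invf_lt1// ltr1n. Qed.

(** Most approximating sequences below are chosen with error of order 2^-n, which
    reduces convergence to an inequality. *)
Lemma half_squeeze (V : normedModType R) (u : nat -> V) l C :
  (forall n, `|l - u n| <= C * 2^-1 ^+ n) -> u @ \oo --> l.
Proof.
move=> h; apply/cvgrPdist_le => e e0.
have hg : (fun n => C * 2^-1 ^+ n : R) @ \oo --> (C * 0 : R).
  by apply: cvgMl_tmp; exact: half_cvg.
have /cvgrPdist_le/(_ _ e0) := hg; apply: filterS => n.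
rewrite mulr0 sub0r normrN => /(le_trans _); apply.
by apply: (le_trans (h n)); exact: ler_norm.
Qed.

End Halves.
Arguments half_gt0 : clear implicits.

Section SeriesTools.
Context {R : realType}.

Lemma cvg_norm_le (V : normedModType R) (u : nat -> V) l M :
  u @ \oo --> l -> (forall n, `|u n| <= M) -> `|l| <= M.
Proof.
move=> ul uM; rewrite -(cvg_lim _ (cvg_norm ul))//.
by apply: limr_le; [apply: cvgP (cvg_norm ul)|apply: nearW].
Qed.

Lemma abs_series_cvg (V : completeNormedModType R) (u : nat -> V) M :
  (forall N, \sum_(0 <= k < N) `|u k| <= M) -> cvgn (series u).
Proof.
move=> uM; apply: normed_cvg; apply: nondecreasing_is_cvgn.
  by apply: nondecreasing_series => k _ _; exact: normr_ge0.
by exists M => _ [n _ <-]; exact: uM.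
Qed.

Lemma contractive_continuous (V W : normedModType R) (f : {linear V -> W}) C :
  (forall v, `|f v| <= C * `|v|) -> continuous f.
Proof.
move=> fC; apply: bounded_linear_continuous; apply/bounded_funP => r.
exists (`|C| * r) => x xr; rewrite (le_trans (fC x))//.
by rewrite (le_trans (ler_wpM2r (normr_ge0 _) (ler_norm C)))// ler_wpM2l.
Qed.

Lemma contractive_cvg (V W : normedModType R) (f : {linear V -> W}) C
    (u : nat -> V) l :
  (forall v, `|f v| <= C * `|v|) -> u @ \oo --> l -> f \o u @ \oo --> f l.
Proof.
by move=> fC ul; apply: continuous_cvg => //; apply: (contractive_continuous fC).
Qed.

Variable V : normedModType R.
Implicit Types S : set V.

Lemma span_gen S v : S v -> v \in closed_span_pred S.
Proof.
move=> Sv; rewrite inE; apply: subset_closure.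
exists 1%N, (fun=> 1), (fun=> v); split => //.
by rewrite big_ord_recl big_ord0 addr0 scale1r.
Qed.

Lemma span_closed S (u : nat -> V) l : u @ \oo --> l ->
  (forall n, u n \in closed_span_pred S) -> l \in closed_span_pred S.
Proof.
move=> ul uS; rewrite inE; apply: (closed_cvg (closure (linear_span S)) _ _ _ ul).
  exact: closed_closure.
by apply: nearW => n; have := uS n; rewrite inE.
Qed.

Lemma span_sub S S' : (forall v, S v -> v \in closed_span_pred S') ->
  {subset closed_span_pred S <= closed_span_pred S'}.
Proof.
move=> SS' v; rewrite !inE => vS.
suff : closure (closure (linear_span S')) v by rewrite -(closure_id _).1//; exact: closed_closure.
apply: closure_subset vS => _ [n [c [s [Ss ->]]]].
suff : \sum_(i < n) c i *: s i \in closed_span_pred S' by rewrite inE.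
by apply: rpred_sum => i _; apply: rpredZ; exact: SS'.
Qed.

Lemma span_approx S v : v \in closed_span_pred S -> forall e, 0 < e ->
  exists2 w, linear_span S w & `|v - w| < e.
Proof.
rewrite inE => vS e e0; have [w [Sw vw]] := vS _ (nbhsx_ballx v e e0).
by exists w => //; move: vw; rewrite -ball_normE.
Qed.

End SeriesTools.

Section Free.
Context {R : realType}.

Definition increments (M : Type) (S : set M) (V : normedModType R) (D : M -> V) : set V :=
  [set v | exists x y, [/\ S x, S y & v = D x - D y]].

(** The universal property of the Lipschitz-free space of [S], up to the choice of a
    base point: [D] stands for the map to point masses.  Stating it for the
    increments of [D] removes the base point, and lets one space [X] serve as free
    space of several metric spaces in turn. *)
Definition is_free (M : Type) (dist : M -> M -> R) (S : set M)
    (V : normedModType R) (D : M -> V) : Prop :=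
  [/\ forall x y, S x -> S y -> `|D x - D y| <= dist x y,
      forall h : M -> R,
        (forall x y, S x -> S y -> `|h x - h y| <= dist x y) ->
        exists z : {linear V -> R^o}, (forall v, `|z v| <= `|v|) /\
          forall x y, S x -> S y -> z (D x - D y) = h x - h y
    & forall v, v \in closed_span_pred (increments S D)].

End Free.

(** * Laying the arcs on a line *)

Section Glue.
Context {R : realType} {T : metricType R}.
Local Notation d := (@mdist R T).
Hypothesis tree : is_rtree T.
Variables (o : T) (B : set T).
Hypotheses (brB : branching_points T `<=` B) (Bo : B o) (cB : closed B).
Variable a : nat -> T.
Hypothesis aB : forall n, B (a n).
Hypothesis aD : forall x e, B x -> 0 < e -> exists n, d x (a n) < e.
Local Notation gp := (gp o).
Local Notation phi := (phi o).
Local Notation height := (height o a).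
Local Notation low := (low o a).
Local Notation tau := (tau o a).

(** The weights 2^-n / (1 + height n) make the scaled lengths [len] of the arcs
    summable.  The n-th arc is laid on [pos n, pos n.+1]; [par n] sends a real to
    the height on the n-th arc, after truncation, and [back n] is its inverse. *)
Definition weight n : R := 2^-1 ^+ n / (1 + height n).
Definition len n : R := weight n * (height n - low n).
Definition pos : nat -> R := series len.
Definition line_length : R := limn pos.
Definition clip n t : R := Num.max (pos n) (Num.min t (pos n.+1)).
Definition par n t : R := low n + (clip n t - pos n) / weight n.
Definition back n s : R := pos n + weight n * (s - low n).
Definition glued : set R :=
  [set t | 0 <= t <= line_length /\ forall n, B (phi (a n) (par n t))].

Lemma height_ge0 n : 0 <= height n. Proof. exact: mdist_ge0. Qed.

Lemma weight_gt0 n : 0 < weight n.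
Proof.
by rewrite divr_gt0 ?exprn_gt0 ?invr_gt0// (lt_le_trans ltr01)// lerDl height_ge0.
Qed.

Lemma len_ge0 n : 0 <= len n.
Proof. by rewrite mulr_ge0 ?subr_ge0 ?low_le// ltW ?weight_gt0. Qed.

Lemma len_le n : len n <= 2^-1 ^+ n.
Proof.
rewrite /len /weight -mulrA ler_piMr ?exprn_ge0 ?invr_ge0// mulrC.
have h1 : 0 < 1 + height n by rewrite (lt_le_trans ltr01)// lerDl height_ge0.
rewrite ler_pdivrMr// mul1r; have := low_ge0 o a n; lra.
Qed.

Lemma posS n : pos n.+1 = pos n + len n.
Proof. by rewrite /pos /series/= big_nat_recr. Qed.

Lemma pos0 : pos 0%N = 0.
Proof. by rewrite /pos /series/= big_nil. Qed.

Lemma pos_mono m n : (m <= n)%N -> pos m <= pos n.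
Proof.
by move=> mn; apply: (@nondecreasing_series R len predT 0) => // k _ _; exact: len_ge0.
Qed.

Lemma pos_cvg : pos @ \oo --> line_length.
Proof.
apply: (@series_le_cvg R len (geometric 1 2^-1)).
- exact: len_ge0.
- by move=> n; rewrite /geometric/= mul1r exprn_ge0// invr_ge0.
- by move=> n; rewrite /geometric/= mul1r len_le.
- by apply: is_cvg_geometric_series; rewrite ger0_norm ?invr_ge0// invf_lt1// ltr1n.
Qed.

Lemma pos_le n : pos n <= line_length.
Proof. by apply: nondecreasing_cvgn_le; [exact: pos_mono|exact: pos_cvg]. Qed.

Lemma pos_ge0 n : 0 <= pos n.
Proof. by rewrite -pos0 pos_mono. Qed.

Lemma clip_itv n t : pos n <= clip n t <= pos n.+1.
Proof.
by rewrite /clip le_max lexx/= ge_max pos_mono// ge_min lexx orbT.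
Qed.

Lemma clip_homo n s t : s <= t -> clip n s <= clip n t.
Proof.
by move=> st; rewrite le_max2 // le_min2.
Qed.

(** The truncations to consecutive intervals telescope. *)
Lemma clip_sum t N : 0 <= t ->
  \sum_(0 <= k < N) (clip k t - pos k) = Num.min t (pos N).
Proof.
move=> t0; elim: N => [|N IH]; first by rewrite big_nil pos0; apply/esym/min_idPr.
rewrite big_nat_recr//= IH /clip; have h := pos_mono (leqnSn N).
have [tN|Nt] := leP t (pos N).
  by rewrite (min_idPl (le_trans tN h)) (max_idPl tN) subrr addr0.
by rewrite (max_idPr _) ?le_min ?(ltW Nt)// addrC subrK.
Qed.

Lemma weight_par n t : weight n * (par n t - low n) = clip n t - pos n.
Proof. by rewrite /par addrC addKr mulrC divfK// gt_eqF// weight_gt0. Qed.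

Lemma par_itv n t : low n <= par n t <= height n.
Proof.
have /andP[h1 h2] := clip_itv n t; have w0 := weight_gt0 n.
have q0 : 0 <= (clip n t - pos n) / weight n by rewrite divr_ge0 ?subr_ge0 ?(ltW w0).
have qh : (clip n t - pos n) / weight n <= height n - low n.
  by rewrite ler_pdivrMr//; move: h2; rewrite posS /len; lra.
by rewrite /par; apply/andP; split; lra.
Qed.

Lemma par_lip n s t : weight n * `|par n s - par n t| = `|clip n s - clip n t|.
Proof.
rewrite -{1}(gtr0_norm (weight_gt0 n)) -normrM; congr (`|_|).
have := weight_par n s; have := weight_par n t; lra.
Qed.

Lemma rescaleK n x : (pos n + weight n * x - pos n) / weight n = x.
Proof. by rewrite addrC addKr mulrC mulKf// gt_eqF// weight_gt0. Qed.

Lemma backK n s : low n <= s <= height n -> par n (back n s) = s.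
Proof.
have h := height_ge0; move=> /andP[ls sh]; have w0 := weight_gt0 n.
have -> : par n (back n s) = low n + (back n s - pos n) / weight n.
  rewrite /par /clip; congr (_ + (_ - _) / _).
  rewrite (min_idPl _) ?(max_idPr _)//.
  - by rewrite /back lerDl mulr_ge0 ?subr_ge0// (ltW w0).
  - by rewrite posS /len /back lerD2l ler_wpM2l ?(ltW w0)// lerD2r.
by rewrite /back rescaleK addrC subrK.
Qed.

Lemma par_pos n t : t <= pos n -> par n t = low n.
Proof.
move=> tn; rewrite /par /clip (max_idPl _) ?subrr ?mul0r ?addr0//.
by rewrite ge_min tn.
Qed.

Lemma par_posS n t : pos n.+1 <= t -> par n t = height n.
Proof.
move=> tn; rewrite /par /clip (min_idPr tn) (max_idPr (pos_mono (leqnSn n))).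
by rewrite posS /len rescaleK addrC subrK.
Qed.

Lemma back_itv n s : low n <= s <= height n -> pos n <= back n s <= pos n.+1.
Proof.
move=> /andP[ls sh]; have w0 := weight_gt0 n.
rewrite posS /len /back !lerD2l lerDl mulr_ge0 ?subr_ge0 ?(ltW w0)//=.
by rewrite ler_wpM2l ?(ltW w0)// lerD2r.
Qed.

(** A real in the n-th interval is beyond all earlier arcs and before all later
    ones. *)
Lemma par_other n m t : pos n <= t <= pos n.+1 -> m <> n ->
  par m t = if (m < n)%N then height m else low m.
Proof.
move=> /andP[nt tn]; case: (ltngtP m n) => // mn _.
- by apply: par_posS; rewrite (le_trans _ nt)// pos_mono.
- by apply: par_pos; rewrite (le_trans tn)// pos_mono.
Qed.

(** At a real of the n-th interval the other arcs are at one of their end points,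
    whose image is some [a m] or a foot; both are in [B]. *)
Lemma back_mem n s : low n <= s <= height n -> B (phi (a n) s) ->
  glued (back n s).
Proof.
move=> hs Bs; have hb := back_itv hs; split.
  have /andP[h1 h2] := hb.
  by rewrite (le_trans (pos_ge0 n) h1) (le_trans h2)// pos_le.
move=> m; have [->|/eqP mn] := eqVneq m n; first by rewrite backK.
rewrite (par_other hb mn); case: ifP => _; last exact: low_mem.
by rewrite phi1.
Qed.

Lemma pos_mem n : glued (pos n).
Proof.
have -> : pos n = back n (low n) by rewrite /back subrr mulr0 addr0.
by apply: back_mem; rewrite ?lexx ?low_le//; exact: low_mem.
Qed.

Variables (X : completeNormedModType R) (D : T -> X).
Hypothesis F : is_free d B D.

Let term t n : X := weight n *: (D (phi (a n) (par n t)) - D (phi (a n) (low n))).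
(** The scaled increments along the arcs up to the real [t] are added up.  This is
    not the image of a point of the tree; it makes the line interact with [X]
    through increments only, and jumps of the tree between consecutive arcs do not
    matter. *)
Definition glue_map t : X := limn (series (term t)).

Let termB s t n : glued s -> glued t ->
  `|term t n - term s n| <= `|clip n t - clip n s|.
Proof.
move=> [_ Ks] [_ Kt]; have [lip _ _] := F.
rewrite /term -scalerBr opprB addrA subrK normrZ gtr0_norm ?weight_gt0//.
rewrite -par_lip ler_wpM2l ?(ltW (weight_gt0 n))//.
apply: (le_trans (lip _ _ (Kt n) (Ks n))).
by rewrite phi_dist//; apply: height_itv; exact: par_itv.
Qed.

Let term0 n : term 0 n = 0.
Proof.
rewrite /term par_pos ?subrr ?scaler0//; exact: pos_ge0.
Qed.

Lemma glued0 : glued 0. Proof. by rewrite -pos0; exact: pos_mem. Qed.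

Let clip0 n : clip n 0 = pos n.
Proof. by apply/max_idPl; rewrite ge_min pos_ge0. Qed.

Let term_cvg t : glued t -> series (term t) @ \oo --> glue_map t.
Proof.
move=> Kt; apply: (@abs_series_cvg _ _ _ t) => N.
have [/andP[t0 _] _] := Kt.
have tN : Num.min t (pos N) <= t by rewrite ge_min lexx.
apply: (le_trans _ tN); rewrite -clip_sum//; apply: ler_sum => k _.
have := @termB 0 t k glued0 Kt; rewrite term0 subr0 clip0 => /le_trans; apply.
by have /andP[h _] := clip_itv k t; rewrite ger0_norm// subr_ge0.
Qed.

Lemma glue_lip s t : glued s -> glued t -> `|glue_map s - glue_map t| <= `|s - t|.
Proof.
wlog st : s t / s <= t.
  move=> W Ks Kt; case: (leP s t) => h; first exact: W.
  by rewrite distrC [leRHS]distrC; apply: W => //; exact: ltW.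
move=> Ks Kt; rewrite distrC [leRHS]distrC [leRHS]ger0_norm ?subr_ge0//.
apply: (cvg_norm_le (cvgB (term_cvg Kt) (term_cvg Ks))) => N.
rewrite !fctE /series/= -sumrB (le_trans (ler_norm_sum _ _ _))//.
have [/andP[t0 _] _] := Kt; have [/andP[s0 _] _] := Ks.
apply: (@le_trans _ _ (Num.min t (pos N) - Num.min s (pos N))); last first.
  by case: (leP t (pos N)); case: (leP s (pos N)); lra.
rewrite -!clip_sum// -sumrB; apply: ler_sum => k _.
apply: (le_trans (termB _ Ks Kt)).
by rewrite opprB addrA subrK ger0_norm// subr_ge0 clip_homo.
Qed.

Section Functional.
Variable h : R -> R.
Hypothesis hlip : forall s t, glued s -> glued t -> `|h s - h t| <= `|s - t|.

(* The function that [h] induces on the n-th arc, with value 0 at its foot, and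
   divided by the weight so that it is 1-Lipschitz for the tree metric. *)
Let H n s : R := (h (back n s) - h (pos n)) / weight n.

Let Hlip n s t : low n <= s <= height n -> low n <= t <= height n ->
  B (phi (a n) s) -> B (phi (a n) t) -> `|H n s - H n t| <= `|s - t|.
Proof.
move=> hs ht Bs Bt; rewrite /H -mulrBl normrM normfV.
rewrite (gtr0_norm (weight_gt0 n)) ler_pdivrMr ?weight_gt0//.
rewrite opprB addrA subrK.
apply: (le_trans (hlip (back_mem hs Bs) (back_mem ht Bt))).
rewrite -[X in _ <= _ * X](gtr0_norm (weight_gt0 n)) -normrM.
by rewrite (_ : back n s - back n t = (s - t) * weight n)// /back; ring.
Qed.

Let Hlow n : H n (low n) = 0.
Proof. by rewrite /H /back subrr mulr0 addr0 subrr mul0r. Qed.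

(* The inequality tau_sum is what makes this sum of independent functions on the
   arcs 1-Lipschitz on [B]. *)
Let hB (x : T) : R := limn (series (fun n => H n (tau n x) : R)).

Let Htau n x y : B x -> B y -> `|H n (tau n x) - H n (tau n y)| <= `|tau n x - tau n y|.
Proof. by move=> Bx By; apply: Hlip; by [exact: tau_itv|exact: tau_mem]. Qed.

Let hB_cvg x : B x -> series (fun n => H n (tau n x) : R) @ \oo --> hB x.
Proof.
move=> Bx; apply: (@abs_series_cvg _ _ _ (d x o)) => N.
apply: (le_trans _ (@tau_sum _ _ tree o a N x o)); apply: ler_sum => k _.
have := Htau k Bx Bo.
by rewrite (tau_o o a) Hlow subr0.
Qed.

Let hB_lip x y : B x -> B y -> `|hB x - hB y| <= d x y.
Proof.
move=> Bx By; apply: (cvg_norm_le (cvgB (hB_cvg Bx) (hB_cvg By))) => N.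
rewrite !fctE /series/= -sumrB (le_trans (ler_norm_sum _ _ _))//.
apply: (le_trans _ (@tau_sum _ _ tree o a N x y)); apply: ler_sum => k _.
exact: Htau.
Qed.

Let hB_piece n s : low n <= s <= height n -> B (phi (a n) s) ->
  hB (phi (a n) s) - hB (phi (a n) (low n)) = H n s.
Proof.
move=> hs Bs; have Bl := low_mem tree brB Bo aB n.
have hl : low n <= low n <= height n by rewrite lexx low_le.
apply: (cvg_unique _ (cvgB (hB_cvg Bs) (hB_cvg Bl))) => //.
apply: cvg_near_cst; exists n.+1 => // N /= nN.
rewrite !fctE /series/= -sumrB (bigD1_seq n) ?mem_index_iota ?iota_uniq//=.
rewrite !tau_phi// Hlow subr0 big1 ?addr0// => m /eqP mn.
by rewrite (tau_other tree hs hl mn) subrr.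
Qed.

(** A 1-Lipschitz function on the line model is transported to [B] arc by arc; the
    functional that integrates the transported function integrates the original
    one, by telescoping along the arcs below [t]. *)
Lemma glue_functional : exists z : {linear X -> R^o}, (forall v, `|z v| <= `|v|) /\
  forall s t, glued s -> glued t -> z (glue_map s - glue_map t) = h s - h t.
Proof.
have [_ /(_ hB hB_lip) [z [z1 zD]] _] := F; exists z; split => //.
suff zE t : glued t -> z (glue_map t) = h t - h 0.
  by move=> s t Ks Kt; rewrite linearB/= !zE//; ring.
move=> Kt; have z1' v : `|z v| <= 1 * `|v| by rewrite mul1r.
have := contractive_cvg z1' (term_cvg Kt).
have [/andP[t0 tL] Bt] := Kt.
have Kmin N : glued (Num.min t (pos N)) by case: leP => // _; exact: pos_mem.
have -> : z \o series (term t) = (fun N => h (Num.min t (pos N)) - h 0 : R^o).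
  apply/funext => N; rewrite /= /series/= linear_sum/=.
  elim: N => [|N IH]; first by rewrite big_nil pos0 (min_idPr t0) subrr.
  rewrite big_nat_recr//= IH /term linearZ/= zD//; last exact: low_mem.
  rewrite hB_piece//; last exact: par_itv.
  rewrite /H [X in _ + X](_ : _ = h (back N (par N t)) - h (pos N)); last first.
    by rewrite /GRing.scale/= mulrC divfK// gt_eqF// weight_gt0.
  have -> : back N (par N t) = clip N t by rewrite /back weight_par addrC subrK.
  have := pos_mono (leqnSn N); rewrite /clip.
  case: (leP t (pos N)) => tN NN1.
    by rewrite (min_idPl (le_trans tN NN1)) (max_idPl tN); ring.
  by rewrite (max_idPr _) ?le_min ?(ltW tN)//; ring.
move=> zl; apply: (cvg_unique _ zl) => //.
apply: cvgB; last exact: cvg_cst.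
apply/cvgrPdist_le => e e0.
have /cvgrPdist_le/(_ e e0)[N _ HN] := pos_cvg.
exists N => // n /= Nn; apply: (le_trans (hlip Kt (Kmin n))).
have := HN n Nn; have := pos_le n.
case: (leP t (pos n)); rewrite ?subrr ?normr0 => h1 h2 h3; first exact: ltW.
rewrite ger0_norm ?subr_ge0// in h3.
by rewrite gtr0_norm ?subr_gt0//; lra.
Qed.

End Functional.

(** Along one arc the line model and the tree have the same increments up to the
    weight. *)
Lemma glue_piece n s : low n <= s <= height n -> B (phi (a n) s) ->
  D (phi (a n) s) - D (phi (a n) (low n)) =
  (weight n)^-1 *: (glue_map (back n s) - glue_map (pos n)).
Proof.
move=> hs Bs; have Kb := back_mem hs Bs; have Kp := pos_mem n.
have -> : glue_map (back n s) - glue_map (pos n) =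
    weight n *: (D (phi (a n) s) - D (phi (a n) (low n))).
  apply: (cvg_unique _ (cvgB (term_cvg Kb) (term_cvg Kp))) => //.
  apply: cvg_near_cst; exists n.+1 => // N /= nN.
  rewrite !fctE /series/= -sumrB (bigD1_seq n) ?mem_index_iota ?iota_uniq//=.
  rewrite /term backK// par_pos// subrr scaler0 subr0 big1 ?addr0// => m /eqP mn.
  rewrite (par_other (back_itv hs) mn) (@par_other n m (pos n)) ?subrr//.
  by rewrite lexx pos_mono.
by rewrite scalerA mulVf ?scale1r// gt_eqF// weight_gt0.
Qed.

(* Below its foot the N-th segment runs along an earlier one, so induction on N
   reaches the root through finitely many arcs. *)
Let span_phi N s : 0 <= s <= height N -> B (phi (a N) s) ->
  D (phi (a N) s) - D o \in closed_span_pred (increments glued glue_map).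
Proof.
elim/ltn_ind: N s => N IH s /andP[s0 sh] Bs.
have low_case t : 0 <= t <= low N -> B (phi (a N) t) ->
    D (phi (a N) t) - D o \in closed_span_pred (increments glued glue_map).
  move=> /andP[t0 tl] Bt; have [l0|[k kN lk]] := low_cases o a N.
    have -> : t = 0 by apply/le_anti; rewrite t0 -l0 tl.
    by rewrite phi0// subrr rpred0.
  have e : phi (a k) t = phi (a N) t by apply: phi_eq => //; rewrite t0 -lk.
  rewrite -e; apply: IH => //; last by rewrite e.
  by rewrite t0 (le_trans tl)// lk gprod_le.
have [sl|ls] := leP s (low N); first by apply: low_case => //; rewrite s0.
have hs : low N <= s <= height N by rewrite ltW.
rewrite -[D _](subrK (D (phi (a N) (low N)))) -addrA rpredD//.
  rewrite glue_piece//; apply: rpredZ; apply: span_gen.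
  by exists (back N s), (pos N); split => //; [exact: back_mem|exact: pos_mem].
by apply: low_case; [rewrite lexx low_ge0|exact: low_mem].
Qed.

Lemma glue_span v : v \in closed_span_pred (increments glued glue_map).
Proof.
have [lip _ dense] := F; apply: span_sub (dense v) => _ [x [y [Bx By ->]]].
have spx z : B z -> D z - D o \in closed_span_pred (increments glued glue_map).
  move=> Bz.
  have ex n : exists k, d z (a k) < n.+1%:R^-1.
    by apply: aD => //; rewrite invr_gt0 ltr0n.
  have [k hk] := choice ex.
  apply: (@span_closed _ _ _ (fun n => D (a (k n)) - D o)); last first.
    move=> n; have := @span_phi (k n) (height (k n)).
    by rewrite phi1//; apply => //; rewrite lexx height_ge0.
  apply: cvgB; last exact: cvg_cst.
  apply/cvgrPdist_lt => e e0.
  have /cvgrPdist_lt/(_ e e0)[M _ hM] := @cvg_harmonic R.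
  exists M => // n /= Mn; apply: le_lt_trans (lip _ _ Bz (aB _)) _.
  apply: lt_trans (hk n) _; have := hM n Mn.
  by rewrite sub0r normrN /= ger0_norm// invr_ge0.
have -> : D x - D y = (D x - D o) - (D y - D o) by rewrite opprB addrA subrK.
by apply: rpredB; exact: spx.
Qed.

Lemma glue_free : is_free (fun s t : R => `|s - t|) glued glue_map.
Proof.
split; [exact: glue_lip|exact: glue_functional|exact: glue_span].
Qed.

End Glue.

(** * Lipschitz images of null sets *)

Section NullSets.
Context {R : realType}.
Local Notation lambda := (@lebesgue_measure R).
Implicit Types S : set R.

Lemma nullP S : lambda S = 0%E <-> lambda.-negligible S.
Proof. by split => [/negligible_outer_measure|/negligible_outer_measure]. Qed.

Lemma null_sub S S' : S `<=` S' -> lambda S' = 0%E -> lambda S = 0%E.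
Proof. by move=> SS' /nullP nS; apply/nullP; apply: negligibleS nS. Qed.

(** Cover the null set by open intervals of small total length; the image of its
    trace on an interval of length l lies in an interval of length 2Cl.  The
    measure is used here as an outer measure, for arbitrary sets. *)
Lemma lip_null S (f : R -> R) C :
  (forall x y, S x -> S y -> `|f x - f y| <= C * `|x - y|) ->
  lambda S = 0%E -> lambda (f @` S) = 0%E.
Proof.
wlog C0 : C / 0 < C.
  move=> W H; apply: (W (`|C| + 1)) => [|x y Sx Sy].
    by rewrite ltr_wpDl.
  apply: (le_trans (H x y Sx Sy)); apply: ler_wpM2r => //.
  by rewrite (le_trans (ler_norm _))// lerDl.
move=> flip S0; apply/eqP; rewrite eq_le measure_ge0 andbT.
apply/lee_addgt0Pr => e e0; rewrite add0e.
have e1 : 0 < e / (2 * C) by rewrite divr_gt0// mulr_gt0.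
have [F [Fo SF] Fe] : exists2 F, open_itv_cover S F &
    (\sum_(0 <= k <oo) wlength idfun (F k) <= (e / (2 * C))%:E)%E.
  have S0' : ((wlength idfun)^* S)%mu = 0%E by exact: S0.
  have : ((wlength idfun)^* S)%mu \is a fin_num by rewrite S0'.
  move: S0'; rewrite outer_measure_open_itv_cover => S0'.
  move=> /lb_ereal_inf_adherent-/(_ _ e1)[_/= [F]] SF <- Fe.
  by exists F => //; rewrite S0' add0e in Fe; exact: ltW.
have exG k : exists G, f @` (S `&` F k) `<=` G /\
    (lambda G <= (2 * C)%:E * wlength idfun (F k))%E.
  have [[u v] /= Fk] := Fo k.
  have [[x [Sx Fx]]|nex] := pselect (exists x, S x /\ F k x); last first.
    exists set0; split.
      by move=> y [x [Sx Fx] _]; exfalso; apply: nex; exists x.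
    by rewrite measure0 mule_ge0// ?lee_fin ?mulr_ge0 ?(ltW C0)//; exact: wlength_ge0.
  move: Fx; rewrite Fk/= in_itv/= => /andP[ux xv].
  have uv : u < v := lt_trans ux xv.
  exists `[f x - C * (v - u), f x + C * (v - u)]%classic; split.
    move=> z [y [Sy Fy] <-]; move: Fy; rewrite /= in_itv/= => /andP[uy yv].
    have := flip y x Sy Sx; have xy : `|y - x| <= v - u.
      by rewrite ler_norml; lra.
    rewrite in_itv/= => h.
    have : `|f y - f x| <= C * (v - u) by rewrite (le_trans h)// ler_wpM2l// ltW.
    by rewrite ler_norml; lra.
  rewrite lebesgue_measure_itv/= wlength_itv/= !lte_fin uv.
  case: ifP => _; last by rewrite mule_ge0// lee_fin ?mulr_ge0 ?subr_ge0 ?(ltW C0) ?ltW.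
  by rewrite -!EFinB -EFinM lee_fin; lra.
have [G hG] := choice exG.
have sub : f @` S `<=` \bigcup_k G k.
  move=> _ [x Sx <-]; have [k _ Fx] := SF _ Sx.
  by exists k => //; apply: (hG k).1; exists x.
have le1 : (lambda (f @` S) <= lambda (\bigcup_k G k))%E.
  exact: (le_outer_measure ((wlength idfun)^*)%mu).
apply: (le_trans le1).
apply: (le_trans (outer_measure_sigma_subadditive ((wlength idfun)^*)%mu G)).
apply: (@le_trans _ _ (\sum_(0 <= k <oo) (2 * C)%:E * wlength idfun (F k))%E).
  by apply: lee_nneseries => k _ *; [exact: outer_measure_ge0|exact: (hG k).2].
rewrite nneseriesZl; last by move=> *; exact: wlength_ge0.
apply: (le_trans (lee_wpmul2l _ Fe)).
  by rewrite lee_fin mulr_ge0// ltW.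
by rewrite -EFinM lee_fin mulrC divfK// mulf_neq0// gt_eqF.
Qed.

End NullSets.

(** * The measure of the line model *)

Section GlueSize.
Context {R : realType} {T : metricType R}.
Local Notation d := (@mdist R T).
Local Notation lambda := (@lebesgue_measure R).
Hypothesis tree : is_rtree T.
Variables (o : T) (B : set T).
Hypotheses (brB : branching_points T `<=` B) (Bo : B o) (cB : closed B).
Variable a : nat -> T.
Hypothesis aB : forall n, B (a n).
Hypothesis aD : forall x e, B x -> 0 < e -> exists n, d x (a n) < e.
Local Notation gp := (gp o).
Local Notation phi := (phi o).
Local Notation height := (height o a).
Local Notation low := (low o a).
Local Notation weight := (weight o a).
Local Notation pos := (pos o a).
Local Notation clip := (clip o a).
Local Notation par := (par o a).
Local Notation back := (back o a).
Local Notation line_length := (line_length o a).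
Local Notation glued := (glued o B a).

(** The trace of [B] on the n-th arc, as a set of heights. *)
Definition piece n : set R := [set s | low n <= s <= height n /\ B (phi (a n) s)].

Lemma clip_lip n s t : `|clip n s - clip n t| <= `|s - t|.
Proof. exact: le_trans (max_lip _ _ _) (min_lip _ _ _). Qed.

Lemma par_lip_inv n s t : `|par n s - par n t| <= (weight n)^-1 * `|s - t|.
Proof.
have w0 := weight_gt0 o a n.
rewrite -(ler_pM2l w0) mulrA mulfV ?gt_eqF// mul1r par_lip.
exact: clip_lip.
Qed.

Lemma glued_closed : closed glued.
Proof.
move=> t ct; split.
  have : closure `[0, line_length]%classic t.
    by apply: closure_subset ct => s [h _]; rewrite /= in_itv.
  by rewrite -(closure_id _).1; [rewrite /= in_itv|exact: itv_closed].
move=> n; apply: cB => U /metricType_numDomainType.nbhs_mdistP[e /= e0 eU].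
have w0 := weight_gt0 o a n.
have we0 : 0 < weight n * e by rewrite mulr_gt0.
have [s [[_ Bs] ts]] := ct _ (nbhsx_ballx t _ we0).
exists (phi (a n) (par n s)); split; first exact: Bs.
apply: eU; rewrite /= phi_dist//; last 2 first.
- by apply: height_itv; exact: par_itv.
- by apply: height_itv; exact: par_itv.
apply: (le_lt_trans (par_lip_inv n t s)).
by rewrite mulrC ltr_pdivrMr// mulrC; move: ts; rewrite -ball_normE.
Qed.

Lemma pos_locate t : 0 <= t < line_length -> exists n, pos n <= t < pos n.+1.
Proof.
move=> /andP[t0 tL].
have [N tN] : exists N, t < pos N.
  apply: contrapT => /forallNP h; have : line_length <= t.
    by apply: limr_le; [exact: (cvgP _ (@pos_cvg _ _ o a))|apply: nearW => n; rewrite leNgt; apply/negP].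
  by rewrite leNgt tL.
elim: N tN => [|N IH]; first by rewrite pos0 ltNge t0.
by case: (ltP t (pos N)) => [/IH//|Nt tN]; exists N; rewrite Nt.
Qed.

Lemma back_par n t : pos n <= t <= pos n.+1 -> back n (par n t) = t.
Proof.
move=> /andP[nt tn]; rewrite /(back _ _) weight_par addrC subrK /(clip _ _).
by rewrite (min_idPl tn) (max_idPr nt).
Qed.

(** The line model is the union of the scaled traces and of its last point, the only
    one that may belong to no arc. *)
Lemma glued_null : (forall n, lambda (piece n) = 0%E) -> lambda glued = 0%E.
Proof.
move=> pn0; apply: (@null_sub _ _ ([set line_length] `|` \bigcup_n (back n @` piece n))).
  move=> t [/andP[t0 tL] Bt].
  have [->|tnL] := eqVneq t line_length; [by left|right].
  have [|n /andP[nt tn]] := @pos_locate t; first by rewrite t0 lt_neqAle tnL.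
  exists n => //; exists (par n t); last by rewrite back_par// nt ltW.
  by split; [exact: par_itv|exact: Bt].
apply/nullP; apply: negligibleU; first by apply/nullP; exact: lebesgue_measure_set1.
apply: negligible_bigcup => n; apply/nullP.
apply: (@lip_null _ _ _ (weight n)) => // x y _ _.
rewrite -[X in _ <= X * _](gtr0_norm (weight_gt0 o a n)) -normrM.
by rewrite (_ : back n x - back n y = weight n * (x - y))// /(back _ x) /(back _ y); ring.
Qed.

Lemma piece_null n : lambda glued = 0%E -> lambda (piece n) = 0%E.
Proof.
move=> g0; apply: (@null_sub _ _ (par n @` glued)).
  by move=> s [hs Bs]; exists (back n s); [exact: back_mem|exact: backK].
by apply: (@lip_null _ _ _ (weight n)^-1) => // x y _ _; exact: par_lip_inv.
Qed.

Lemma piece_length0 n : length_measure B = 0%E -> lambda (piece n) = 0%E.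
Proof.
move=> l0; apply: (@null_sub _ _ (segment_preimage o (a n) B)).
  by move=> s [hs Bs]; split => //; rewrite /= in_itv/=; exact: height_itv.
apply/eqP; rewrite eq_le measure_ge0 andbT -l0.
apply: ereal_sup_ubound; exists 1%N, (fun=> (o, a n)); split.
  by move=> i j _ _ _; rewrite !ord1.
by rewrite big_ord_recl big_ord0 adde0.
Qed.

(** Every point of a segment from [o] to [a n], except [o], is on an arc: it is on
    the arc of the first segment that passes through it. *)
Lemma locate n h : 0 < h <= height n ->
  exists k, low k < h <= height k /\ phi (a k) h = phi (a n) h.
Proof.
elim/ltn_ind: n => n IH /andP[h0 hn].
have [hl|lh] := leP h (low n); last by exists n; rewrite lh.
have [l0|[k kn lk]] := low_cases o a n; first by move: h0; rewrite ltNge -l0 hl.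
have e : phi (a k) h = phi (a n) h by apply: phi_eq => //; rewrite (ltW h0) -lk.
have [|j [hj ej]] := IH k kn; last by exists j; rewrite ej.
by rewrite h0 (le_trans hl)// lk gprod_le.
Qed.

(** The trace of [B] on a segment from the root is covered by the arcs, up to its
    top: below a point [phi x h'] of [B], some [a n] close to that point has a
    segment that agrees with the given one up to height [h]. *)
Lemma ray_null x : (forall n, lambda (piece n) = 0%E) ->
  lambda [set h | 0 <= h <= d o x /\ B (phi x h)] = 0%E.
Proof.
move=> pn0; set P := mkset _.
apply: (@null_sub _ _ ([set sup P; 0] `|` \bigcup_n piece n)); last first.
  apply/nullP; apply: negligibleU.
    by apply: negligibleU; apply/nullP; exact: lebesgue_measure_set1.
  by apply: negligible_bigcup => n; apply/nullP.
have supP : has_sup P.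
  split; last by exists (d o x) => h [/andP[]].
  by exists 0; rewrite /P /= lexx mdist_ge0 phi0.
move=> h Ph; have [/andP[h0 hx] Bh] := Ph.
have [->|hn0] := eqVneq h 0; first by left; right.
have [->|hS] := eqVneq h (sup P); [by left; left|right].
have hlt : h < sup P by rewrite lt_neqAle hS; apply: sup_upper_bound.
have [h' [/andP[h'0 h'x] Bh'] hh'] : exists2 h', P h' & h < h'.
  have sh0 : 0 < sup P - h by rewrite subr_gt0.
  by have [h' Ph'] := sup_adherent sh0 supP; rewrite subKr => hh'; exists h'.
have [n dn] := aD Bh' (etrans (subr_gt0 _ _) hh').
have dh' : gp (phi x h') (phi x h') = h'.
  by rewrite /(gp _ _) gprodxx phi_height// h'0.
have hn : h <= gp (phi x h') (a n).
  have := gprod_lip o (phi x h') (phi x h') (a n).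
  by rewrite -/(gp _ _) dh' -/(gp _ _) ler_norml; lra.
have e1 : phi (phi x h') h = phi (a n) h by apply: phi_eq => //; rewrite h0.
have e2 : phi (phi x h') h = phi x h.
  by apply: phi_eq => //; rewrite gp_phi_self ?h'0// h0 ltW.
have [|k [/andP[lk hk] ek]] := @locate n h.
  by rewrite lt_neqAle eq_sym hn0 h0 (le_trans hn)// gprod_ler.
by exists k => //; split; [rewrite ltW|rewrite ek -e1 e2].
Qed.

(** An arbitrary segment is made of two pieces of segments from the root, on both
    sides of its lowest point. *)
Lemma segment_null x y : (forall n, lambda (piece n) = 0%E) ->
  segment_measure x y B = 0%E.
Proof.
move=> pn0; rewrite /segment_measure; set g := gp x y.
have gx : g <= d o x := gprod_le _ _ _; have gy : g <= d o y := gprod_ler _ _ _.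
have g0 : 0 <= g := gprod_ge0 _ _ _.
have dxy : d x y = d o x + d o y - 2 * g by rewrite /g /(gp _ _) /gprod; field.
apply: (@null_sub _ _
  ((fun h => d o x - h) @` [set h | 0 <= h <= d o x /\ B (phi x h)] `|`
   (fun h => d o x + h - 2 * g) @` [set h | 0 <= h <= d o y /\ B (phi y h)])).
  move=> s [] /=; rewrite in_itv/= => /andP[s0 sd] Bs.
  have [sx|xs] := leP s (d o x - g).
    left; exists (d o x - s); last by rewrite subKr.
    have hs : 0 <= d o x - s <= d o x by lra.
    split => //; suff -> : phi x (d o x - s) = segment_map x y s by [].
    set p := phi x _.
    have px : d x p = s by rewrite metric_sym segment_distr// subKr.
    have py : d p y = d x y - s.
      have := gp_phi tree y hs; rewrite -/p gpC min_r; last first.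
        by rewrite gpC -/g; lra.
      rewrite (gpC o y) -/g {1}/(gp _ _) /gprod phi_height// dxy; lra.
    by rewrite -[s in RHS]px; apply: between_segment => //; rewrite px py; lra.
  right; exists (s - d o x + 2 * g); last by ring.
  have hs : 0 <= s - d o x + 2 * g <= d o y by lra.
  split => //; suff -> : phi y (s - d o x + 2 * g) = segment_map x y s by [].
  set p := phi y _.
  have py : d p y = d x y - s by rewrite segment_distr//; lra.
  have px : d x p = s.
    have := gp_phi tree x hs; rewrite -/p min_r; last by rewrite -/g; lra.
    rewrite -/g {1}/(gp _ _) /gprod phi_height//; lra.
  by rewrite -[s in RHS]px; apply: between_segment => //; rewrite px py; lra.
apply/nullP; apply: negligibleU; apply/nullP.
  apply: (@lip_null _ _ _ 1); last exact: ray_null.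
  move=> u v _ _; have -> : d o x - u - (d o x - v) = v - u by ring.
  by rewrite mul1r distrC.
apply: (@lip_null _ _ _ 1); last exact: ray_null.
move=> u v _ _; rewrite mul1r.
by have -> : d o x + u - 2 * g - (d o x + v - 2 * g) = u - v by ring.
Qed.

Lemma length_pos : (0 < length_measure B)%E -> (0 < lambda glued)%E.
Proof.
move=> l0; rewrite lt_neqAle measure_ge0 andbT; apply/eqP => /esym g0.
move: l0; apply/negP; rewrite -leNgt; apply: ge_ereal_sup => _ [n [s [_ ->]]].
by rewrite big1// => i _; apply: segment_null => k; exact: piece_null.
Qed.

Lemma length_null : length_measure B = 0%E -> lambda glued = 0%E.
Proof. by move=> l0; apply: glued_null => n; exact: piece_length0. Qed.

(** A point of the line model determines at most one [a n] other than [o]: the one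
    at the corresponding height of the arc that carries it.  If the model were
    finite, so would be the range of [a], hence its closure. *)
Lemma glued_infinite : infinite_set B -> infinite_set glued.
Proof.
move=> Binf gfin; apply: Binf.
(* Half-open intervals, closed on the right: the top of an arc is counted on this
   arc and not on the next one, whose foot has the same position. *)
pose kappa t := xget 0%N [set k | pos k < t <= pos k.+1].
pose f t := phi (a (kappa t)) (par (kappa t) t).
have kappaE k t : pos k < t <= pos k.+1 -> kappa t = k.
  move=> hk; rewrite /kappa; case: xgetP => [j _ hj|/(_ k)//].
  have [kt tk] := andP hk; have [jt tj] := andP hj.
  apply/eqP; rewrite eqn_leq; apply/andP; split; rewrite leqNgt; apply/negP => h.
    by have := le_lt_trans (le_trans tk (pos_mono o a h)) jt; rewrite ltxx.
  by have := le_lt_trans (le_trans tj (pos_mono o a h)) kt; rewrite ltxx.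
have sub : range a `<=` o |` (f @` glued).
  move=> _ [n _ <-]; have [<-|no] := pselect (o = a n); [by left|right].
  have h0 : 0 < height n by rewrite mdist_gt0; apply/eqP.
  have [|k [/andP[lk hk] ek]] := @locate n (height n); first by rewrite h0 lexx.
  rewrite phi1// in ek.
  have hh : low k <= height n <= height k by rewrite ltW.
  have Kt : glued (back k (height n)) by apply: back_mem => //; rewrite ek.
  exists (back k (height n)) => //; rewrite /f (@kappaE k); first by rewrite backK.
  have /andP[_ ->] := back_itv hh; rewrite andbT /(back _ _) ltrDl.
  by rewrite mulr_gt0 ?weight_gt0// subr_gt0.
have fr : finite_set (range a).
  by apply: sub_finite_set sub _; rewrite finite_setU; split=> //; exact: finite_image.
apply: (sub_finite_set _ fr) => x Bx.
have : closure (range a) x.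
  move=> U /metricType_numDomainType.nbhs_mdistP[e /= e0 eU].
  have [n xn] := aD Bx e0; exists (a n); split => //.
  exact: eU.
rewrite -(closure_id _).1//.
have /accessible_finite_set_closed : accessible_space T.
  by apply: hausdorff_accessible; exact: metric_hausdorff.
by move=> /(_ _ fr).
Qed.

End GlueSize.

(** * Gaps of a closed set of reals *)

Section GapDefs.
Context {R : realType}.
Local Notation lambda := (@lebesgue_measure R).
Variables (K : set R) (L : R).
Hypotheses (cK : closed K) (Kitv : K `<=` `[0, L]) (K0 : K 0) (KL : K L).

(** A gap is indexed by the rational numbers it contains, through their codes [i];
    [act] selects the least code of every gap, so that distinct active indices
    give disjoint gaps. *)
Definition node (i : nat) : R := if unpickle i is Some r then ratr (r : rat) else 0.
Definition gap_left i : R := sup (K `&` [set x | x <= node i]).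
Definition gap_right i : R := inf (K `&` [set x | node i <= x]).
Definition in_gap i : Prop := ~ K (node i) /\ 0 < node i < L.
Definition act i : bool :=
  `[< in_gap i /\ forall j, (j < i)%N -> in_gap j -> gap_left j <> gap_left i >].
Definition gap_len i : R := gap_right i - gap_left i.
(** [nu i t] is the length of the i-th gap if it lies below [t], and [theta t] is
    the measure of K below [t]. *)
Definition nu i t : R := if act i && (gap_right i <= t) then gap_len i else 0.
Lemma nu_def i t : nu i t = if act i && (gap_right i <= t) then gap_len i else 0.
Proof. by []. Qed.

Definition theta t : R := fine (lambda (K `&` `[0, t])).

Lemma Kle t : K t -> 0 <= t <= L.
Proof. by move/Kitv; rewrite /= in_itv. Qed.

Lemma sup_mem (x : R) : 0 <= x ->
  let s := sup (K `&` [set y | y <= x]) in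
  [/\ K s, s <= x & forall y, K y -> y <= x -> y <= s].
Proof.
move=> x0 s; have hs : has_sup (K `&` [set y | y <= x]).
  by split; [exists 0; split|exists x => y []].
have ub y : K y -> y <= x -> y <= s by move=> Ky yx; apply: sup_upper_bound.
split => //; last by apply: ge_sup => [|y []//]; exact: hs.1.
apply: cK => U /nbhs_ballP[e /= e0 eU].
have [y [Ky yx] sy] := sup_adherent e0 hs.
exists y; split => //; apply: eU; rewrite -ball_normE/= ger0_norm.
  by rewrite ltrBlDr -ltrBlDl.
by rewrite subr_ge0 ub.
Qed.

Lemma inf_mem (x : R) : x <= L ->
  let s := inf (K `&` [set y | x <= y]) in
  [/\ K s, x <= s & forall y, K y -> x <= y -> s <= y].
Proof.
move=> x0 s; have hs : has_inf (K `&` [set y | x <= y]).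
  by split; [exists L; split|exists x => y []].
have lb y : K y -> x <= y -> s <= y.
  by move=> Ky yx; apply: ge_inf => //; exact: hs.2.
split => //; last by apply: lb_le_inf => [|y []//]; exact: hs.1.
apply: cK => U /nbhs_ballP[e /= e0 eU].
have [y [Ky yx] sy] := inf_adherent e0 hs.
exists y; split => //; apply: eU; rewrite -ball_normE/= ler0_norm.
  by rewrite opprB ltrBlDl.
by rewrite subr_le0 lb.
Qed.

Lemma gap_spec i : in_gap i ->
  [/\ K (gap_left i), K (gap_right i), gap_left i < node i, node i < gap_right i
    & forall y, K y -> y <= gap_left i \/ gap_right i <= y].
Proof.
move=> [Kn /andP[n0 nL]].
have [Kl ln lub] := sup_mem (ltW n0); have [Kr nr rlb] := inf_mem (ltW nL).
have ne y : K y -> y != node i by move=> Ky; apply: contra_notN Kn => /eqP <-.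
split => //; [by rewrite lt_neqAle ne|by rewrite lt_neqAle eq_sym ne|].
move=> y Ky; case: (leP y (node i)) => h; first by left; exact: lub.
by right; apply: rlb => //; exact: ltW.
Qed.

Lemma act_in_gap i : act i -> in_gap i.
Proof. by move=> /asboolP[]. Qed.

Lemma gap_len_gt0 i : act i -> 0 < gap_len i.
Proof.
move=> /act_in_gap/gap_spec[_ _ h1 h2 _].
by rewrite subr_gt0 (lt_trans h1).
Qed.

Lemma gap_disj i j : act i -> act j -> i != j ->
  gap_right i <= gap_left j \/ gap_right j <= gap_left i.
Proof.
move=> ai aj ij.
have [Kli Kri li ri hi] := gap_spec (act_in_gap ai).
have [Klj Krj lj rj hj] := gap_spec (act_in_gap aj).
have nl : gap_left i != gap_left j.
  apply/eqP => e; have [ij'|ji|e'] := ltngtP i j.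
  - by have /asboolP[_ /(_ i ij' (act_in_gap ai))] := aj.
  - by have /asboolP[_ /(_ j ji (act_in_gap aj))] := ai; rewrite e.
  - by rewrite e' eqxx in ij.
have [h|h|h] := ltgtP (gap_left i) (gap_left j).
- by left; case: (hi _ Klj) => //; rewrite leNgt h.
- by right; case: (hj _ Kli) => //; rewrite leNgt h.
- by rewrite h eqxx in nl.
Qed.

(** The points of K closest to [t] on both sides bound a gap, which contains a
    rational number. *)
Lemma gap_cover t : 0 <= t <= L -> ~ K t ->
  exists2 i, act i & gap_left i < t < gap_right i.
Proof.
move=> /andP[t0 tL] Kt.
have [Kl lt lub] := sup_mem t0; have [Kr tr rlb] := inf_mem tL.
set l := sup _ in Kl lt lub; set r := inf _ in Kr tr rlb.
have ne y : K y -> y != t by move=> Ky; apply: contra_notN Kt => /eqP <-.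
have lt' : l < t by rewrite lt_neqAle ne.
have tr' : t < r by rewrite lt_neqAle eq_sym ne.
have hyp y : K y -> y <= l \/ r <= y.
  move=> Ky; case: (leP y t) => h; first by left; exact: lub.
  by right; apply: rlb => //; exact: ltW.
have nodeE j : l < node j < r -> in_gap j /\ gap_left j = l.
  move=> /andP[lj jr].
  have ij : in_gap j.
    split.
      by move=> Kj; case: (hyp _ Kj); rewrite leNgt ?lj ?jr.
    by have /andP[l0 _] := Kle Kl; have /andP[_ rL] := Kle Kr; lra.
  split => //; have [Klj _ lj1 lj2 hj] := gap_spec ij.
  apply/le_anti/andP; split.
    case: (hyp _ Klj) => // h; have := le_lt_trans h lj1.
    by rewrite ltNge (ltW jr).
  by case: (hj _ Kl) => // h; have := lt_le_trans lj2 h; rewrite ltNge (ltW lj).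
have [x xlr] : exists x : rat, ratr x \in `]l, r[.
  by apply: rat_in_itvoo; exact: lt_trans lt' tr'.
have exj : exists j, `[< in_gap j /\ gap_left j = l >].
  exists (pickle x); apply/asboolP/nodeE; rewrite /node pickleK.
  by move: xlr; rewrite in_itv.
have [i /asboolP[gi li] imin] := ex_minnP exj.
have [Kli Kri h1 h2 hi] := gap_spec gi.
exists i.
  apply/asboolP; split => // j ji gj; rewrite li => lj.
  have := imin j; rewrite leqNgt ji => /(_ _)/negP; apply => //.
  by apply/asboolP.
rewrite li lt'/=; apply: (lt_le_trans tr').
case: (hyp _ Kri) => // h.
by have := lt_trans h1 h2; rewrite li ltNge h.
Qed.

Lemma nu_ge0 i t : 0 <= nu i t.
Proof. by rewrite /nu; case: ifP => // /andP[/gap_len_gt0/ltW]. Qed.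

Lemma nu_homo i s t : s <= t -> nu i s <= nu i t.
Proof.
move=> st; rewrite /nu; case: ifP => [/andP[ai rs]|_]; last exact: nu_ge0.
by rewrite ai (le_trans rs st).
Qed.

Lemma nu0 i : nu i 0 = 0.
Proof.
rewrite /nu; case: ifP => // /andP[/act_in_gap gi r0].
have [_ _ _ nr _] := gap_spec gi; have [_ /andP[n0 _]] := gi.
by have := lt_trans n0 nr; rewrite ltNge r0.
Qed.

Lemma mK : measurable K. Proof. exact: closed_measurable. Qed.

Lemma thetaE t : lambda (K `&` `[0, t]) = (theta t)%:E.
Proof.
rewrite fineK// ge0_fin_numE// (le_lt_trans _ (ltry (Num.max t 0)))//.
apply: (@le_trans _ _ (lambda `[0, t])).
  by apply: le_measure; rewrite ?inE//; apply: measurableI => //; exact: mK.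
rewrite lebesgue_measure_itv/= lte_fin; case: ifP => t0.
  by rewrite sube0 lee_fin le_max lexx.
by rewrite lee_fin le_max lexx orbT.
Qed.

Lemma theta_ge0 t : 0 <= theta t.
Proof. by rewrite fine_ge0. Qed.

Lemma thetaL : lambda K = (theta L)%:E.
Proof. by rewrite -thetaE (setIidl Kitv). Qed.

(** [0, t] is the disjoint union of the part of K below [t] and of the gaps
    below [t]. *)
Lemma nu_series t : K t -> series (nu ^~ t) @ \oo --> t - theta t.
Proof.
move=> Kt; have /andP[t0 tL] := Kle Kt.
pose G i := if act i && (gap_right i <= t) then `]gap_left i, gap_right i[%classic else set0.
have mG i : measurable (G i) by rewrite /G; case: ifP.
have lG i : lambda (G i) = (nu i t)%:E.
  rewrite /G /nu; case: ifP => [/andP[ai _]|_]; last by rewrite measure0.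
  rewrite lebesgue_measure_itv/= lte_fin -subr_gt0 -/(gap_len i).
  by rewrite gap_len_gt0.
have tG : trivIset setT G.
  move=> i j _ _; rewrite /G => -[x []].
  case: ifP => // /andP[ai _]; rewrite /= in_itv/= => /andP[x1 x2].
  case: ifP => // /andP[aj _]; rewrite /= in_itv/= => /andP[x3 x4].
  apply/eqP; apply/negP => /negP ij.
  by have [h|h] := gap_disj ai aj ij; lra.
have KG : (K `&` `[0, t]) `&` (\bigcup_i G i) = set0.
  rewrite -subset0 => x [[Kx _] [i _]]; rewrite /G.
  case: ifP => // /andP[/act_in_gap gi _]; rewrite /= in_itv/= => /andP[x1 x2].
  by have [_ _ _ _ h] := gap_spec gi; case: (h _ Kx); rewrite leNgt ?x1 ?x2.
have cov : `[0, t]%classic = (K `&` `[0, t]) `|` (\bigcup_i G i).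
  apply/seteqP; split => x.
    rewrite /= in_itv/= => /andP[x0 xt].
    have [Kx|nKx] := pselect (K x); first by left; split => //=; apply/andP.
    right; have [|i ai /andP[lx xr]] := @gap_cover x _ nKx.
      by rewrite x0 (le_trans xt).
    exists i => //; rewrite /G ai/=.
    have [_ _ _ _ h] := gap_spec (act_in_gap ai).
    have -> : gap_right i <= t by case: (h _ Kt) => //; lra.
    by rewrite /= in_itv/= lx.
  move=> [[_]//|[i _]]; rewrite /G; case: ifP => // /andP[/act_in_gap gi rt].
  have [Kl _ _ _ _] := gap_spec gi; have /andP[l0 _] := Kle Kl.
  by rewrite /= !in_itv/= => /andP[h1 h2]; apply/andP; split; lra.
have sumE : (\sum_(i <oo) (nu i t)%:E)%E = (t - theta t)%:E.
  have : lambda `[0, t] = (lambda (K `&` `[0%R, t]) + lambda (\bigcup_i G i))%E.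
    rewrite {1}cov measureU//; first by apply: measurableI => //; exact: mK.
    exact: bigcupT_measurable.
  have -> : lambda (\bigcup_i G i) = (\sum_(i <oo) (nu i t)%:E)%E.
    rewrite measure_semi_bigcup//; last exact: bigcupT_measurable.
    by apply: eq_eseriesr => i _; exact: lG.
  rewrite thetaE lebesgue_measure_itv/= lte_fin.
  move=> e; have e' : (t%:E = (theta t)%:E + \sum_(i <oo) (nu i t)%:E)%E.
    rewrite -e; case: ltP => h; first by rewrite sube0.
    by congr (_%:E); apply/le_anti; rewrite t0 h.
  by rewrite EFinB {1}e' addeAC subee// add0e.
have : (fun n => (series (nu ^~ t) n)%:E) @ \oo --> (t - theta t)%:E.
  have -> : (fun n => (series (nu ^~ t) n)%:E) =
      (fun n => \sum_(0 <= i < n) (nu i t)%:E)%E.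
    by apply/funext => n; rewrite /series/= -sumEFin.
  by rewrite -sumE; apply: is_cvg_nneseries => n _ _; rewrite lee_fin nu_ge0.
by move/fine_cvg.
Qed.

End GapDefs.

(** * The free space of a closed set of reals *)

Section Structure.
Context {R : realType}.
Local Notation lambda := (@lebesgue_measure R).
Variables (K : set R) (L : R).
Hypotheses (cK : closed K) (Kitv : K `<=` `[0, L]) (K0 : K 0) (KL : K L).
Variables (X : completeNormedModType R) (E : R -> X).
Hypothesis F : is_free (fun s t : R => `|s - t|) K E.
Local Notation act := (act K L).
Local Notation nu := (nu K L).
Local Notation theta := (theta K).
Local Notation gap_left := (gap_left K).
Local Notation gap_right := (gap_right K).
Local Notation gap_len := (gap_len K).

(** The increment of [E] across a gap is a multiple of an [atom] of norm at most 1.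
    Removing these jumps from [E] leaves [diffuse]. *)
Definition atom i : X := (gap_len i)^-1 *: (E (gap_right i) - E (gap_left i)).
Definition diffuse t : X := E t - E 0 - limn (series (fun i => nu i t *: atom i)).

Let Elip x y : K x -> K y -> `|E x - E y| <= `|x - y|.
Proof. by have [h _ _] := F; exact: h. Qed.

(** Between two points of K lies the part of K between them together with any one
    of the gaps between them. *)
Lemma theta_le s t : K s -> K t -> s <= t ->
  forall i, theta t - theta s + (nu i t - nu i s) <= t - s.
Proof.
move=> Ks Kt st i.
have h : (fun N => series (nu ^~ t) N - series (nu ^~ s) N) @ \oo -->
    (t - theta t) - (s - theta s).
  by apply: cvgB; apply: nu_series.
suff : nu i t - nu i s <= (t - theta t) - (s - theta s) by lra.
rewrite -(cvg_lim _ h)//; apply: limr_ge; first exact: (cvgP _ h).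
exists i.+1 => // N /= iN; rewrite /series/= -sumrB.
rewrite (bigD1_seq i) ?mem_index_iota ?iota_uniq//= lerDl sumr_ge0// => j _.
by rewrite subr_ge0 nu_homo.
Qed.

Lemma theta_homo s t : s <= t -> theta s <= theta t.
Proof.
move=> st; rewrite -lee_fin -!(thetaE cK); apply: le_measure; rewrite ?inE.
- by apply: measurableI => //; exact: mK.
- by apply: measurableI => //; exact: mK.
- by apply: setIS => x; rewrite /= !in_itv/= => /andP[-> /le_trans]; apply.
Qed.

Lemma nu_right i j : act i -> nu j (gap_right i) - nu j (gap_left i) =
  if j == i then gap_len i else 0.
Proof.
move=> ai; have [Kl Kr h1 h2 _] := gap_spec cK K0 KL (act_in_gap ai).
have [->|ji] := eqVneq j i.
  by rewrite !nu_def ai lexx (lt_geF (lt_trans h1 h2)) subr0.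
have [aj|] := boolP (act j); last by rewrite !nu_def => /negbTE->; rewrite subrr.
have := gap_len_gt0 cK K0 KL aj; rewrite /(gap_len _) subr_gt0 => h3.
have [h|h] := gap_disj cK K0 KL aj ai ji.
  by rewrite !nu_def aj/= h (le_trans h)// ?subrr// ltW// (lt_trans h1).
rewrite !nu_def aj/= (lt_geF (le_lt_trans h h3)) (lt_geF _) ?subrr//.
by rewrite (lt_le_trans _ (ltW h3))// (lt_le_trans (lt_trans h1 h2)).
Qed.

Lemma theta_gap i : act i -> theta (gap_right i) = theta (gap_left i).
Proof.
move=> ai; have [Kl Kr h1 h2 _] := gap_spec cK K0 KL (act_in_gap ai).
have lr := ltW (lt_trans h1 h2).
apply/le_anti; rewrite (theta_homo lr) andbT.
by have := theta_le Kl Kr lr i; rewrite nu_right// eqxx /(gap_len _); lra.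
Qed.

Lemma atom_le i : act i -> `|atom i| <= 1.
Proof.
move=> ai; have [Kl Kr _ _ _] := gap_spec cK K0 KL (act_in_gap ai).
have l0 := gap_len_gt0 cK K0 KL ai.
rewrite /atom normrZ normfV (gtr0_norm l0) ler_pdivrMl// mulr1.
by apply: (le_trans (Elip Kr Kl)); rewrite gtr0_norm.
Qed.

(** This is gap_sum for the first [N] gaps, those that are not between [s] and [t]
    contributing 0 on both sides. *)
Lemma nu_partial N s t : K s -> K t -> s <= t ->
  `|E t - E s - \sum_(0 <= i < N) (nu i t - nu i s) *: atom i|
    <= t - s - \sum_(0 <= i < N) (nu i t - nu i s).
Proof.
move=> Ks Kt st.
pose r := [seq i <- index_iota 0 N | [&& act i, s <= gap_left i & gap_right i <= t]].
have nuE i : nu i t - nu i s =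
    if [&& act i, s <= gap_left i & gap_right i <= t] then gap_len i else 0.
  have [ai|nai] := boolP (act i); last by rewrite !nu_def (negbTE nai) subrr.
  have [Kl Kr h1 h2 h] := gap_spec cK K0 KL (act_in_gap ai).
  rewrite !nu_def ai/=; have [sl|ls] := leP s (gap_left i).
    by rewrite (lt_geF (le_lt_trans sl (lt_trans h1 h2))) subr0.
  have -> : gap_right i <= s by case: (h _ Ks) => //; rewrite leNgt ls.
  by rewrite (le_trans _ st) ?subrr//; case: (h _ Ks) => //; rewrite leNgt ls.
have -> : \sum_(0 <= i < N) (nu i t - nu i s) = \sum_(i <- r) (gap_right i - gap_left i).
  by rewrite big_filter [RHS]big_mkcond; apply: eq_bigr => i _; rewrite nuE.
have -> : \sum_(0 <= i < N) (nu i t - nu i s) *: atom i =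
    \sum_(i <- r) (E (gap_right i) - E (gap_left i)).
  rewrite big_filter [RHS]big_mkcond; apply: eq_bigr => i _; rewrite nuE.
  case: ifP => [/and3P[ai _ _]|_]; last by rewrite scale0r.
  by rewrite scalerA mulfV ?scale1r// gt_eqF// (gap_len_gt0 cK K0 KL).
apply: (gap_sum Elip Ks Kt st).
- move=> i; rewrite mem_filter => /andP[/and3P[ai sl rt] _].
  have [Kl Kr h1 h2 _] := gap_spec cK K0 KL (act_in_gap ai).
  by split => //; exact: ltW (lt_trans h1 h2).
- move=> i j; rewrite !mem_filter => /andP[/and3P[ai _ _] _] /andP[/and3P[aj _ _] _].
  exact: (gap_disj cK K0 KL ai aj).
- by rewrite filter_uniq// iota_uniq.
Qed.

Let sum_cvg t : K t -> series (fun i => nu i t *: atom i) @ \oo -->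
  limn (series (fun i => nu i t *: atom i)).
Proof.
move=> Kt; apply: (@abs_series_cvg _ _ _ (t - theta t)) => N.
have h := nu_series cK Kitv K0 KL Kt.
apply: (@le_trans _ _ (series (nu ^~ t) N)).
  apply: ler_sum => i _; rewrite normrZ ger0_norm ?nu_ge0//.
  have [ai|nai] := boolP (act i); last by rewrite !nu_def (negbTE nai) mul0r.
  by rewrite ler_piMr ?nu_ge0// atom_le.
rewrite -(cvg_lim _ h)//; apply: nondecreasing_cvgn_le; last exact: (cvgP _ h).
by apply: nondecreasing_series => k _ _; exact: nu_ge0.
Qed.

(** The limit of nu_partial: outside the gaps only the measure of K is left to move
    along. *)
Lemma diffuse_lip s t : K s -> K t -> `|diffuse s - diffuse t| <= `|theta s - theta t|.
Proof.
wlog st : s t / s <= t.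
  move=> W Ks Kt; case: (leP s t) => h; first exact: W.
  by rewrite distrC [leRHS]distrC; apply: W => //; exact: ltW.
move=> Ks Kt; rewrite distrC [leRHS]distrC [leRHS]ger0_norm ?subr_ge0 ?theta_homo//.
pose u N := E t - E s - \sum_(0 <= i < N) (nu i t - nu i s) *: atom i.
have cu : u @ \oo --> diffuse t - diffuse s.
  have -> : diffuse t - diffuse s = E t - E s -
      (limn (series (fun i => nu i t *: atom i)) - limn (series (fun i => nu i s *: atom i))).
    rewrite /diffuse !opprD !opprK !addrA.
    by rewrite [LHS](ACl (1*4*3*6*(2*5))) /= addNr addr0.
  apply: cvgB; first exact: cvg_cst.
  have -> : (fun N => \sum_(0 <= i < N) (nu i t - nu i s) *: atom i) =
     series (fun i => nu i t *: atom i) \- series (fun i => nu i s *: atom i).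
    by apply/funext => N; rewrite /series/= -sumrB; apply: eq_bigr => i _; rewrite scalerBl.
  by apply: cvgB; exact: sum_cvg.
have cv : (fun N => t - s - \sum_(0 <= i < N) (nu i t - nu i s)) @ \oo -->
    theta t - theta s.
  have -> : theta t - theta s = t - s - ((t - theta t) - (s - theta s)) by ring.
  apply: cvgB; first exact: cvg_cst.
  have -> : (fun N => \sum_(0 <= i < N) (nu i t - nu i s)) =
     series (nu ^~ t) \- series (nu ^~ s).
    by apply/funext => N; rewrite /series/= -sumrB.
  by apply: cvgB; apply: nu_series.
rewrite -(cvg_lim _ (cvg_norm cu))// -(cvg_lim _ cv)//.
apply: ler_lim; [exact: cvgP (cvg_norm cu)|exact: cvgP cv|].
by apply: nearW => N; exact: nu_partial.
Qed.

Lemma diffuse0 : diffuse 0 = 0.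
Proof.
rewrite /diffuse subrr sub0r (_ : (fun _ => _) = 0).
  have -> : series (0 : nat -> X) = 0.
    by apply/funext => n; rewrite /series/= big1.
  by rewrite lim_cst ?oppr0.
by apply/funext => i; rewrite nu0// scale0r.
Qed.

Lemma theta0 : theta 0 = 0.
Proof.
apply: EFin_inj; rewrite -(thetaE cK); apply: (@null_sub _ _ [set 0]).
  by move=> x [_]; rewrite /= in_itv/= => h; apply/le_anti; rewrite andbC.
exact: lebesgue_measure_set1.
Qed.

Lemma diffuse_norm t : K t -> `|diffuse t| <= theta t.
Proof.
move=> Kt; have := diffuse_lip Kt K0.
by rewrite diffuse0 theta0 !subr0 [X in _ <= X]ger0_norm ?theta_ge0.
Qed.

(** The function t |-> f (theta t) + \sum_i e i * nu i t is 1-Lipschitz on K, since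
    by nu_series the variations of [theta] and of the [nu i] add up to t - s. *)
Lemma structure_functional (f : R -> R) (e : nat -> R) :
  (forall x y, `|f x - f y| <= `|x - y|) -> (forall i, `|e i| <= 1) ->
  exists z : {linear X -> R^o}, [/\ forall v, `|z v| <= `|v|,
    forall i, act i -> z (atom i) = e i &
    forall t, K t -> z (diffuse t) = f (theta t) - f 0].
Proof.
move=> flip e1.
pose H t : R := f (theta t) + limn (series (fun i => e i * nu i t)).
have Hcvg t : K t -> series (fun i => e i * nu i t) @ \oo -->
    limn (series (fun i => e i * nu i t)).
  move=> Kt; have h := nu_series cK Kitv K0 KL Kt.
  apply: (@abs_series_cvg _ _ _ (t - theta t)) => N.
  apply: (@le_trans _ _ (series (nu ^~ t) N)).
    apply: ler_sum => i _; rewrite normrM (ger0_norm (nu_ge0 cK K0 KL _ _))//.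
    by rewrite ler_piMl ?nu_ge0.
  rewrite -(cvg_lim _ h)//; apply: nondecreasing_cvgn_le; last exact: (cvgP _ h).
  by apply: nondecreasing_series => k _ _; exact: nu_ge0.
have Hlip s t : K s -> K t -> `|H s - H t| <= `|s - t|.
  wlog st : s t / s <= t.
    move=> W Ks Kt; case: (leP s t) => h; first exact: W.
    by rewrite distrC [leRHS]distrC; apply: W => //; exact: ltW.
  move=> Ks Kt; rewrite distrC [leRHS]distrC [leRHS]ger0_norm ?subr_ge0//.
  have hs := nu_series cK Kitv K0 KL Ks; have ht := nu_series cK Kitv K0 KL Kt.
  have -> : H t - H s = (f (theta t) - f (theta s)) +
      (limn (series (fun i => e i * nu i t)) - limn (series (fun i => e i * nu i s))).
    by rewrite /H; ring.
  have -> : t - s = (theta t - theta s) + ((t - theta t) - (s - theta s)) by ring.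
  rewrite (le_trans (ler_normD _ _))// lerD//.
    by rewrite (le_trans (flip _ _))// ger0_norm// subr_ge0 theta_homo.
  have /(_ _) c1 := cvgB (Hcvg _ Kt) (Hcvg _ Ks); have /(_ _) c2 := cvgB ht hs.
  rewrite -(cvg_lim _ (cvg_norm c1))// -(cvg_lim _ c2)//.
  apply: ler_lim; [exact: cvgP (cvg_norm c1)|exact: cvgP c2|].
  apply: nearW => N; rewrite !fctE /series/= -!sumrB (le_trans (ler_norm_sum _ _ _))//.
  apply: ler_sum => i _; rewrite -mulrBr normrM.
  rewrite [X in _ * X]ger0_norm ?subr_ge0 ?nu_homo//.
  by rewrite ler_piMl// subr_ge0 nu_homo.
have [_ /(_ H Hlip) [z [z1 zE]] _] := F; exists z.
have za i : act i -> z (atom i) = e i.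
  move=> ai; have [Kl Kr _ _ _] := gap_spec cK K0 KL (act_in_gap ai).
  have l0 := gap_len_gt0 cK K0 KL ai.
  rewrite /atom linearZ/= zE// /H theta_gap//.
  have -> : limn (series (fun j => e j * nu j (gap_right i))) =
      limn (series (fun j => e j * nu j (gap_left i))) + e i * gap_len i.
    apply/eqP; rewrite addrC -subr_eq; apply/eqP.
    apply: (cvg_unique _ (cvgB (Hcvg _ Kr) (Hcvg _ Kl))) => //.
    apply: cvg_near_cst; exists i.+1 => // N /= iN.
    rewrite !fctE /series/= -sumrB (bigD1_seq i) ?mem_index_iota ?iota_uniq//=.
    rewrite -mulrBr nu_right// eqxx big1 ?addr0// => j ji.
    by rewrite -mulrBr nu_right// (negbTE ji) mulr0.
  rewrite [X in _ *: X](_ : _ = e i * gap_len i); last by ring.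
  by rewrite /GRing.scale/= mulrCA mulVf ?mulr1// gt_eqF.
split => // t Kt.
have z1' v : `|z v| <= 1 * `|v| by rewrite mul1r.
have cz := contractive_cvg z1' (sum_cvg Kt).
have -> : z (diffuse t) = H t - H 0 - limn (series (fun i => e i * nu i t)).
  rewrite /diffuse linearB/= zE//; congr (_ - _).
  apply: (cvg_unique _ cz) => //.
  have -> : z \o series (fun i => nu i t *: atom i) = series (fun i => e i * nu i t).
    apply/funext => N; rewrite /series/= linear_sum; apply: eq_bigr => i _.
    rewrite linearZ/=; have [ai|nai] := boolP (act i); first by rewrite za// mulrC.
    by rewrite !nu_def (negbTE nai) scale0r mulr0.
  exact: Hcvg.
have -> : H 0 = f 0.
  rewrite /H theta0 (_ : (fun _ => _) = 0).
    have -> : series (0 : nat -> R) = 0 by apply/funext => n; rewrite /series/= big1.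
    by rewrite lim_cst ?addr0.
  by apply/funext => i; rewrite nu0// mulr0.
by rewrite /H; ring.
Qed.

Definition generators : set X :=
  [set v | (exists2 i, act i & v = atom i) \/ (exists2 t, K t & v = diffuse t)].

Lemma structure_span v : v \in closed_span_pred generators.
Proof.
have [_ _ dense] := F; apply: span_sub (dense v) => _ [x [y [Kx Ky ->]]].
have sp t : K t -> E t - E 0 \in closed_span_pred generators.
  move=> Kt; rewrite -[_ - _](subrK (limn (series (fun i => nu i t *: atom i)))).
  apply: rpredD; first by apply: span_gen; right; exists t.
  apply: (span_closed (sum_cvg Kt)) => N; apply: rpred_sum => i _.
  have [ai|nai] := boolP (act i); last by rewrite !nu_def (negbTE nai) scale0r rpred0.
  by apply/rpredZ/span_gen; left; exists i.
have -> : E x - E y = (E x - E 0) - (E y - E 0) by rewrite opprB addrA subrK.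
by apply: rpredB; exact: sp.
Qed.

(** [theta] is continuous and constant on gaps, so an intermediate value taken in a
    gap is also taken at the last point of K before it. *)
Lemma theta_onto u : 0 <= u <= theta L -> exists2 t, K t & theta t = u.
Proof.
move=> /andP[u0 uL]; have L0 : 0 <= L by have /andP[] := Kle Kitv KL.
have tlip s t : s <= t -> theta t - theta s <= t - s.
  move=> st; suff : (lambda (K `&` `[0%R, t]) <= lambda (K `&` `[0%R, s]) + (t - s)%:E)%E.
    by rewrite !(thetaE cK) -EFinD lee_fin; lra.
  apply: (@le_trans _ _ (lambda ((K `&` `[0%R, s]) `|` `]s, t]%classic))).
    apply: le_measure; rewrite ?inE.
    - by apply: measurableI => //; exact: mK.
    - by apply: measurableU => //; apply: measurableI => //; exact: mK.
    move=> x [Kx]; rewrite /= !in_itv/= => /andP[x0 xt].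
    by case: (leP x s) => xs; [left; rewrite x0|right].
  apply: le_trans (measureU2 _ _ _) _ => //.
    by apply: measurableI => //; exact: mK.
  have h2 : (lambda `]s, t]%classic <= (t - s)%:E)%E.
    rewrite lebesgue_measure_itv/= lte_fin; case: ltP => // ts.
    by rewrite lee_fin subr_ge0.
  exact: (leeD2l _ h2).
have tcont : {within `[0, L], continuous theta}.
  apply: continuous_subspaceT => x; apply/cvgrPdist_le => e e0; near=> y.
  have : `|x - y| <= e by near: y; exact: cvgr_dist_le.
  apply: le_trans; case: (leP x y) => xy.
    by rewrite distrC [leRHS]distrC !ger0_norm ?subr_ge0 ?theta_homo// tlip.
  by rewrite !ger0_norm ?subr_ge0 ?theta_homo ?(ltW xy)// tlip// ltW.
have [|c] := @IVT R theta 0 L u L0 tcont.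
  by rewrite theta0 (min_idPl (theta_ge0 _ _)) (max_idPr (theta_ge0 _ _)) u0.
rewrite in_itv/= => /andP[c0 cL] cu.
have [Ks sc ub] := sup_mem cK K0 c0; exists (sup (K `&` [set y | y <= c])) => //.
rewrite -cu; congr fine; congr lambda; apply/seteqP; split => x [Kx];
  rewrite /= !in_itv/= => /andP[x0 xc]; split => //; apply/andP; split => //.
- exact: le_trans sc.
- exact: ub.
Unshelve. all: by end_near. Qed.

(** In a null set t = \sum_i nu i t; finitely many gaps allow finitely many such
    sums. *)
Lemma act_infinite : lambda K = 0%E -> infinite_set K -> infinite_set [set i | act i].
Proof.
move=> lK Kinf Afin; apply: Kinf.
have th t : K t -> theta t = 0.
  move=> Kt; apply/le_anti; rewrite theta_ge0 andbT.
  suff : (lambda (K `&` `[0%R, t]) <= lambda K)%E by rewrite lK thetaE// lee_fin.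
  by apply: le_measure; rewrite ?inE//; [apply: measurableI => //; exact: mK|exact: mK].
have [N hN] : exists N, forall i, act i -> (i < N)%N.
  have /finite_seqP[r rE] := Afin; exists (\max_(i <- r) i).+1 => i ai.
  have ir : i \in r by have : [set i | act i] i by []; rewrite rE.
  by rewrite ltnS leq_bigmax_seq.
pose val (b : {ffun 'I_N -> bool}) : R := \sum_(i < N) (if b i then gap_len i else 0).
apply: (@sub_finite_set _ _ (range val)); last exact: finite_image.
move=> t Kt; exists [ffun i : 'I_N => act i && (gap_right i <= t)] => //.
have := nu_series cK Kitv K0 KL Kt; rewrite th// subr0 => h.
apply/esym; apply: (cvg_unique _ h) => //.
apply: cvg_near_cst; exists N => // n /= Nn.
have tail : \sum_(N <= i < n) nu i t = 0.
  apply: big1_seq => i /andP[_]; rewrite mem_index_iota => /andP[Ni _].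
  by rewrite !nu_def; case: ifP => // /andP[/hN]; rewrite ltnNge Ni.
rewrite /series/= (@big_cat_nat _ _ _ N)//= tail addr0 big_mkord /val.
by apply: eq_bigr => i _; rewrite ffunE.
Qed.

End Structure.

(** * Completeness of duals and of closed spans *)

Section Completeness.
Context {R : realType}.

(** A Cauchy filter is followed by points x n within 2^-(n+2); the series of their
    increments converges to its limit. *)
Lemma complete_of_series (V : normedModType R) :
  (forall u : nat -> V, (forall n, `|u n| <= 2^-1 ^+ n) -> cvgn (series u)) ->
  forall F : set_system V, ProperFilter F -> cauchy F -> cvg F.
Proof.
move=> cV F FF /cauchyP cF.
have h2 n : 0 < (2^-1 ^+ n.+2 : R) by rewrite exprn_gt0// invr_gt0.
have ex n : exists x, F (ball x (2^-1 ^+ n.+2 : R)) by exact: cF.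
have [x Fx] := choice ex.
pose u n := x n.+1 - x n.
have un n : `|u n| <= 2^-1 ^+ n.
  have [y [hy1 hy2]] := filter_ex (filterI (Fx n) (Fx n.+1)).
  rewrite -ball_normE/= in hy1; rewrite -ball_normE/= in hy2.
  have -> : u n = (x n.+1 - y) - (x n - y) by rewrite /u opprB addrA subrK.
  rewrite (le_trans (ler_normB _ _))//.
  have e0 := h2 n; rewrite !exprS in hy1 hy2 e0 *; lra.
have /cvg_ex[l xl] := cV u un.
have xc : x @ \oo --> l + x 0%N.
  have xE n : x n = series u n + x 0%N.
    rewrite /series/= /u; elim: n => [|n IH]; first by rewrite big_nil add0r.
    by rewrite big_nat_recr//= addrAC -IH addrC subrK.
  have -> : x @ \oo = (fun n => series u n + x 0%N) @ \oo.
    by rewrite [in LHS](funext xE).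
  by apply: (cvgD xl); exact: cvg_cst.
apply/cvg_ex; exists (l + x 0%N); apply/fcvgrPdist_lt => e e0.
have e2 : 0 < e / 2 by rewrite divr_gt0.
have /cvgrPdist_lt/(_ _ e2) h1 := xc.
have hg : (fun n => 2^-1 ^+ n : R) @ \oo --> 0.
  by apply: cvg_expr; rewrite ger0_norm ?invr_ge0// invf_lt1// ltr1n.
have /cvgrPdist_lt/(_ _ e2) h3 := hg.
have [n [h4 h5]] := filter_ex (filterI h1 h3).
apply: filterS (Fx n) => y; rewrite -ball_normE/= => hy.
rewrite -(subrK (x n) (l + _)) -addrA (le_lt_trans (ler_normD _ _))//.
rewrite sub0r normrN ger0_norm ?exprn_ge0 ?invr_ge0// in h5.
have h0 : 0 < (2^-1 ^+ n : R) by rewrite exprn_gt0// invr_gt0.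
rewrite !exprS in hy; lra.
Qed.

Lemma geometric_half_sum (N M : nat) :
  \sum_(N <= n < M) (2^-1 ^+ n : R) <= 2 * 2^-1 ^+ N.
Proof.
have h0 n : 0 <= (2^-1 ^+ n : R) by rewrite exprn_ge0// invr_ge0.
have [MN|NM] := leqP M N; first by rewrite big_geq// mulr_ge0.
suff : \sum_(N <= n < M) (2^-1 ^+ n : R) = 2 * 2^-1 ^+ N - 2 * 2^-1 ^+ M.
  by move=> ->; rewrite gerBl mulr_ge0.
rewrite (@telescope_sumr_eq _ _ _ (fun n => - (2 * 2^-1 ^+ n))) ?(ltnW NM)//.
  by rewrite opprK addrC.
by move=> k _; rewrite exprS; field.
Qed.

Section Dual.
Variable V : normedModType R.

(** The pointwise sum of a rapidly convergent series of functionals is bounded, and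
    its tails have small norm. *)
Lemma dual_complete (F : set_system (dual_space V)) :
  ProperFilter F -> cauchy F -> cvg F.
Proof.
move: F; apply: complete_of_series;
suff : forall u : nat -> dual_space V, (forall n, `|u n| <= 2^-1 ^+ n) ->
  cvgn (series u) by [].
move=> u un.
have uv n v : `|u n v| <= 2^-1 ^+ n * `|v|.
  apply: (le_trans (dual_norm_ub (u n) v)); apply: ler_wpM2r => //; exact: un.
pose f (v : V) : R^o := limn (series (fun n => u n v : R^o)).
have sumb N M v : `|\sum_(N <= n < M) u n v| <= 2 * 2^-1 ^+ N * `|v|.
  apply: (le_trans (ler_norm_sum _ _ _)).
  apply: (@le_trans _ _ (\sum_(N <= n < M) 2^-1 ^+ n * `|v|)).
    by apply: ler_sum => n _; exact: uv.
  by rewrite -mulr_suml; apply: ler_wpM2r => //; exact: geometric_half_sum.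
have fc v : series (fun n => u n v : R^o) @ \oo --> f v.
  apply: (@abs_series_cvg _ _ _ (2 * 2^-1 ^+ 0 * `|v|)) => N.
  apply: (@le_trans _ _ (\sum_(0 <= n < N) 2^-1 ^+ n * `|v|)).
    by apply: ler_sum => n _; exact: uv.
  by rewrite -mulr_suml; apply: ler_wpM2r => //; exact: geometric_half_sum.
have fl : linear f.
  move=> a v w; apply: (cvg_unique _ (fc _)) => //.
  have -> : series (fun n => u n (a *: v + w) : R^o) =
     (fun N => a *: series (fun n => u n v : R^o) N + series (fun n => u n w : R^o) N).
    apply/funext => N; rewrite /series/= scaler_sumr -big_split/=.
    by apply: eq_bigr => n _; rewrite linearP.
  by apply: (cvgD (cvgZl_tmp (fc v)) (fc w)).
have ftail N v : `|f v - \sum_(0 <= n < N) u n v| <= 2 * 2^-1 ^+ N * `|v|.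
  have c : (fun M => \sum_(0 <= n < M) u n v - \sum_(0 <= n < N) u n v) @ \oo -->
      f v - \sum_(0 <= n < N) u n v.
    by apply: cvgB; [exact: fc|exact: cvg_cst].
  rewrite -(cvg_lim _ (cvg_norm c))//; apply: limr_le; first exact: (cvgP _ (cvg_norm c)).
  exists N => // M /= NM; rewrite (@big_cat_nat _ _ _ N)//= addrAC subrr add0r.
  exact: sumb.
have fb v : `|f v| <= 2 * `|v|.
  by have := ftail 0%N v; rewrite big_nil subr0 mulr1.
pose fL : {linear V -> R^o} := HB.pack f (GRing.isLinear.Build R V R^o _ f fl).
have fP : f \in @dual_pred R V.
  rewrite inE; split => //.
  exact: (@contractive_continuous _ _ _ fL 2).
pose fD : dual_space V := exist _ f fP; apply/cvg_ex; exists fD.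
apply/cvgrPdist_le => e e0.
have hg : (fun n => 2 * 2^-1 ^+ n : R) @ \oo --> (2 * 0 : R).
  by apply: cvgMl_tmp; apply: cvg_expr; rewrite ger0_norm ?invr_ge0// invf_lt1// ltr1n.
have /cvgrPdist_le/(_ _ e0) := hg; apply: filterS => N.
rewrite mulr0 sub0r normrN ger0_norm ?mulr_ge0 ?exprn_ge0 ?invr_ge0// => hN.
apply: (@le_trans _ _ (2 * 2^-1 ^+ N)) => //.
apply: dual_norm_le => [|v]; first by rewrite mulr_ge0 ?exprn_ge0 ?invr_ge0.
have -> : dual_fun (fD - series u N : dual_space V) v =
    f v - \sum_(0 <= n < N) u n v.
  rewrite [LHS]/(f v - dual_fun (series u N : dual_space V) v); congr (_ - _).
  rewrite /series/=; elim: N {hN} => [|N IH]; first by rewrite !big_nil.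
  by rewrite !big_nat_recr//= -IH.
exact: ftail.
Qed.

HB.instance Definition _ := Uniform_isComplete.Build (dual_space V) dual_complete.

End Dual.

Section ClosedSpan.
Variables (V : completeNormedModType R) (S : set V).

Lemma closed_span_complete (F : set_system (closed_span S)) :
  ProperFilter F -> cauchy F -> cvg F.
Proof.
move: F; apply: complete_of_series.
suff : forall u : nat -> closed_span S, (forall n, `|u n| <= 2^-1 ^+ n) ->
  cvgn (series u) by [].
move=> u un.
have valS N : val (series u N) = series (fun n => val (u n)) N.
  rewrite /series/=; elim: N => [|N IH]; first by rewrite !big_nil.
  by rewrite !big_nat_recr//= -IH.
have /cvg_ex[l ul] : cvgn (series (fun n => val (u n))).
  apply: (@abs_series_cvg _ _ _ (2 * 2^-1 ^+ 0)) => N.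
  by apply: le_trans (geometric_half_sum 0 N); apply: ler_sum => n _; exact: un.
have lS : l \in closed_span_pred S.
  by apply: (span_closed ul) => N; rewrite -valS; exact: (valP (series u N)).
apply/cvg_ex; exists (exist _ l lS : closed_span S).
apply/cvgrPdist_le => e e0; have /cvgrPdist_le/(_ _ e0) := ul.
by apply: filterS => N; rewrite -valS.
Qed.

HB.instance Definition _ := Uniform_isComplete.Build (closed_span S) closed_span_complete.

End ClosedSpan.
End Completeness.

(** * Point masses on the closure *)

Section FreeClosure.
Context {R : realType} {T : metricType R} (A : set T) (o : A).
Local Notation d := (@mdist R T).
Local Notation X := (closed_span (range (delta o))).
Local Notation val_ := (@set_val T A).

Definition point_mass (x : A) : X :=
  exist _ (delta o x) (span_gen (imageT (delta o) x)).

Lemma dual_norm_lip (f : lip0 o) (x y : A) :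
  `|val f x - val f y| <= `|f| * d (val_ x) (val_ y).
Proof. exact: lip0_normP. Qed.

Lemma point_mass_lip x y : `|point_mass x - point_mass y| <= d (val_ x) (val_ y).
Proof.
apply: dual_norm_le => [|f]; first exact: mdist_ge0.
by rewrite mulrC; exact: dual_norm_lip.
Qed.

Lemma closure_approx p : closure A p -> forall n, exists x : A,
  d p (val_ x) < 2^-1 ^+ n.
Proof.
move=> cp n; have e0 : 0 < (2^-1 ^+ n : R) by rewrite exprn_gt0// invr_gt0.
have [|x [Ax]] := cp (ball p (2^-1 ^+ n : R)).
  by apply/metricType_numDomainType.nbhs_mdistP; exists (2^-1 ^+ n) => //; rewrite ballEmdist.
by rewrite ballEmdist => px; exists (SigSub (mem_set Ax)).
Qed.

Definition approx (p : T) : nat -> A := fun n => xget o [set x : A | d p (val_ x) < 2^-1 ^+ n].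

Lemma approxP p n : closure A p -> d p (val_ (approx p n)) < 2^-1 ^+ n.
Proof. by move=> cp; exact: (xgetPex o (closure_approx cp n)). Qed.

(** A point of the closure need not be a point of [A]: its mass is the limit of the
    point masses at points of [A] within 2^-n. *)
Definition mass (p : T) : X := limn (point_mass \o approx p).

Lemma mass_cvg p : closure A p -> point_mass \o approx p @ \oo --> mass p.
Proof.
move=> cp; apply: cauchy_cvg; apply: cauchy_exP => e e0.
have /cvgrPdist_lt/(_ (e / 2)) := @half_cvg R.
rewrite divr_gt0// => /(_ isT) [N _ hN].
exists (point_mass (approx p N)); exists N => // n /= Nn.
rewrite -ball_normE/=; apply: (le_lt_trans (point_mass_lip _ _)).
apply: (le_lt_trans (metric_triangle _ p _)); rewrite metric_sym.
have h1 := approxP N cp; have h2 := approxP n cp.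
have := hN N (leqnn N); have := hN n Nn.
have h0 k : 0 <= (2^-1 ^+ k : R) by rewrite exprn_ge0// invr_ge0.
rewrite !sub0r !normrN !ger0_norm//; lra.
Qed.

Lemma mass_lip p q : closure A p -> closure A q -> `|mass p - mass q| <= d p q.
Proof.
move=> cp cq; apply/ler_addgt0Pr => e e0.
have /(_ _) c := cvgB (mass_cvg cp) (mass_cvg cq).
have /cvgrPdist_lt/(_ (e / 2)) := @half_cvg R.
rewrite divr_gt0// => /(_ isT) [N _ hN].
rewrite -(cvg_lim _ (cvg_norm c))//; apply: limr_le; first exact: (cvgP _ (cvg_norm c)).
exists N => // n /= Nn; apply: (le_trans (point_mass_lip _ _)).
have h1 := approxP n cp; have h2 := approxP n cq.
have := hN n Nn.
rewrite sub0r normrN ger0_norm ?exprn_ge0 ?invr_ge0// => h3.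
have := metric_triangle (val_ (approx p n)) p (val_ (approx q n)).
have := metric_triangle p q (val_ (approx q n)).
rewrite (metric_sym _ p); lra.
Qed.

Lemma mass_val x : mass (val_ x) = point_mass x.
Proof.
have cx : closure A (val_ x) by apply: subset_closure; exact: set_valP.
apply: (cvg_unique _ (mass_cvg cx)) => //; apply: (@half_squeeze _ _ _ _ 1) => n.
rewrite mul1r; apply: (le_trans (point_mass_lip _ _)); exact: ltW (approxP n cx).
Qed.

(** Elements of [X] are functionals on Lipschitz functions; the functional wanted is
    the evaluation at the restriction of [h] to [A], normalised at the origin. *)
Lemma mass_functional (h : T -> R) :
  (forall p q, closure A p -> closure A q -> `|h p - h q| <= d p q) ->
  exists z : {linear X -> R^o}, (forall v, `|z v| <= `|v|) /\
    forall p q, closure A p -> closure A q -> z (mass p - mass q) = h p - h q.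
Proof.
move=> hlip.
have cA x : closure A (val_ x) by apply: subset_closure; exact: set_valP.
pose f0 (x : A) : R^o := h (val_ x) - h (val_ o).
have f0lip : is_lipschitz 1 f0.
  move=> x y; rewrite mul1r /f0 opprB addrA subrK; exact: hlip.
have f0P : f0 \in lip0_pred o.
  by rewrite inE/=; split; [exists 1|rewrite /f0 subrr].
pose f : lip0 o := exist _ f0 f0P.
have f1 : `|f| <= 1 by apply: lip0_norm_le.
pose z0 (v : X) : R^o := dual_fun (val v) f.
have zl : linear z0.
  move=> a u v; rewrite /z0.
  have -> : val (a *: u + v) = a *: val u + val v by rewrite linearP.
  by rewrite /dual_fun linearP.
pose z : {linear X -> R^o} := HB.pack z0 (GRing.isLinear.Build R X R^o _ z0 zl).
have z1 v : `|z v| <= `|v|.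
  apply: (le_trans (dual_norm_ub (val v) f)).
  rewrite -[X in _ <= X]mulr1; apply: (@ler_wpM2l _ `|v|) => //.
have z1' v : `|z v| <= 1 * `|v| by rewrite mul1r.
exists z; split => // p q cp cq.
suff zm p' : closure A p' -> z (mass p') = h p' - h (val_ o).
  by rewrite linearB !zm// opprB addrA subrK.
move=> {cp cq p q} cp; have cz := contractive_cvg z1' (mass_cvg cp).
apply: (cvg_unique _ cz) => //; apply: (@half_squeeze _ _ _ _ 1) => n.
rewrite [X in _ - X](_ : _ = h (val_ (approx p' n)) - h (val_ o))//.
rewrite opprB addrA subrK mul1r; apply: (le_trans (hlip _ _ cp (cA _))).
exact: ltW (approxP n cp).
Qed.

(** The mass at the origin is 0, so every point mass is an increment. *)
Lemma mass_dense v : v \in closed_span_pred (increments (closure A) mass).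
Proof.
have cA x : closure A (val_ x) by apply: subset_closure; exact: set_valP.
rewrite inE => U /nbhs_ballP[e /= e0 eU].
have [_ [n [c [s [Ss ->]]]] hw] := span_approx (valP v) e0.
have ex i : exists x : A, delta o x = s i by have [x _ <-] := Ss i; exists x.
have [x xE] := choice ex.
have mo : delta o o = 0.
  apply/val_inj/funext => f /=; have := valP f; rewrite inE => -[_ fo].
  exact: fo.
pose w : X := \sum_(i < n) c i *: (mass (val_ (x i)) - mass (val_ o)).
exists w; split.
  exists n, c, (fun i => mass (val_ (x i)) - mass (val_ o)); split => // i.
  by exists (val_ (x i)), (val_ o).
apply: eU; rewrite -ball_normE /=.
have -> : `|v - w| = `|val v - \sum_(i < n) c i *: s i|; last by [].
rewrite [LHS]/(`|val v - val w|); congr (`|_ - _|).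
rewrite /w; elim/big_ind2: _ => // [_ a _ b <- <-//|i _].
by rewrite !mass_val [LHS]/(c i *: (delta o (x i) - delta o o)) mo subr0 xE.
Qed.

Lemma mass_free : is_free d (closure A) mass.
Proof. split; [exact: mass_lip|exact: mass_functional|exact: mass_dense]. Qed.

End FreeClosure.

(** * Calculus and completeness of L1 *)

Section L1Tools.
Context d (T : measurableType d) (R : realType) (mu : {measure set T -> \bar R}).
Local Notation V := (LspaceType1 mu : normedModType R).
Local Notation intg f := (mu.-integrable setT (EFin \o f)).
Implicit Types f g : T -> R.

(** The class of an integrable function; the value 0 for other functions makes this
    a total map, which turns equalities between classes into equalities between
    functions. *)
Definition toL1 f : LspaceType1 mu :=
  if pselect (f \in Lfun mu 1) is left h then Lspace_pi (Lfun_Sub (lexx 1%E) h)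
  else (0 : V).

Lemma toL1E f (h : f \in Lfun mu 1) : toL1 f = Lspace_pi (Lfun_Sub (lexx 1%E) h).
Proof.
rewrite /toL1; case: pselect => // h'.
by rewrite (Prop_irrelevance h h').
Qed.

Lemma toL1_repr (v : LspaceType1 mu) : toL1 (Lspace_repr v) = v.
Proof.
rewrite (toL1E (LfunP (Lspace_repr v))) -[RHS]Lspace_reprK; congr Lspace_pi.
exact/LfuneqP.
Qed.

Lemma repr_integrable (v : LspaceType1 mu) : intg (Lspace_repr v).
Proof. by apply/Lfun1_integrable; exact: LfunP. Qed.

Lemma integrable_lin a f g : intg f -> intg g -> intg (fun x => a * f x + g x).
Proof.
move=> hf hg; have := integrableD measurableT (integrableZl measurableT a hf) hg.
by apply: eq_integrable => // x _ /=; rewrite EFinD EFinM.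
Qed.

Lemma toL1_lin a f g : intg f -> intg g ->
  toL1 (fun x => a * f x + g x) = a *: (toL1 f : V) + (toL1 g : V).
Proof.
move=> hf hg; have hl := integrable_lin a hf hg.
move/Lfun1_integrable in hf; move/Lfun1_integrable in hg; move/Lfun1_integrable in hl.
rewrite (toL1E hf) (toL1E hg) (toL1E hl).
rewrite [X in X + _]Lspace_pi_scale [RHS]Lspace_pi_add; congr Lspace_pi.
exact/LfuneqP.
Qed.

Lemma toL1_norm f : intg f -> (`|(toL1 f : V)|%:E = \int[mu]_x `|(f x)%:E|)%E.
Proof.
move=> hf; move/Lfun1_integrable in hf.
rewrite (toL1E hf) [X in (X%:E)%E]Lspace_pi_norm finite_norm_fine Lnorm1.
by [].
Qed.

Lemma toL1_ae f g : intg f -> intg g -> {ae mu, forall x, f x = g x} ->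
  toL1 f = toL1 g.
Proof.
move=> hf hg fg; move/Lfun1_integrable in hf; move/Lfun1_integrable in hg.
rewrite (toL1E hf) (toL1E hg); apply: Lspace_piP.
by apply: filterS fg => x /= -> _.
Qed.

Lemma intg0 : intg (fun=> 0).
Proof. exact: integrable0. Qed.

Lemma toL1_0 : toL1 (fun=> 0) = 0 :> V.
Proof.
have := toL1_lin 0 intg0 intg0; rewrite scale0r add0r => h.
have := toL1_lin 1 intg0 intg0; rewrite scale1r.
have -> : (fun x : T => 1 * 0 + 0) = (fun=> 0) :> (T -> R).
  by apply/funext => x; rewrite mul1r addr0.
by move/eqP; rewrite -subr_eq subrr => /eqP.
Qed.

Lemma intg_sum (I : Type) (s : seq I) (c : I -> R) (f : I -> T -> R) :
  (forall i, intg (f i)) -> intg (fun x => \sum_(i <- s) c i * f i x).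
Proof.
move=> hf; elim: s => [|i s IH].
  by under [X in EFin \o X]eq_fun do rewrite big_nil; exact: intg0.
under [X in EFin \o X]eq_fun do rewrite big_cons.
exact: integrable_lin.
Qed.

Lemma toL1_sum (I : Type) (s : seq I) (c : I -> R) (f : I -> T -> R) :
  (forall i, intg (f i)) ->
  toL1 (fun x => \sum_(i <- s) c i * f i x) = \sum_(i <- s) c i *: (toL1 (f i) : V).
Proof.
move=> hf; elim: s => [|i s IH].
  rewrite big_nil -toL1_0; congr toL1; apply/funext => x; exact: big_nil.
rewrite big_cons -IH -toL1_lin//; last exact: intg_sum.
by congr toL1; apply/funext => x; rewrite big_cons.
Qed.

Lemma toL1B f g : intg f -> intg g -> toL1 (fun x => f x - g x) = (toL1 f : V) - toL1 g.
Proof.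
move=> hf hg; rewrite addrC -scaleN1r -toL1_lin//; congr toL1.
by apply/funext => x; rewrite mulN1r addrC.
Qed.

Lemma intgB f g : intg f -> intg g -> intg (fun x => f x - g x).
Proof.
move=> hf hg; have := integrable_lin (-1) hg hf.
by congr integrable; apply/funext => x /=; rewrite mulN1r addrC.
Qed.

(** The Riesz-Fischer theorem for rapidly convergent series: the series of absolute
    values is integrable, hence almost everywhere finite, and dominates the partial
    sums, so that these converge in the mean by dominated convergence. *)
Lemma L1_complete (F : set_system V) : ProperFilter F -> cauchy F -> cvg F.
Proof.
move: F; apply: complete_of_series.
suff : forall u : nat -> V, (forall n, `|u n| <= 2^-1 ^+ n) -> cvgn (series u) by [].
move=> u un.
pose f n : T -> R := Lspace_repr (u n).
have intf n : intg (f n) by exact: repr_integrable.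
have mf n : measurable_fun setT (f n).
  by have /integrableP[/measurable_EFinP] := intf n.
have uE n : u n = toL1 (f n) by rewrite toL1_repr.
pose G x : \bar R := (\sum_(n <oo) `|(f n x)%:E|)%E.
have mG : measurable_fun setT G.
  apply: ge0_emeasurable_sum => [n x _ _|n _]; first exact: abse_ge0.
  by apply: measurableT_comp => //; exact/measurable_EFinP.
have G0 x : (0 <= G x)%E by apply: nneseries_ge0 => n _ _; exact: abse_ge0.
have intG : mu.-integrable setT G.
  apply/integrableP; split => //.
  under eq_integral do rewrite gee0_abs//.
  rewrite /G integral_nneseries//; last first.
    by move=> n; apply: measurableT_comp => //; exact/measurable_EFinP.
  apply: (@le_lt_trans _ _ (2%:E)); last exact: ltry.
  apply: lime_le; first by apply: is_cvg_nneseries => n _ _; exact: integral_ge0.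
  apply: nearW => N.
  rewrite (eq_bigr (fun n => (`|u n|)%:E)); last by move=> n _; rewrite -toL1_norm// uE.
  rewrite sumEFin lee_fin; apply: (@le_trans _ _ (\sum_(0 <= n < N) 2^-1 ^+ n)).
    by apply: ler_sum => n _; exact: un.
  by apply: (le_trans (geometric_half_sum 0 N)); rewrite expr0 mulr1.
pose S N x : R := \sum_(0 <= n < N) 1 * f n x.
have SE N x : S N x = series (fun n => f n x) N.
  by rewrite /S /series/=; apply: eq_bigr => n _; rewrite mul1r.
pose l x : \bar R := limn_esup (fun N => (S N x)%:E).
have intS N : intg (S N) by exact: intg_sum.
have mS N : measurable_fun setT (EFin \o S N) by have /integrableP[] := intS N.
have ml : measurable_fun setT l by apply: measurable_fun_limn_esup.
have aeG : {ae mu, forall x, G x \is a fin_num}.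
  by have := integrable_ae measurableT intG; apply: filterS => x /(_ I).
have cS x : G x \is a fin_num -> (fun N => (S N x)%:E) @ \oo --> (fine (l x))%:E.
  move=> Gx.
  have cv : cvgn (series (fun n => f n x : R^o)).
    apply: (@abs_series_cvg _ _ _ (fine (G x))) => N.
    rewrite -lee_fin fineK// -sumEFin.
    by apply: nneseries_lim_ge => n *; rewrite lee_fin.
  have ce : (fun N => (S N x)%:E) @ \oo --> (limn (series (fun n => f n x : R^o)))%:E.
    apply: cvg_EFin; first by apply: nearW.
    have -> : fine \o (fun N => (S N x)%:E) = series (fun n => f n x).
      by apply/funext => N /=; exact: SE.
    exact: cv.
  have -> : l x = (limn (series (fun n => f n x : R^o)))%:E.
    by rewrite /l is_cvg_limn_esupE; [exact: cvg_lim ce|exact: (cvgP _ ce)].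
  exact: ce.
have mfl : measurable_fun setT (EFin \o (fine \o l)).
  by apply/measurable_EFinP; apply: measurableT_comp => //; exact: measurable_fine.
have [] := @dominated_convergence _ _ _ mu setT measurableT (fun N => EFin \o S N)
   (EFin \o (fine \o l)) G mS mfl _ intG _.
- by apply: filterS aeG => x /cS h _.
- apply: aeW => x N _ /=.
  apply: (@le_trans _ _ (\sum_(0 <= n < N) `|(f n x)%:E|)%E).
    rewrite sumEFin lee_fin; apply: (le_trans (ler_norm_sum _ _ _)).
    by apply: ler_sum => n _; rewrite mul1r.
  by apply: nneseries_lim_ge => n *.
move=> intl cvg0 _.
apply/cvg_ex; exists (toL1 (fine \o l) : V).
apply/cvgrPdist_le => e e0.
have e0' : (0 < e%:E)%E by rewrite lte_fin.
have : \forall N \near \oo, (\int[mu]_x `|(EFin \o S N) x - (EFin \o (fine \o l)) x| <= e%:E)%E.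
  have := cvg0; move/fine_cvgP => -[fin0 /cvgrPdist_le/(_ e e0)].
  apply: filterS2 fin0 => N /= h1; rewrite sub0r normrN => h2.
  rewrite -(fineK h1) lee_fin; apply: le_trans h2; exact: ler_norm.
apply: filterS => N hN.
have -> : series u N = toL1 (S N).
  by rewrite /S toL1_sum// /series/=; apply: eq_bigr => n _; rewrite scale1r uE.
rewrite distrC -toL1B// -lee_fin toL1_norm; last exact: intgB.
exact: hN.
Qed.

HB.instance Definition _ :=
  Uniform_isComplete.Build (LspaceType mu (@lexx _ _ 1%E)) L1_complete.
HB.instance Definition _ := CompleteNormedModule.copy (LspaceType1 mu) (LspaceType mu (@lexx _ _ 1%E)).

End L1Tools.

(** * Isomorphisms from total families *)

Section Combination.
Context {R : realType} {I : Type}.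

(** Formal combinations of generators are lists of coefficients and indices, in
    which an index may occur several times. *)
Definition comb (V : lmodType R) (v : I -> V) (l : seq (R * I)) : V :=
  \sum_(p <- l) p.1 *: v p.2.

Definition scale_add (a : R) (l l' : seq (R * I)) :=
  [seq (a * p.1, p.2) | p <- l] ++ l'.

Lemma comb_scale_add (V : lmodType R) (v : I -> V) a l l' :
  comb v (scale_add a l l') = a *: comb v l + comb v l'.
Proof.
rewrite /comb /scale_add big_cat/= big_map scaler_sumr; congr +%R.
by apply: eq_bigr => p _; rewrite scalerA.
Qed.

Lemma comb1 (V : lmodType R) (v : I -> V) i : comb v [:: (1, i)] = v i.
Proof. by rewrite /comb big_seq1 scale1r. Qed.

Lemma comb_approx (V : normedModType R) (v : I -> V) x :
  x \in closed_span_pred (range v) -> forall n, exists l,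
  `|x - comb v l| <= 2^-1 ^+ n.
Proof.
move=> hx n; have e0 : 0 < (2^-1 ^+ n : R) by rewrite exprn_gt0// invr_gt0.
have [_ [k [c [s [Ss ->]]]] h] := span_approx hx e0.
have ex j : exists i, v i = s j by have [i _ <-] := Ss j; exists i.
have [i iE] := choice ex.
exists [seq (c j, i j) | j <- enum 'I_k]; apply: le_trans (ltW h).
rewrite /comb big_map big_enum/=.
by under eq_bigr do rewrite iE.
Qed.

Section Extension.
Variables (V : normedModType R) (W : completeNormedModType R).
Variables (v : I -> V) (w : I -> W) (C : R).
Hypothesis vw : forall l, `|comb w l| <= C * `|comb v l|.
Hypothesis dense : forall x, x \in closed_span_pred (range v).

Let vwB l l' : `|comb w l - comb w l'| <= C * `|comb v l - comb v l'|.
Proof.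
have := vw (scale_add (-1) l' l).
by rewrite !comb_scale_add !scaleN1r ![- _ + _]addrC.
Qed.

Let vwB' l l' : `|comb w l - comb w l'| <= `|C| * `|comb v l - comb v l'|.
Proof.
by apply: (le_trans (vwB l l')); apply: ler_wpM2r => //; exact: ler_norm.
Qed.

Let approx x := projT1 (choice (comb_approx (dense x))).

Let approxP x n : `|x - comb v (approx x n)| <= 2^-1 ^+ n.
Proof. exact: (projT2 (choice (comb_approx (dense x))) n). Qed.

Let ext x : W := limn (fun n => comb w (approx x n)).

Let ext_cvg x : (fun n => comb w (approx x n)) @ \oo --> ext x.
Proof.
apply: cauchy_cvg; apply: cauchy_exP => e e0.
have d0 : 0 < e / (2 * (`|C| + 1)) by rewrite divr_gt0// mulr_gt0// ltr_wpDl.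
have /cvgrPdist_lt/(_ _ d0) [N _ hN] := @half_cvg R.
exists (comb w (approx x N)); exists N => // n /= Nn.
rewrite -ball_normE/=; apply: (le_lt_trans (vwB' _ _)).
have h1 := approxP x N; have h2 := approxP x n.
have := hN N (leqnn N); have := hN n Nn.
have hh k : 0 <= (2^-1 ^+ k : R) by rewrite exprn_ge0// invr_ge0.
rewrite /= !sub0r !normrN !(ger0_norm (hh _)) => h3 h4.
have : `|comb v (approx x N) - comb v (approx x n)| < 2 * (e / (2 * (`|C| + 1))).
  have -> : comb v (approx x N) - comb v (approx x n) =
    (x - comb v (approx x n)) - (x - comb v (approx x N)) by rewrite opprB [RHS]addrC addrA subrK.
  by apply: (le_lt_trans (ler_normB _ _)); lra.
set z := `|_ - _| => hz.
have C0 : 0 <= `|C| := normr_ge0 C.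
have z0 : 0 <= z by exact: normr_ge0.
have hz' : z * (`|C| + 1) < e.
  have c1 : 0 < `|C| + 1 by rewrite ltr_wpDl.
  rewrite -ltr_pdivlMr//; apply: (lt_le_trans hz).
  by rewrite le_eqVlt; apply/orP; left; apply/eqP; field; rewrite gt_eqF.
by rewrite mulrDr mulr1 in hz'; lra.
Qed.

Let ext_uniq x l C' : (forall n, `|x - comb v (l n)| <= C' * 2^-1 ^+ n) ->
  (fun n => comb w (l n)) @ \oo --> ext x.
Proof.
move=> hl; rewrite -[ext x]add0r.
have -> : (fun n => comb w (l n)) =
   (fun n => (comb w (l n) - comb w (approx x n)) + comb w (approx x n)).
  by apply/funext => n; rewrite subrK.
apply: cvgD; last exact: ext_cvg.
apply: (@half_squeeze _ _ _ _ (`|C| * (C' + 1))) => n.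
rewrite sub0r normrN; apply: (le_trans (vwB' _ _)).
rewrite -mulrA; apply: ler_wpM2l => //.
have -> : comb v (l n) - comb v (approx x n) =
    (x - comb v (approx x n)) - (x - comb v (l n)) by rewrite opprB [RHS]addrC addrA subrK.
apply: (le_trans (ler_normB _ _)); rewrite mulrDl mul1r addrC.
by apply: lerD; [exact: hl|exact: approxP].
Qed.

Let ext_linear : linear ext.
Proof.
move=> a x y.
have h : (fun n => comb w (scale_add a (approx x n) (approx y n))) @ \oo --> ext (a *: x + y).
  apply: (@ext_uniq _ _ (`|a| + 1)) => n; rewrite comb_scale_add opprD addrACA -scalerBr.
  apply: (le_trans (ler_normD _ _)); rewrite mulrDl mul1r normrZ.
  by apply: lerD; [apply: ler_wpM2l => //; exact: approxP|exact: approxP].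
apply/esym; apply: (cvg_unique _ _ h) => //.
have -> : (fun n => comb w (scale_add a (approx x n) (approx y n))) =
  (fun n => a *: comb w (approx x n) + comb w (approx y n)).
  by apply/funext => n; rewrite comb_scale_add.
by apply: (cvgD (cvgZl_tmp (@ext_cvg x)) (@ext_cvg y)).
Qed.

(** A vector is approximated by combinations of the [v i] within 2^-n; the
    corresponding combinations of the [w i] form a Cauchy sequence. *)
Lemma extension : exists f : {linear V -> W},
  (forall x, `|f x| <= C * `|x|) /\ forall i, f (v i) = w i.
Proof.
pose f : {linear V -> W} := HB.pack ext (GRing.isLinear.Build R V W _ ext ext_linear).
exists f; split => [x|i].
  have /(_ _) c1 := cvg_norm (@ext_cvg x).
  have xv : (fun n => comb v (approx x n)) @ \oo --> x.
    by apply: (@half_squeeze _ _ _ _ 1) => n; rewrite mul1r.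
  have c2 : (fun n => C * `|comb v (approx x n)|) @ \oo --> C * `|x|.
    by apply: cvgMl_tmp; exact: cvg_norm.
  rewrite -[f x]/(ext x) -(cvg_lim _ c1)// -(cvg_lim _ c2)//.
  apply: ler_lim; [exact: cvgP c1|exact: cvgP c2|apply: nearW => n; exact: vw].
have h : (fun n : nat => comb w [:: (1, i)]) @ \oo --> ext (v i).
  apply: (@ext_uniq _ _ 0) => n; rewrite comb1 subrr normr0 mul0r//.
rewrite -[f _]/(ext _) -(comb1 w i); apply: (cvg_unique _ h) => //; exact: cvg_cst.
Qed.

End Extension.

Lemma linear_dense_eq (V W : normedModType R) (f g : {linear V -> W}) (v : I -> V) C C' :
  (forall x, `|f x| <= C * `|x|) -> (forall x, `|g x| <= C' * `|x|) ->
  (forall x, x \in closed_span_pred (range v)) ->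
  (forall i, f (v i) = g (v i)) -> f =1 g.
Proof.
move=> fC gC dense fg x.
have [l hl] := choice (comb_approx (dense x)).
have xv : (fun n => comb v (l n)) @ \oo --> x.
  by apply: (@half_squeeze _ _ _ _ 1) => n; rewrite mul1r.
apply: (cvg_unique _ (contractive_cvg fC xv)) => //.
have -> : f \o (fun n => comb v (l n)) = g \o (fun n => comb v (l n)).
  apply/funext => n; rewrite /= /comb !linear_sum; apply: eq_bigr => p _.
  by rewrite !linearZ fg.
exact: (contractive_cvg gC xv).
Qed.

(** Both maps exist by extension, and are inverse to each other because this holds
    on a total family. *)
Lemma generators_iso (V W : completeNormedModType R) (v : I -> V) (w : I -> W) c C :
  (forall l, `|comb w l| <= C * `|comb v l|) ->
  (forall l, `|comb v l| <= c * `|comb w l|) ->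
  (forall x, x \in closed_span_pred (range v)) ->
  (forall x, x \in closed_span_pred (range w)) ->
  exists (f : {linear V -> W}) (g : {linear W -> V}),
    [/\ cancel f g, cancel g f, forall x, `|f x| <= C * `|x|
      & forall y, `|g y| <= c * `|y| ].
Proof.
move=> vw wv dv dw; have [f [fC fv]] := extension vw dv.
have [g [gC gw]] := extension wv dw; exists f, g.
have comp (V1 V2 : normedModType R) (h : {linear V1 -> V2}) (k : {linear V2 -> V1}) a b :
    (forall x, `|h x| <= a * `|x|) -> (forall x, `|k x| <= b * `|x|) ->
    forall x, `|(k \o h) x| <= (`|b| * a) * `|x|.
  move=> ha kb x /=; apply: (le_trans (kb _)).
  apply: (@le_trans _ _ (`|b| * `|h x|)); first by apply: ler_wpM2r => //; exact: ler_norm.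
  by rewrite -mulrA; apply: ler_wpM2l.
have id1 (V1 : normedModType R) (x : V1) : `|(idfun : {linear V1 -> V1}) x| <= 1 * `|x|.
  by rewrite mul1r.
split => // [x|y].
- apply: (@linear_dense_eq _ _ (g \o f : {linear V -> V}) idfun _ _ _ (comp _ _ _ _ _ _ fC gC) (@id1 _) dv).
  by move=> i /=; rewrite fv gw.
- apply: (@linear_dense_eq _ _ (f \o g : {linear W -> W}) idfun _ _ _ (comp _ _ _ _ _ _ gC fC) (@id1 _) dw).
  by move=> i /=; rewrite gw fv.
Qed.

End Combination.

(** * The null case *)

Section Coefficients.
Context {R : realType}.
Implicit Types l : seq (R * nat).

(** A formal combination of a sequence of vectors with repetitions removed: [coef]
    adds up the coefficients of one index, and [bound] bounds all indices. *)
Definition coef l n : R := \sum_(p <- l) p.1 * (p.2 == n)%:R.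
Definition bound l : nat := \max_(p <- l) p.2.+1.

Lemma comb_coef (V : lmodType R) (v : nat -> V) l M : (bound l <= M)%N ->
  comb v l = \sum_(0 <= n < M) coef l n *: v n.
Proof.
rewrite /bound /comb => lM.
have -> : \sum_(0 <= n < M) coef l n *: v n =
    \sum_(p <- l) \sum_(0 <= n < M) (p.1 * (p.2 == n)%:R) *: v n.
  by rewrite exchange_big/=; apply: eq_bigr => n _; rewrite /coef scaler_suml.
elim: l lM => [|p l IH] lM; first by rewrite !big_nil.
rewrite !big_cons in lM *; rewrite geq_max in lM; have /andP[pM lM'] := lM.
rewrite -(IH lM'); congr +%R.
rewrite (bigD1_seq p.2) ?mem_index_iota ?iota_uniq//= eqxx mulr1 big1 ?addr0// => n.
by rewrite eq_sym => /negbTE ->; rewrite mulr0 scale0r.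
Qed.

Lemma comb_norm_le (V : normedModType R) (v : nat -> V) l M : (bound l <= M)%N ->
  (forall n, `|v n| <= 1) -> `|comb v l| <= \sum_(0 <= n < M) `|coef l n|.
Proof.
move=> lM v1; rewrite (comb_coef _ lM); apply: (le_trans (ler_norm_sum _ _ _)).
by apply: ler_sum => n _; rewrite normrZ ler_piMr.
Qed.

End Coefficients.

Section Ell1.
Context {R : realType}.
Local Notation V := (LspaceType1 (@counting nat R) : normedModType R).

Definition unit_fun (j n : nat) : R := (n == j)%:R.

Lemma counting_norm (f : nat -> R) : (counting : set nat -> \bar R).-integrable setT (EFin \o f) ->
  (`|(toL1 counting f : V)|%:E = \sum_(n <oo) `|(f n)%:E|)%E.
Proof. by move=> hf; rewrite toL1_norm// ge0_integral_count. Qed.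

Lemma counting_integrable (f : nat -> R) :
  (counting : set nat -> \bar R).-integrable setT (EFin \o f) <->
  (\sum_(n <oo) `|(f n)%:E| < +oo)%E.
Proof.
split => [/integrableP[_]|h]; first by rewrite ge0_integral_count.
by apply/integrableP; split => //; rewrite ge0_integral_count.
Qed.

Lemma eseries_finite (f : nat -> R) M : (forall n, (M <= n)%N -> f n = 0) ->
  (\sum_(n <oo) `|(f n)%:E|)%E = (\sum_(0 <= n < M) `|f n|)%:E.
Proof.
move=> fM; rewrite (@nneseries_split _ _ 0 M)// add0n eseries0 ?adde0 ?sumEFin//.
by move=> n Mn _; rewrite fM// abse0.
Qed.

Lemma unit_integrable j :
  (counting : set nat -> \bar R).-integrable setT (EFin \o unit_fun j).
Proof.
apply/counting_integrable; rewrite (@eseries_finite _ j.+1) ?ltry// => n jn.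
by rewrite /unit_fun gtn_eqF.
Qed.

Lemma unit_fun_sum (u : nat -> R) M n :
  \sum_(0 <= i < M) u i * unit_fun i n = if (n < M)%N then u n else 0.
Proof.
case: ifP => nM; last first.
  rewrite big_nat_cond big1// => i; rewrite andbT => /andP[_ iM].
  by rewrite /unit_fun (_ : n == i = false) ?mulr0//; apply: contraFF nM => /eqP ->.
rewrite (bigD1_seq n) ?mem_index_iota ?iota_uniq//= /unit_fun eqxx mulr1 big1 ?addr0// => i.
by rewrite eq_sym => /negbTE ->; rewrite mulr0.
Qed.

Definition unit_vec j : LspaceType1 (@counting nat R) := toL1 counting (unit_fun j).

Lemma unit_comb_norm (l : seq (R * nat)) M : (bound l <= M)%N ->
  `|(comb (unit_vec : nat -> V) l)| = \sum_(0 <= n < M) `|coef l n|.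
Proof.
move=> lM; apply: EFin_inj; rewrite (comb_coef _ lM).
rewrite -(toL1_sum _ _ unit_integrable) counting_norm; last exact: (intg_sum _ _ unit_integrable).
have fE n : \sum_(0 <= i < M) coef l i * unit_fun i n = if (n < M)%N then coef l n else 0.
  exact: unit_fun_sum.
rewrite (@eseries_finite _ M) => [|n Mn]; last by rewrite fE ltnNge Mn.
congr EFin; rewrite big_nat_cond [RHS]big_nat_cond; apply: eq_bigr => n.
by rewrite andbT => /andP[_ nM]; rewrite fE nM.
Qed.

(** The norm of a tail of a summable family is the tail of its norm. *)
Lemma unit_dense (y : V) : y \in closed_span_pred (range (unit_vec : nat -> V)).
Proof.
pose u := Lspace_repr y; have iu : _.-integrable setT (EFin \o u) := repr_integrable y.
have yE : y = toL1 counting u by rewrite toL1_repr.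
pose S N : V := \sum_(0 <= n < N) u n *: (unit_vec n : V).
have SE N : S N = toL1 counting (fun x => \sum_(0 <= n < N) u n * unit_fun n x).
  by rewrite toL1_sum//; exact: unit_integrable.
have sfin : (\sum_(n <oo) `|(u n)%:E| < +oo)%E by apply/counting_integrable.
have tailE N : (`|y - S N|%:E = \sum_(N <= n <oo) `|(u n)%:E|)%E.
  have iS := intg_sum (index_iota 0 N) u unit_integrable.
  rewrite SE yE -toL1B// counting_norm; last exact: intgB.
  have sumE n : \sum_(0 <= i < N) u i * unit_fun i n = if (n < N)%N then u n else 0.
    exact: unit_fun_sum.
  rewrite (@nneseries_split _ _ 0 N)// add0n big_nat_cond big1 ?add0e; last first.
    by move=> n; rewrite andbT => /andP[_ nN]; rewrite sumE nN subrr abse0.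
  rewrite eseries_cond [RHS]eseries_cond; apply: eq_eseriesr => n /= Nn.
  by rewrite sumE ltnNge Nn/= subr0.
apply: (@span_closed _ _ _ S); last first.
  move=> N; apply: rpred_sum => n _; apply: rpredZ; apply: span_gen.
  by exists n.
apply/cvgrPdist_le => e e0.
have := nneseries_tail_cvg sfin (fun k _ => abse_ge0 _).
move=> /fine_cvgP[fin0 /cvgrPdist_le/(_ e e0)].
apply: filterS2 fin0 => N /= h1; rewrite sub0r normrN => h2.
rewrite -lee_fin tailE -(fineK h1) lee_fin; apply: le_trans h2; exact: ler_norm.
Qed.

End Ell1.

Section IsometricCase.
Context {R : realType}.
Local Notation lambda := (@lebesgue_measure R).
Variables (K : set R) (L : R).
Hypotheses (cK : closed K) (Kitv : K `<=` `[0, L]) (K0 : K 0) (KL : K L).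
Variables (X : completeNormedModType R) (E : R -> X).
Hypothesis F : is_free (fun s t : R => `|s - t|) K E.
Hypotheses (lK : lambda K = 0%E) (Kinf : infinite_set K).
Local Notation act := (act K L).
Local Notation atom := (atom K E).

(** The atoms have norm at most 1, and the functional with value the sign of the
    coefficient at every atom shows that a combination has the norm it has in l1.
    They are total since the diffuse part has norm at most the measure of K. *)
Lemma isometric_case : linearly_isometric X (ell1 R).
Proof.
have [en en_inj en_act] : exists2 en : nat -> nat, injective en &
    range en = [set i | act i].
  have Ainf := act_infinite cK Kitv K0 KL lK Kinf.
  have : ([set: nat] #= [set i | act i])%card by apply/card_esym/eq_card_nat.
  move=> /card_set_bijP[en [ef ei es]]; exists en.
    by move=> m n; apply: ei; rewrite inE.
  apply/seteqP; split => [_ [n _ <-]|i /es[n _ <-]]; [exact: ef|by exists n].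
have ena n : act (en n).
  by have : [set i | act i] (en n) by rewrite -en_act; exists n.
pose v n : X := atom (en n).
have v1 n : `|v n| <= 1 by exact: (atom_le cK K0 KL F).
have lower l M : (bound l <= M)%N -> \sum_(0 <= n < M) `|coef l n| <= `|comb v l|.
  move=> lM; pose inv i := xget 0%N [set n | en n = i].
  have invK n : inv (en n) = n.
    by rewrite /inv; case: xgetP => [m _ /en_inj//|/(_ n)[]].
  have [||z [z1 za _]] := structure_functional cK Kitv K0 KL F (f := fun=> 0)
    (e := fun i => Num.sg (coef l (inv i))).
  - by move=> x y; rewrite subrr normr0.
  - by move=> i; rewrite normr_sg lern1 leq_b1.
  apply: le_trans (z1 _); apply: le_trans (ler_norm _).
  rewrite (comb_coef _ lM) linear_sum/=; apply: ler_sum => n _.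
  by rewrite linearZ/= za// invK /GRing.scale/= mulrC -normrEsg.
have eqn l : `|comb v l| = `|comb (unit_vec : nat -> (LspaceType1 (@counting nat R) : normedModType R)) l|.
  rewrite (unit_comb_norm (leqnn (bound l))); apply/le_anti.
  by rewrite comb_norm_le// lower.
have [||||f [g [fK gK f1 g1]]] := @generators_iso R nat X
    (LspaceType1 (@counting nat R) : completeNormedModType R) v unit_vec 1 1.
- by move=> l; rewrite mul1r -eqn.
- by move=> l; rewrite mul1r eqn.
- move=> x; apply: span_sub (structure_span cK Kitv K0 KL F x) => _ [[i ai ->]|[t Kt ->]].
    have : [set i | act i] i by [].
    by rewrite -en_act => -[n _ <-]; apply: span_gen; exists n.
  suff -> : diffuse K L E t = 0 by rewrite rpred0.
  apply/eqP; rewrite -normr_eq0 eq_le normr_ge0 andbT.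
  apply: (le_trans (diffuse_norm cK Kitv K0 KL F Kt)).
  have : (lambda (K `&` `[0%R, t]) <= lambda K)%E.
    by apply: le_measure; rewrite ?inE//; [apply: measurableI => //; exact: mK|exact: mK].
  by rewrite lK thetaE.
- exact: unit_dense.
exists f; split; last by move=> y; exists (g y); rewrite gK.
move=> x; apply/le_anti; have := f1 x; have := g1 (f x).
by rewrite fK !mul1r => -> ->.
Qed.

End IsometricCase.

(** * Step functions in L1 of the unit interval *)

(** Continuity of a measure from above, applied to the complements. *)
Lemma measure_exhaust d (T : measurableType d) (R : realType)
    (mu : {measure set T -> \bar R}) (B : (set T)^nat) (e : R) :
  (forall n, measurable (B n)) -> nondecreasing_seq B ->
  (mu (\bigcup_n B n) < +oo)%E -> 0 < e ->
  \forall n \near \oo, (mu (\bigcup_n B n `\` B n) <= e%:E)%E.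
Proof.
move=> mB ndB Uoo e0; set U := \bigcup_n B n.
have mU : measurable U by exact: bigcupT_measurable.
have U0 : \bigcap_n (U `\` B n) = set0.
  by rewrite -subset0 => x h; have [[n _ Bx] _] := h 0%N I; have [_] := h n I.
have mD n : measurable (U `\` B n) by exact: measurableD.
have lt0 : (mu (U `\` B 0%N) < +oo)%E.
  by apply: le_lt_trans Uoo; apply: le_measure; rewrite ?inE//; exact: subDsetl.
have mI : measurable (\bigcap_n (U `\` B n)) by rewrite U0.
have ni : nonincreasing_seq (fun n => U `\` B n).
  move=> m n mn; apply/subsetPset => x [Ux nB]; split => // Bm; apply: nB.
  by have /subsetPset h := ndB _ _ mn; exact: h.
have := nonincreasing_cvg_mu lt0 mD mI ni; rewrite U0 measure0.
move=> /fine_cvgP[fin0 /cvgrPdist_le/(_ e e0)].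
apply: filterS2 fin0 => n /= h1; rewrite sub0r normrN => h2.
by rewrite -(fineK h1) lee_fin; apply: le_trans h2; exact: ler_norm.
Qed.

Section UnitInterval.
Context {R : realType}.
Local Notation mu01 := (mrestr (@lebesgue_measure R) (measurable_itv `[0%R, 1%R])).
Local Notation Y := (LspaceType1 mu01 : normedModType R).
Local Notation intg f := ((mu01 : measure _ _).-integrable setT (EFin \o f)).

Lemma mu01_le1 (A : set R) : measurable A -> (mu01 A <= 1%:E)%E.
Proof.
move=> mA; rewrite /mrestr (@le_trans _ _ (@lebesgue_measure R `[0%R, 1%R]))//.
  by apply: le_measure; rewrite ?inE//=; exact: measurableI.
by rewrite lebesgue_measure_itv/= lte_fin ltr01 oppr0 adde0.
Qed.

Lemma intg_indic (A : set R) : measurable A -> intg (\1_A : R -> R).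
Proof.
move=> mA; apply/integrableP; split; first by apply/measurable_EFinP; exact: measurable_indic.
under eq_integral do rewrite /= ger0_norm//.
rewrite integral_indic// setIT.
by rewrite (le_lt_trans (mu01_le1 mA))// ltry.
Qed.

Definition ind (A : set R) : LspaceType1 mu01 := toL1 mu01 (\1_A : R -> R).

Lemma ind_norm (A : set R) : measurable A -> (`|(ind A : Y)|%:E = mu01 A)%E.
Proof.
move=> mA; rewrite /ind toL1_norm; last exact: intg_indic.
under eq_integral do rewrite /= ger0_norm//.
by rewrite integral_indic// setIT.
Qed.

Lemma indD (A B : set R) : measurable A -> measurable B -> A `<=` B ->
  ind (B `\` A) = (ind B : Y) - ind A.
Proof.
move=> mA mB AB; rewrite /ind -toL1B; try exact: intg_indic.
congr toL1; apply/funext => x; rewrite !indicE in_setD.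
have [xA|xA] := boolP (x \in A) => /=; last by rewrite subr0 andbT.
by rewrite (mem_set (AB _ (set_mem xA)))//= subrr.
Qed.

Definition step (u : R) : LspaceType1 mu01 := ind `]0, u].
Definition steps : set Y := [set (step u : Y) | u in `[0, 1]].

Lemma null_ae (P : R -> Prop) (N : set R) : measurable N -> mu01 N = 0%E ->
  (forall x, ~ N x -> P x) -> {ae mu01, forall x, P x}.
Proof.
move=> mN N0 h; exists N; split => // x /= nP; apply: contrapT => nN; apply: nP.
exact: h.
Qed.

Lemma ind_ae (A B : set R) : measurable A -> measurable B ->
  (forall x, 0 < x <= 1 -> A x <-> B x) -> ind A = ind B.
Proof.
move=> mA mB AB; apply: toL1_ae; try exact: intg_indic.
apply: (@null_ae _ (~` `]0, 1]%classic)); first exact: measurableC.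
  apply: (@subset_measure0 _ _ _ (@lebesgue_measure R) _ [set 0]).
  - by apply: measurableI => //; exact: measurableC.
  - by [].
  - move=> x []; rewrite /= !in_itv/= => h1 /andP[x0 x1].
    by apply/le_anti; rewrite x0 andbT leNgt; apply/negP => h; apply: h1; rewrite h.
  - exact: lebesgue_measure_set1.
move=> x /contrapT; rewrite /= in_itv/= => h; rewrite !indicE; congr (_%:R).
by congr nat_of_bool; apply/idP/idP => /set_mem h'; apply/mem_set; have [h1 h2] := AB x h; auto.
Qed.

Lemma step_span u : (step u : Y) \in closed_span_pred steps.
Proof.
have [u1|u1] := leP u 1; last first.
  have -> : step u = step 1.
    apply: ind_ae => // x /andP[x0 x1]; rewrite /= !in_itv/= x0 x1.
    by rewrite (le_trans x1 (ltW u1)).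
  by apply: span_gen; exists 1; rewrite //= in_itv/= ler01 lexx.
have [u0|u0] := leP 0 u.
  by apply: span_gen; exists u; rewrite //= in_itv/= u0 u1.
have -> : step u = step 0.
  apply: ind_ae => // x /andP[x0 x1]; rewrite /= !in_itv/= x0/=.
  by rewrite (lt_geF x0) (lt_geF (lt_trans u0 x0)).
by apply: span_gen; exists 0; rewrite //= in_itv/= ler01 lexx.
Qed.

(** The sets whose indicator is in the closed span of the steps form a lambda
    system, and it contains the half-open intervals, which are stable under
    intersection and generate the Borel sets. *)
Lemma ind_span (A : set R) : measurable A -> (ind A : Y) \in closed_span_pred steps.
Proof.
move=> mA.
pose H := [set B : set R | measurable B /\ (ind B : Y) \in closed_span_pred steps].
suff : measurable `<=` H by move=> /(_ A mA)[].
apply: (@lambda_system_subset _ (@ocitv R)) => //.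
- by move=> B C; exact: ocitvI.
- split => //.
  + split => //; have -> : ind setT = step 1; last exact: step_span.
    apply: ind_ae => // x /andP[x0 x1]; rewrite /= in_itv/= x0 x1.
  + move=> B C CB [mB hB] [mC hC]; split; first exact: measurableD.
    by rewrite indD//; exact: rpredB.
  + move=> B ndB hB.
    have mB n : measurable (B n) by case: (hB n).
    have mU : measurable (\bigcup_n B n) by exact: bigcupT_measurable.
    split => //; apply: (@span_closed _ _ _ (fun n => ind (B n) : Y)); last first.
      by move=> n; case: (hB n).
    have BU n : B n `<=` \bigcup_n B n by exact: bigcup_sup.
    apply/cvgrPdist_le => e e0.
    have Uoo : (mu01 (\bigcup_n B n) < +oo)%E.
      by rewrite (le_lt_trans (mu01_le1 mU))// ltry.
    have := @measure_exhaust _ _ R mu01 B e mB ndB Uoo e0.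
    apply: filterS => n hn; rewrite -indD// -lee_fin ind_norm//.
    exact: measurableD.
- move=> _ [[a b] _ <-] /=; split => //.
  have [ab|ba] := leP a b; last first.
    have -> : ind `]a, b] = step 0; last exact: step_span.
    apply: ind_ae => // x /andP[x0 x1]; rewrite /= !in_itv/= x0/= (lt_geF x0).
    by split => // /andP[h1 h2]; have := lt_le_trans (lt_trans ba h1) h2; rewrite ltxx.
  have -> : ind `]a, b] = (step b : Y) - step a.
    rewrite -indD//; last first.
      by move=> x; rewrite /= !in_itv/= => /andP[-> /le_trans]; exact.
    apply: ind_ae => //; first exact: measurableD.
    move=> x /andP[x0 x1]; split; rewrite /= !in_itv/= x0/=.
      by move=> /andP[ax ->]; split => //; apply/negP; rewrite -ltNge.
    by move=> [-> /negP]; rewrite -ltNge => ->.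
  by apply: rpredB; exact: step_span.
Qed.

(** Simple functions are dense, and they are combinations of indicators. *)
Lemma steps_dense (y : Y) : y \in closed_span_pred steps.
Proof.
have iy := repr_integrable y; set g := Lspace_repr y in iy.
have [h [ih _ hcvg]] := approximation_sfun_integrable measurableT iy.
have yE : y = toL1 mu01 g by rewrite toL1_repr.
have c : (fun n => toL1 mu01 (h n) : Y) @ \oo --> y.
  apply/cvgrPdist_le => e e0.
  move: hcvg => /fine_cvgP[fin0 /cvgrPdist_le/(_ e e0)].
  apply: filterS2 fin0 => n /= h1; rewrite sub0r normrN => h2.
  rewrite yE -toL1B// -lee_fin toL1_norm; last exact: intgB.
  by rewrite -[X in (X <= _)%E](fineK h1) lee_fin; apply: le_trans h2; exact: ler_norm.
apply: (span_closed c) => n.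
have mh r : measurable (h n @^-1` [set r]).
  by rewrite -[X in measurable X]setTI; apply: (measurable_funPT (h n)).
have -> : toL1 mu01 (h n) = \sum_(r <- finmap.enum_fset (fset_set (range (h n))))
    r *: (ind (h n @^-1` [set r]) : Y).
  rewrite -toL1_sum; last by move=> r; apply: intg_indic; exact: mh.
  by congr toL1; apply/funext => x; rewrite fimfunE fsbig_finite.
by apply: rpred_sum => r _; apply: rpredZ; apply: ind_span; exact: mh.
Qed.

End UnitInterval.

(** * Norms of combinations of step functions *)

Lemma toL1_disjoint d (T : measurableType d) (R : realType)
    (mu : {measure set T -> \bar R}) (c : R) (f g : T -> R) :
  mu.-integrable setT (EFin \o f) -> mu.-integrable setT (EFin \o g) ->
  (forall x, f x = 0 \/ g x = 0) ->
  `|(toL1 mu (fun x => c * f x + g x) : LspaceType1 mu)| =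
  `|c| * `|(toL1 mu f : LspaceType1 mu)| + `|(toL1 mu g : LspaceType1 mu)|.
Proof.
move=> hf hg fg; apply: EFin_inj; rewrite EFinD EFinM !toL1_norm//; last exact: integrable_lin.
have mf : measurable_fun setT (fun x => `|(f x)%:E|%E).
  by apply: measurableT_comp => //; case/integrableP: hf.
have mg : measurable_fun setT (fun x => `|(g x)%:E|%E).
  by apply: measurableT_comp => //; case/integrableP: hg.
rewrite -ge0_integralZl_EFin// -ge0_integralD//; last exact: measurable_funeM.
apply: eq_integral => x _; rewrite /= -EFinM -EFinD; congr EFin.
by have [->|->] := fg x; rewrite ?mulr0 ?normr0 ?mulr0 ?add0r ?addr0 ?normrM.
Qed.

Lemma comb_merge (R : realType) (I : Type) (V : lmodType R) (w : I -> V) c i c2 i2 r :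
  comb w [:: (c, i), (c2, i2) & r] = c *: (w i - w i2) + comb w ((c + c2, i2) :: r).
Proof. by rewrite /comb !big_cons/= scalerBr scalerDl !addrA subrK. Qed.

Section StepCombinations.
Context {R : realType} {I : eqType}.
Local Notation mu01 := (mrestr (@lebesgue_measure R) (measurable_itv `[0%R, 1%R])).
Local Notation Y := (LspaceType1 mu01 : normedModType R).
Variable u : I -> R.
Hypothesis u01 : forall i, 0 <= u i <= 1.
Local Notation ge_u := (fun p q : R * I => u q.2 <= u p.2).

(** The norm of a combination of steps, by summation by parts: when the list is
    sorted by decreasing [u], the combination equals c on ]u i2, u i] for the sum c
    of the coefficients met so far. *)
Fixpoint abel (c : R) (i : I) (r : seq (R * I)) : R :=
  if r is (c2, i2) :: r' then `|c| * (u i - u i2) + abel (c + c2) i2 r'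
  else `|c| * u i.

Definition step_fun (i : I) : R -> R := \1_(`]0, u i]).
Definition ustep (i : I) : Y := step (u i).

Let mstep i : (mu01 : measure _ _).-integrable setT (EFin \o step_fun i).
Proof. by apply: intg_indic. Qed.

Lemma combE l : comb ustep l =
  toL1 mu01 (fun x => \sum_(p <- l) p.1 * step_fun p.2 x) :> Y.
Proof.
exact: (esym (toL1_sum l (fun p => p.1) (fun p : R * I => mstep p.2))).
Qed.

Lemma ind_itv_norm a b : 0 <= a -> a <= b -> b <= 1 ->
  `|(ind (`]a, b]%classic : set R) : Y)| = b - a.
Proof.
move=> a0 ab b1; apply: EFin_inj; rewrite ind_norm// /mrestr.
rewrite (_ : `]a, b] `&` `[0%R, 1%R] = `]a, b]%classic); last first.
  apply/setIidl => x; rewrite /= !in_itv/= => /andP[h1 h2].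
  by apply/andP; split; lra.
rewrite lebesgue_measure_itv/= lte_fin; case: ltP => // ba.
by congr EFin; lra.
Qed.

(** The remaining steps vanish on ]a, b]. *)
Lemma step_peel c a b l : 0 <= a -> a <= b -> b <= 1 ->
  (forall p, p \in l -> u p.2 <= a) ->
  `|c *: ((step b : Y) - step a) + comb ustep l| = `|c| * (b - a) + `|comb ustep l|.
Proof.
move=> a0 ab b1 la.
have sub : `]0, a] `<=` `]0, b].
  by move=> x; rewrite /= !in_itv/= => /andP[-> /le_trans]; exact.
have ba : `]0, b] `\` `]0, a] = `]a, b]%classic.
  apply/seteqP; split => x; rewrite /= !in_itv/=.
    move=> [/andP[x0 xb] /negP]; rewrite x0/= -ltNge => ->.
    by rewrite xb.
  move=> /andP[ax xb]; rewrite xb (le_lt_trans a0 ax); split => //.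
  by apply/negP; rewrite -ltNge.
rewrite -(ind_itv_norm a0 ab b1) /step -indD// ba combE /ind.
pose F x := \sum_(p <- l) p.1 * step_fun p.2 x.
have iF : (mu01 : measure _ _).-integrable setT (EFin \o F).
  exact: (intg_sum l (fun p => p.1) (fun p : R * I => mstep p.2)).
have ig : (mu01 : measure _ _).-integrable setT (EFin \o (\1_(`]a, b]%classic) : R -> R)).
  exact: intg_indic.
rewrite -toL1_lin// (toL1_disjoint _ ig iF)// => x.
case: (leP x a) => xa; [left|right].
  by rewrite indicE memNset//= in_itv/= ltNge xa.
rewrite /F big_seq big1// => p pl.
rewrite /step_fun indicE memNset ?mulr0// /= in_itv/= => /andP[_].
by rewrite leNgt (le_lt_trans (la p pl) xa).
Qed.

Section Bounds.

Lemma path_ge c i r : path ge_u (c, i) r -> forall p, p \in r -> u p.2 <= u i.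
Proof.
move=> h; have tr : transitive ge_u by move=> q p s /= h1 h2; exact: le_trans h1.
by have /allP := order_path_min tr h.
Qed.

Lemma path_head c c' i r : path ge_u (c, i) r -> path ge_u (c', i) r.
Proof. by case: r. Qed.

Lemma abel_norm c i r : path ge_u (c, i) r -> `|comb ustep ((c, i) :: r)| = abel c i r.
Proof.
have step0 : step 0 = 0 :> Y.
  by apply/eqP; rewrite -normr_eq0 ind_itv_norm ?subrr ?ler01.
elim: r c i => [|[c2 i2] r IH] c i /=.
  move=> _; have /andP[ui0 ui1] := u01 i.
  have h0 : forall p : R * I, p \in [::] -> u p.2 <= 0 by [].
  have := @step_peel c 0 (u i) [::] (lexx _) ui0 ui1 h0.
  by rewrite /comb !big_nil addr0 big_seq1 step0 !subr0 normr0 addr0.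
move=> /andP[h /(path_head (c + c2)) hr]; have /andP[ui0 ui1] := u01 i; have /andP[u20 u21] := u01 i2.
rewrite -(IH (c + c2) i2 hr).
rewrite comb_merge step_peel// => p; rewrite inE => /orP[/eqP->//|]; exact: (path_ge hr).
Qed.

Lemma abel_le (X : normedModType R) (d : I -> X) c i r :
  (forall i, `|d i| <= u i) -> (forall i j, `|d i - d j| <= `|u i - u j|) ->
  path ge_u (c, i) r -> `|comb d ((c, i) :: r)| <= abel c i r.
Proof.
move=> d0 dl; elim: r c i => [|[c2 i2] r IH] c i /=.
  by move=> _; rewrite /comb big_seq1 normrZ ler_wpM2l.
move=> /andP[h /(path_head (c + c2)) hr].
rewrite comb_merge.
apply: (le_trans (ler_normD _ _)); apply: lerD; last exact: IH.
rewrite normrZ; apply: ler_wpM2l => //; apply: (le_trans (dl _ _)).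
by rewrite ger0_norm// subr_ge0.
Qed.

(** The extremal function has on ]u i2, u i] the sign of the value of the combination
    there as slope.  It is constant beyond [u i], which allows the next interval to
    be added without changing what has been built. *)
Lemma abel_functional c i r : path ge_u (c, i) r -> exists f : R -> R,
  [/\ forall x y, `|f x - f y| <= `|x - y|, f 0 = 0,
    forall x, u i <= x -> f x = f (u i)
    & \sum_(p <- (c, i) :: r) p.1 * f (u p.2) = abel c i r].
Proof.
elim: r c i => [|[c2 i2] r IH] c i /=.
  move=> _; have /andP[ui0 ui1] := u01 i.
  exists (fun x => Num.sg c * Num.max 0 (Num.min x (u i))); split.
  - move=> x y; rewrite -mulrBr normrM.
    apply: (@le_trans _ _ (1 * `|Num.max 0 (Num.min x (u i)) - Num.max 0 (Num.min y (u i))|)).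
      by apply: ler_wpM2r => //; rewrite normr_sg lern1 leq_b1.
    by rewrite mul1r; apply: (le_trans (max_lip _ _ _)); exact: min_lip.
  - by rewrite (min_idPl ui0) maxxx mulr0.
  - by move=> x ux; rewrite (min_idPr ux) minxx.
  - by rewrite big_seq1 /= minxx (max_idPr ui0) mulrA [c * _]mulrC -normrEsg.
move=> /andP[h /(path_head (c + c2)) hr]; have [f' [f'lip f'0 f'c f's]] := IH (c + c2) i2 hr.
have /andP[ui0 ui1] := u01 i; have /andP[u20 u21] := u01 i2.
pose q x := Num.max (u i2) (Num.min x (u i)) - u i2.
have q_lo x : x <= u i2 -> q x = 0.
  by move=> hx; rewrite /q (max_idPl _) ?subrr// ge_min hx.
exists (fun x => f' x + Num.sg c * q x); split.
- move=> x y; wlog xy : x y / x <= y.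
    move=> W; case: (leP x y) => hxy; first exact: W.
    by rewrite distrC [leRHS]distrC; apply: W; exact: ltW.
  rewrite distrC [leRHS]distrC [leRHS]ger0_norm ?subr_ge0//.
  rewrite opprD addrACA -mulrBr; apply: (le_trans (ler_normD _ _)).
  have f'min z : f' z = f' (Num.min z (u i2)) by case: leP => // /ltW /f'c.
  have h1 : `|f' y - f' x| <= Num.min y (u i2) - Num.min x (u i2).
    rewrite (f'min x) (f'min y); apply: (le_trans (f'lip _ _)).
    by rewrite ger0_norm// subr_ge0 le_min2.
  have h2 : `|Num.sg c * (q y - q x)| <= q y - q x.
    have q0 : 0 <= q y - q x by rewrite subr_ge0 /q lerD2r le_max2// le_min2.
    by rewrite normrM normr_sg (ger0_norm q0) ler_piMl// lern1 leq_b1.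
  apply: (le_trans (lerD h1 h2)).
  have qE z : Num.min z (u i2) + q z = Num.min z (u i).
    rewrite /q; case: (leP z (u i2)) => hz.
      by rewrite (min_idPl (le_trans hz h)) (max_idPl hz); ring.
    by rewrite (max_idPr _) ?le_min ?(ltW hz)//; ring.
  have -> : Num.min y (u i2) - Num.min x (u i2) + (q y - q x) =
      Num.min y (u i) - Num.min x (u i) by rewrite -!qE; ring.
  have := min_lip (u i) y x; rewrite [X in _ <= X]ger0_norm ?subr_ge0//.
  exact: le_trans (ler_norm _).
- by rewrite f'0 q_lo// mulr0 addr0.
- move=> x ux; rewrite (f'c x (le_trans h ux)) (f'c (u i) h); congr (_ + _ * _).
  by rewrite /q (min_idPr ux) minxx.
- rewrite -f's !big_cons/= (q_lo (u i2) (lexx _)) mulr0 addr0 (f'c (u i) h).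
  have -> : q (u i) = u i - u i2 by rewrite /q minxx (max_idPr h).
  have -> : \sum_(p <- r) p.1 * (f' (u p.2) + Num.sg c * q (u p.2)) =
      \sum_(p <- r) p.1 * f' (u p.2).
    rewrite big_seq [RHS]big_seq; apply: eq_bigr => p pr.
    by rewrite q_lo ?mulr0 ?addr0//; exact: (path_ge hr).
  by rewrite mulrDr mulrA [c * Num.sg c]mulrC -normrEsg; ring.
Qed.

End Bounds.

(** No family with norms bounded by [u] and increments bounded by those of [u] has
    larger combinations than the steps, and the norm of a combination of steps is
    attained by a 1-Lipschitz function of [u].  Both facts are read off from the formula [abel] after sorting the list. *)
Lemma comb_bounds l :
  (forall (X : normedModType R) (d : I -> X), (forall i, `|d i| <= u i) ->
     (forall i j, `|d i - d j| <= `|u i - u j|) -> `|comb d l| <= `|comb ustep l|) /\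
  exists f : R -> R, [/\ forall x y, `|f x - f y| <= `|x - y|, f 0 = 0
    & \sum_(p <- l) p.1 * f (u p.2) = `|comb ustep l|].
Proof.
have tot : total ge_u by move=> p q /=; exact: le_total.
pose s := sort ge_u l; have sl : perm_eq s l by rewrite perm_sort.
have combs (W : lmodType R) (w : I -> W) : comb w l = comb w s.
  by apply: perm_big; rewrite perm_sym.
have srt : sorted ge_u s by exact: sort_sorted.
have sumE (f : R -> R) : \sum_(p <- l) p.1 * f (u p.2) = \sum_(p <- s) p.1 * f (u p.2).
  by apply: perm_big; rewrite perm_sym.
case: s combs srt sumE {sl} => [|[c i] r] combs /= srt sumE.
  split => [X d _ _|]; first by rewrite !combs /comb !big_nil !normr0.
  exists (fun=> 0); split => //; first by move=> x y; rewrite subrr normr0.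
  by rewrite combs /comb big_nil normr0 big1 // => p _; rewrite mulr0.
split => [X d d0 dl|]; first by rewrite !combs abel_norm//; exact: abel_le.
have [f [flip f0 _ fs]] := abel_functional srt.
by exists f; split => //; rewrite sumE combs abel_norm.
Qed.

End StepCombinations.

(** * Making room for a copy of l1 *)

(** Rearrange the natural numbers in columns.  In the column of every [k] in [G]
    the map [s] moves everyone one place up, and [t k] is the place set free; other
    columns do not move. *)
Lemma hotel_index (G : pred nat) : exists s t : nat -> nat,
  [/\ injective s, injective t, forall k n, G k -> s n <> t k &
      forall i, (exists n, s n = i) \/ (exists2 k, G k & t k = i)].
Proof.
have /card_set_bijP[b] := card_nat2; rewrite setTT_bijective => -[c bK cK].
pose s n := let p := c n in if G p.1 then b (p.1, p.2.+1) else n.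
pose t k := b (k, 0%N).
have cs n : c (s n) = if G (c n).1 then ((c n).1, (c n).2.+1) else c n.
  by rewrite /s; case: ifP.
have ct k : c (t k) = (k, 0%N) by rewrite /t bK.
have sG n : G (c (s n)).1 = G (c n).1 by rewrite cs; case: ifP.
exists s, t; split.
- move=> m n mn; have := sG m; rewrite mn sG => Gmn.
  have := congr1 c mn; rewrite !cs -Gmn; case: ifP => _ h; last exact: (can_inj cK).
  by apply: (can_inj cK); move: h; case: (c m) => ? ?; case: (c n) => ? ? /= [-> ->].
- by move=> k l kl; have := congr1 c kl; rewrite !ct => -[].
- by move=> k n Gk /(congr1 c); rewrite cs ct; case: ifP => [_ []//|+ cn]; rewrite cn/= Gk.
- move=> i; case: (boolP (G (c i).1)) => Gi; last first.
    by left; exists i; apply: (can_inj cK); rewrite cs (negbTE Gi).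
  case: (c i) (cK i) Gi => k [|j] <- /= Gk; first by right; exists k.
  by left; exists (b (k, j)); rewrite /s bK/= Gk.
Qed.

Section Hotel.
Context {R : realType} (Y : completeNormedModType R).
(** The [e n] behave as the unit vectors of l1 and the [m n] as its coordinates,
    summable on all of [Y]. *)
Variables (e : nat -> Y) (m : nat -> {linear Y -> R^o}).
Hypotheses (e1 : forall n, `|e n| <= 1)
  (m1 : forall y N, \sum_(0 <= n < N) `|m n y| <= `|y|)
  (me : forall i j, m i (e j) = (i == j)%:R).
Variables (s : nat -> nat) (s_inj : injective s).

Let term y n : Y := m n y *: (e (s n) - e n).

Let term_le y N : \sum_(0 <= n < N) `|term y n| <= 2 * \sum_(0 <= n < N) `|m n y|.
Proof.
rewrite mulr_sumr; apply: ler_sum => n _; rewrite normrZ mulrC; apply: ler_wpM2r => //.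
by apply: (le_trans (ler_normB _ _)); have := e1 (s n); have := e1 n; lra.
Qed.

Let shift y : Y := limn (series (term y)).

Let shift_cvg y : series (term y) @ \oo --> shift y.
Proof.
apply: (@abs_series_cvg _ _ _ (2 * `|y|)) => N.
by apply: (le_trans (term_le y N)); apply: ler_wpM2l.
Qed.

Let shift_le y C : (forall N, \sum_(0 <= n < N) `|m n y| <= C) -> `|shift y| <= 2 * C.
Proof.
move=> h; apply: (cvg_norm_le (@shift_cvg y)) => N.
apply: (le_trans (ler_norm_sum _ _ _)); apply: (le_trans (term_le y N)).
by apply: ler_wpM2l.
Qed.

Let hotel0 y : Y := y + shift y.

Let hotel_linear : linear hotel0.
Proof.
move=> a x y; rewrite /hotel0.
have -> : shift (a *: x + y) = a *: shift x + shift y.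
  apply: (cvg_unique _ (@shift_cvg _)) => //.
  have -> : series (term (a *: x + y)) =
      (fun N => a *: series (term x) N + series (term y) N).
    apply/funext => N; rewrite /series/= scaler_sumr -big_split/=.
    by apply: eq_bigr => n _; rewrite /term linearP/= scalerDl scalerA.
  by apply: (cvgD (cvgZl_tmp (@shift_cvg x)) (@shift_cvg y)).
by rewrite scalerDr addrACA.
Qed.

(** The operator moves the component of [y] along [e n] to [e (s n)] and leaves the
    rest of [y] unchanged. *)
Definition hotel : {linear Y -> Y} :=
  HB.pack hotel0 (GRing.isLinear.Build R Y Y _ hotel0 hotel_linear).

Lemma hotel_le y : `|hotel y| <= 3 * `|y|.
Proof.
have h : `|shift y| <= 2 * `|y| by apply: shift_le => N; exact: m1.
by apply: (le_trans (ler_normD _ _)); lra.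
Qed.

Lemma m_le i y : `|m i y| <= 1 * `|y|.
Proof.
rewrite mul1r; apply: (le_trans _ (m1 y i.+1)); rewrite big_nat_recr//= lerDr.
by apply: sumr_ge0.
Qed.

Let m_hotel_lim y i l : (exists N0, forall N, (N0 <= N)%N ->
    \sum_(0 <= n < N) m n y * (i == s n)%:R = l) -> m i (hotel y) = l.
Proof.
move=> [N0 hN]; rewrite [m i _](linearD (m i) y (shift y)).
suff -> : m i (shift y) = l - m i y by rewrite addrC subrK.
apply: (cvg_unique _ (contractive_cvg (m_le i) (@shift_cvg y))) => //.
apply: cvg_near_cst; exists (maxn N0 i.+1) => // N /=.
rewrite geq_max => /andP[h1 h2]; rewrite /series/= linear_sum -(hN N h1).
have -> : m i y = \sum_(0 <= n < N) m n y * (i == n)%:R.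
  rewrite (bigD1_seq i) ?mem_index_iota ?iota_uniq//= eqxx mulr1 big1 ?addr0// => n.
  by rewrite eq_sym => /negbTE ->; rewrite mulr0.
rewrite -sumrB; apply: eq_bigr => n _.
by rewrite /term linearZ linearB/= !me /GRing.scale/= mulrBr.
Qed.

Lemma m_hotel y j : m (s j) (hotel y) = m j y.
Proof.
apply: m_hotel_lim; exists j.+1 => N jN.
rewrite (bigD1_seq j) ?mem_index_iota ?iota_uniq//= eqxx mulr1 big1 ?addr0// => n nj.
by rewrite (inj_eq s_inj) eq_sym (negbTE nj) mulr0.
Qed.

Lemma m_hotel0 y i : (forall n, s n <> i) -> m i (hotel y) = 0.
Proof.
move=> si; apply: m_hotel_lim; exists 0%N => N _; rewrite big1// => n _.
by case: eqP => [/esym/si//|_]; rewrite mulr0.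
Qed.

Lemma hotel_id y : (forall n, m n y = 0) -> hotel y = y.
Proof.
move=> y0; rewrite -[RHS]addr0; congr (y + _).
apply: (cvg_unique _ (@shift_cvg y)) => //; apply: cvg_near_cst; apply: nearW => N.
by rewrite /series/= big1// => n _; rewrite /term y0 scale0r.
Qed.

Lemma hotel_e j : hotel (e j) = e (s j).
Proof.
rewrite -[RHS](subrK (e j)) [RHS]addrC; congr (e j + _).
apply: (cvg_unique _ (@shift_cvg _)) => //.
apply: cvg_near_cst; exists j.+1 => // N /= jN.
rewrite /series/= (bigD1_seq j) ?mem_index_iota ?iota_uniq//= /term me eqxx scale1r.
by rewrite big1 ?addr0// => n /negbTE nj; rewrite me nj scale0r.
Qed.

(** A sum over distinct indices is at most the sum over all of them. *)
Lemma m_inj_sum (t : nat -> nat) z N : injective t ->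
  \sum_(0 <= n < N) `|m (t n) z| <= `|z|.
Proof.
move=> t_inj; pose r := [seq t n | n <- index_iota 0 N].
have -> : \sum_(0 <= n < N) `|m (t n) z| = \sum_(i <- r) `|m i z| by rewrite big_map.
pose M := (\max_(i <- r) i).+1.
apply: (le_trans _ (m1 z M)).
have -> : \sum_(i <- r) `|m i z| = \sum_(0 <= i < M | i \in r) `|m i z|.
  rewrite -[RHS]big_filter; apply: perm_big; apply: uniq_perm.
  - by rewrite map_inj_uniq// iota_uniq.
  - by rewrite filter_uniq// iota_uniq.
  move=> i; rewrite mem_filter mem_index_iota/=.
  by case: (boolP (i \in r)) => //= ir; rewrite ltnS leq_bigmax_seq.
rewrite [leRHS](bigID (fun i => i \in r))/= lerDl; exact: sumr_ge0.
Qed.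

Section Guests.
Variables (G : pred nat) (t : nat -> nat).
Hypotheses (t_inj : injective t) (st : forall k n, G k -> s n <> t k)
  (part : forall i, (exists n, s n = i) \/ (exists2 k, G k & t k = i)).

(** The coordinates of the combination at the indices [s n] are those of [y], and at
    the indices [t k] they are the [c k].  They control the shift that was applied
    to [y] and the guests, hence [y] itself: with z the combination, the shift has
    norm at most 2 |z| and the guests at most |z|. *)
Lemma hotel_lower y (c : nat -> R) M : (forall k, ~~ G k -> c k = 0) ->
  `|y| + \sum_(0 <= k < M) `|c k| <=
  5 * `|hotel y + \sum_(0 <= k < M) c k *: e (t k)|.
Proof.
move=> cG; set g := \sum_(0 <= k < M) c k *: e (t k); set z := hotel y + g.
have mg i : m i g = \sum_(0 <= k < M) c k * (i == t k)%:R.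
  by rewrite /g linear_sum; apply: eq_bigr => k _; rewrite linearZ/= me.
have ms n : m (s n) z = m n y.
  rewrite linearD m_hotel mg big1 ?addr0// => k _.
  have [Gk|/cG->] := boolP (G k); last by rewrite mul0r.
  by rewrite (_ : s n == t k = false) ?mulr0//; apply/eqP/st.
have mt k : (k < M)%N -> G k -> m (t k) z = c k.
  move=> kM Gk; rewrite linearD m_hotel0; last by move=> n; exact: st.
  rewrite add0r mg (bigD1_seq k) ?mem_index_iota ?iota_uniq//= eqxx mulr1.
  rewrite big1 ?addr0// => j jk; rewrite (inj_eq t_inj) eq_sym (negbTE jk) mulr0//.
have hs : `|shift y| <= 2 * `|z|.
  apply: shift_le => N; apply: (le_trans _ (m_inj_sum z N s_inj)).
  by apply: ler_sum => n _; rewrite ms.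
have hc : \sum_(0 <= k < M) `|c k| <= `|z|.
  apply: (le_trans _ (m_inj_sum z M t_inj)); rewrite big_nat_cond [leRHS]big_nat_cond.
  apply: ler_sum => k; rewrite andbT => /andP[_ kM].
  by have [Gk|/cG->] := boolP (G k); [rewrite mt|rewrite normr0].
have hg : `|g| <= \sum_(0 <= k < M) `|c k|.
  apply: (le_trans (ler_norm_sum _ _ _)); apply: ler_sum => k _.
  by rewrite normrZ ler_piMr.
have hy : `|y| <= `|z| + `|shift y| + `|g|.
  have yE : y = z - shift y - g.
    by rewrite /z [hotel y]/(y + shift y) addrAC addrK addrK.
  rewrite [X in `|X| <= _]yE.
  by apply: (le_trans (ler_normB _ _)); apply: lerD => //; exact: ler_normB.
lra.
Qed.

Lemma hotel_upper y (c : nat -> R) M :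
  `|hotel y + \sum_(0 <= k < M) c k *: e (t k)| <=
  3 * (`|y| + \sum_(0 <= k < M) `|c k|).
Proof.
apply: (le_trans (ler_normD _ _)); have h := hotel_le y.
have hg : `|\sum_(0 <= k < M) c k *: e (t k)| <= \sum_(0 <= k < M) `|c k|.
  apply: (le_trans (ler_norm_sum _ _ _)); apply: ler_sum => k _.
  by rewrite normrZ ler_piMr.
have s0 : 0 <= \sum_(0 <= k < M) `|c k| by apply: sumr_ge0.
lra.
Qed.

(** Every [e i] is an [e (s n)] or an [e (t k)].  A vector minus its component along
    the [e i] has zero coordinates, hence is fixed by [hotel]. *)
Lemma hotel_dense (W W' : set Y) : (forall y, y \in closed_span_pred W) ->
  (forall w, W w -> hotel w \in closed_span_pred W') ->
  (forall k, G k -> e (t k) \in closed_span_pred W') ->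
  forall z, z \in closed_span_pred W'.
Proof.
move=> dense hW hG.
have hL w : linear_span W w -> hotel w \in closed_span_pred W'.
  move=> [k [c [v [Wv ->]]]]; have -> := linear_sum hotel (index_enum 'I_k) xpredT (fun i => c i *: v i).
  by apply: rpred_sum => i _; have -> := linearZZ hotel (c i) (v i); apply: rpredZ; exact: hW.
have hS y : hotel y \in closed_span_pred W'.
  have ex n : exists w, linear_span W w /\ `|y - w| <= 2^-1 ^+ n.
    have e0 : 0 < (2^-1 ^+ n : R) by rewrite exprn_gt0// invr_gt0.
    have [w Ww hw] := span_approx (dense y) e0; exists w; split => //; exact: ltW.
  have [w hw] := choice ex.
  have wy : w @ \oo --> y.
    by apply: (@half_squeeze _ _ _ _ 1) => n; rewrite mul1r; case: (hw n).
  apply: (span_closed (contractive_cvg hotel_le wy)) => n.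
  have [Ww _] := hw n; exact: hL.
have he i : e i \in closed_span_pred W'.
  by case: (part i) => [[n <-]|[k Gk <-]]; [rewrite -hotel_e|exact: hG].
move=> z.
have pc : series (fun n => m n z *: e n) @ \oo --> limn (series (fun n => m n z *: e n)).
  apply: (@abs_series_cvg _ _ _ `|z|) => N; apply: (le_trans _ (m1 z N)).
  by apply: ler_sum => n _; rewrite normrZ ler_piMr.
set p := limn _ in pc.
have pS : p \in closed_span_pred W'.
  by apply: (span_closed pc) => N; apply: rpred_sum => n _; apply: rpredZ.
rewrite -(subrK p z); apply: rpredD => //.
suff zp0 i : m i (z - p) = 0 by rewrite -(hotel_id zp0); exact: hS.
rewrite linearB; apply/eqP; rewrite subr_eq0; apply/eqP/esym.
apply: (cvg_unique _ (contractive_cvg (m_le i) pc)) => //.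
apply: cvg_near_cst; exists i.+1 => // N /= iN.
rewrite /series/= linear_sum (bigD1_seq i) ?mem_index_iota ?iota_uniq//=.
rewrite linearZ/= me eqxx /GRing.scale/= mulr1 big1 ?addr0// => n ni.
by rewrite linearZ/= me eq_sym (negbTE ni) /GRing.scale/= mulr0.
Qed.

End Guests.
End Hotel.

(** * Integrals over disjoint sets *)

Section Mean.
Context d (T : measurableType d) (R : realType) (mu : {measure set T -> \bar R}).
Local Notation V := (LspaceType1 mu : normedModType R).

Let mean0 (A : set T) (y : V) : R^o := \int[mu]_(x in A) Lspace_repr y x.

Lemma integrable_on (A : set T) (f : T -> R) : measurable A ->
  mu.-integrable setT (EFin \o f) -> mu.-integrable A (EFin \o f).
Proof. by move=> mA; exact: integrableS. Qed.

Let mean0_toL1 (A : set T) (f : T -> R) : measurable A ->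
  mu.-integrable setT (EFin \o f) -> mean0 A (toL1 mu f) = \int[mu]_(x in A) f x.
Proof.
move=> mA hf; have hr := repr_integrable (toL1 mu f).
congr fine; apply: ae_eq_integral => //.
- by have /integrableP[] := integrable_on mA hr.
- by have /integrableP[] := integrable_on mA hf.
move/Lfun1_integrable in hf; rewrite (toL1E hf).
have := Lspace_piK (Lfun_Sub (lexx 1%E) hf); apply: filterS => x /(_ I) /= h _.
by rewrite -h.
Qed.

Let mean0_linear A : measurable A -> linear (mean0 A).
Proof.
move=> mA a x y; rewrite -[in LHS](toL1_repr x) -[in LHS](toL1_repr y).
have hx := repr_integrable x; have hy := repr_integrable y.
rewrite -toL1_lin// mean0_toL1//; last exact: integrable_lin.
rewrite RintegralD//; [|exact: integrable_on (integrableZl measurableT a hx)|exact: integrable_on].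
by rewrite RintegralZl//; exact: integrable_on.
Qed.

Definition mean (A : set T) (mA : measurable A) : {linear V -> R^o} :=
  HB.pack (mean0 A) (GRing.isLinear.Build R V R^o _ (mean0 A) (mean0_linear mA)).

Lemma mean_ind (A B : set T) (mA : measurable A) (mB : measurable B) :
  (mu B < +oo)%E -> mean mA (toL1 mu (\1_B : T -> R)) = fine (mu (A `&` B)).
Proof.
move=> Boo; rewrite -[LHS]/(mean0 A _) mean0_toL1//; last first.
  apply/integrableP; split; first by apply/measurable_EFinP; exact: measurable_indic.
  under eq_integral do rewrite /= ger0_norm//.
  by rewrite integral_indic// setIT.
by rewrite /Rintegral integral_indic// setIC.
Qed.

(** The integrals of |y| over disjoint sets add up to at most its integral. *)
Lemma mean_sum (A : (set T)^nat) (mA : forall n, measurable (A n)) (y : V) N :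
  trivIset setT A -> \sum_(0 <= n < N) `|mean (mA n) y| <= `|y|.
Proof.
move=> tA; have hy := repr_integrable y; set g := Lspace_repr y in hy.
have hn : mu.-integrable setT (EFin \o (fun x => `|g x|)).
  exact: (integrable_norm hy).
have mU M : measurable (\big[setU/set0]_(i < M) A i) by exact: bigsetU_measurable.
have le1 M : \sum_(0 <= n < M) `|mean (mA n) y| <=
    \int[mu]_(x in \big[setU/set0]_(i < M) A i) `|g x|.
  elim: M => [|M IH]; first by rewrite big_nil Rintegral_ge0.
  rewrite big_nat_recr//= big_ord_recr/= Rintegral_setU; [|exact: mU|exact: mA| |].
  - exact: (lerD IH (le_normr_Rintegral (mA M) (integrable_on (mA M) hy))).
  - by apply: (integrable_on (measurableU _ _ (mU M) (mA M)) hn).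
  apply/disj_setPRL => x AMx; rewrite -bigcup_mkord => -[i /= iM Aix].
  by have := tA i M I I (ex_intro _ x (conj Aix AMx)) => iM'; rewrite iM' ltnn in iM.
apply: (le_trans (le1 N)); rewrite -lee_fin -[X in (_ <= X%:E)%E](congr1 (fun z : V => `|z|) (toL1_repr y)).
rewrite toL1_norm// /Rintegral fineK.
  apply: ge0_subset_integral => //.
  by have /integrableP[] := hn.
by apply: integrable_fin_num => //; exact: integrable_on.
Qed.
End Mean.

(** * Normalised indicators of dyadic intervals *)

Section Bumps.
Context {R : realType}.
Local Notation mu01 := (mrestr (@lebesgue_measure R) (measurable_itv `[0%R, 1%R])).
Local Notation Y := (LspaceType1 mu01 : completeNormedModType R).

Definition dyadic n : set R := `]2^-1 ^+ n.+1, 2^-1 ^+ n].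

Lemma half_homo m n : (m <= n)%N -> 2^-1 ^+ n <= 2^-1 ^+ m :> R.
Proof. by move=> mn; apply: ler_wiXn2l => //; lra. Qed.

Lemma dyadic_disjoint : trivIset setT dyadic.
Proof.
apply/trivIsetP => i j _ _; wlog ij : i j / (i < j)%N => [W ij|_].
  by case: (ltngtP i j) ij => // h _; [|rewrite setIC]; apply: W; rewrite // ltn_eqF.
rewrite -subset0 => x []; rewrite /dyadic/= !in_itv/= => /andP[h1 _] /andP[_ h2].
by have := lt_le_trans h1 (le_trans h2 (half_homo ij)); rewrite ltxx.
Qed.

Lemma dyadic_measurable n : measurable (dyadic n). Proof. exact: measurable_itv. Qed.

Lemma dyadic_mu n : mu01 (dyadic n) = (2^-1 ^+ n.+1)%:E.
Proof.
rewrite /mrestr (_ : dyadic n `&` `[0%R, 1%R] = dyadic n); last first.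
  apply/setIidl => x; rewrite /dyadic/= !in_itv/= => /andP[h1 h2].
  have := half_gt0 R n.+1; have := half_homo (leq0n n); rewrite expr0 => h3 h4.
  by rewrite (ltW (lt_trans h4 h1)) (le_trans h2 h3).
rewrite lebesgue_measure_itv/= lte_fin exprS; have := half_gt0 R n => h.
have -> : 2^-1 * 2^-1 ^+ n < 2^-1 ^+ n :> R by lra.
by congr EFin; lra.
Qed.

Definition bump n : Y := 2 ^+ n.+1 *: ind (dyadic n).
Definition bump_mean n : {linear Y -> R^o} := mean mu01 (dyadic_measurable n).

Lemma bump_norm n : `|bump n| = 1.
Proof.
have h : `|(ind (dyadic n) : Y)| = 2^-1 ^+ n.+1.
  by apply: EFin_inj; rewrite -dyadic_mu; exact: (ind_norm (dyadic_measurable n)).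
rewrite /bump normrZ h normrX ger0_norm// -exprMn divff ?expr1n//.
Qed.

Lemma bump_mean_sum (y : Y) N : \sum_(0 <= n < N) `|bump_mean n y| <= `|y|.
Proof. exact: (mean_sum (mu := mu01) dyadic_measurable y N dyadic_disjoint). Qed.

(** The intervals are disjoint. *)
Lemma bump_meanE i j : bump_mean i (bump j) = (i == j)%:R.
Proof.
have fin : (mu01 (dyadic j) < +oo)%E by rewrite dyadic_mu ltry.
rewrite /bump; have -> := linearZZ (bump_mean i) (2 ^+ j.+1) (ind (dyadic j)).
have -> : bump_mean i (ind (dyadic j)) = fine (mu01 (dyadic i `&` dyadic j)).
  exact: (mean_ind (mu := mu01) (dyadic_measurable i) (dyadic_measurable j) fin).
rewrite /GRing.scale/=; case: eqVneq => [->|ij].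
  rewrite setIid; have -> := dyadic_mu j.
  by rewrite /= -exprMn divff ?expr1n.
have /trivIsetP/(_ i j I I ij) -> := dyadic_disjoint.
by rewrite measure0 mulr0.
Qed.

End Bumps.

(** * The positive case *)

Lemma comb_linear (R : realType) (I : Type) (V W : lmodType R) (f : {linear V -> W})
  (v : I -> V) l : f (comb v l) = comb (f \o v) l.
Proof. by rewrite /comb linear_sum; apply: eq_bigr => p _; exact: linearZZ. Qed.

Section SumIndex.
Context {R : realType} {I J : Type}.

Definition lefts (l : seq (R * (I + J))) : seq (R * I) :=
  pmap (fun p => if p.2 is inl i then Some (p.1, i) else None) l.
Definition rights (l : seq (R * (I + J))) : seq (R * J) :=
  pmap (fun p => if p.2 is inr j then Some (p.1, j) else None) l.

Lemma comb_sum (V : lmodType R) (v : I + J -> V) l :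
  comb v l = comb (v \o inr) (rights l) + comb (v \o inl) (lefts l).
Proof.
elim: l => [|[c [i|j]] l IH]; first by rewrite /comb !big_nil addr0.
- rewrite /= [LHS]/comb big_cons [X in _ + X]IH addrCA; congr +%R.
  by rewrite [RHS]/comb big_cons.
- rewrite /= [LHS]/comb big_cons [X in _ + X]IH addrA; congr +%R.
  by rewrite [RHS]/comb big_cons.
Qed.
End SumIndex.

Section IsomorphicCase.
Context {R : realType}.
Local Notation lambda := (@lebesgue_measure R).
Local Notation mu01 := (mrestr (@lebesgue_measure R) (measurable_itv `[0%R, 1%R])).
Local Notation Y := (LspaceType1 mu01 : completeNormedModType R).
Variables (K : set R) (L : R).
Hypotheses (cK : closed K) (Kitv : K `<=` `[0, L]) (K0 : K 0) (KL : K L).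
Variables (X : completeNormedModType R) (E : R -> X).
Hypothesis F : is_free (fun s t : R => `|s - t|) K E.
Hypothesis lK : (0 < lambda K)%E.
Local Notation act := (act K L).
Local Notation atom := (atom K E).
Local Notation diffuse := (diffuse K L E).
Local Notation theta := (theta K).

Let mass0 : 0 < theta L. Proof. by rewrite -lte_fin -(thetaL cK Kitv). Qed.

(* Extended to all reals by 0, a point of K with zero measure below, so that the
   generators can be indexed by all reals. *)
Let pt (r : R) : R := if `[< K r >] then r else 0.
Let Kpt r : K (pt r). Proof. by rewrite /pt; case: asboolP. Qed.
Let ptE r : K r -> pt r = r. Proof. by rewrite /pt; case: asboolP. Qed.

Let u r : R := theta (pt r) / theta L.

Let u01 r : 0 <= u r <= 1.
Proof.
rewrite /u ler_pdivrMr// mul1r divr_ge0 ?theta_ge0//=.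
by apply: (theta_homo cK); have /andP[] := Kle Kitv (Kpt r).
Qed.

Let dens r : X := (theta L)^-1 *: diffuse (pt r).

Let dens_norm r : `|dens r| <= u r.
Proof.
rewrite normrZ gtr0_norm ?invr_gt0// mulrC; apply: ler_wpM2r; first by rewrite invr_ge0 ltW.
exact: (diffuse_norm cK Kitv K0 KL F).
Qed.

Let dens_lip r r' : `|dens r - dens r'| <= `|u r - u r'|.
Proof.
rewrite -scalerBr normrZ -mulrBl normrM mulrC; apply: ler_wpM2r => //.
exact: (diffuse_lip cK Kitv K0 KL F).
Qed.

Let upper_l1 l := (comb_bounds u01 l).1 X dens dens_norm dens_lip.

Let atoms (c : nat -> R) M : X := \sum_(0 <= k < M) c k *: atom k.

(* This is the l1 sum of the atomic and of the diffuse part.  The lower bound takes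
   the functional with slope the sign of c k on the k-th gap, and the extremal
   function of comb_bounds, rescaled to the measure of K, on the diffuse part. *)
Let norm_formula l (c : nat -> R) M : (forall k, ~~ act k -> c k = 0) ->
  `|comb dens l + atoms c M| =
  `|comb (ustep u) l| + \sum_(0 <= k < M) `|c k|.
Proof.
move=> c0; apply/le_anti/andP; split.
  apply: (le_trans (ler_normD _ _)); apply: lerD; first exact: upper_l1.
  apply: (le_trans (ler_norm_sum _ _ _)); apply: ler_sum => k _; rewrite normrZ.
  have [ak|/c0->] := boolP (act k); last by rewrite normr0 mul0r.
  by rewrite ler_piMr// (atom_le cK K0 KL F).
have [_ [f [flip f0 <-]]] := comb_bounds u01 l.
pose h x : R := theta L * f (x / theta L).
have hlip x y : `|h x - h y| <= `|x - y|.
  rewrite /h -mulrBr normrM gtr0_norm// mulrC -ler_pdivlMr//.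
  by apply: (le_trans (flip _ _)); rewrite -mulrBl normrM normfV (gtr0_norm mass0).
have sg1 k : `|Num.sg (c k)| <= 1 by rewrite normr_sg lern1 leq_b1.
have [z [z1 za zd]] := structure_functional cK Kitv K0 KL F hlip sg1.
apply: le_trans (z1 _); apply: le_trans (ler_norm _).
rewrite linearD; apply: lerD.
  rewrite /comb linear_sum/=; apply: ler_sum => p _.
  rewrite linearZ/= [z (dens _)]linearZ/= zd// /h mul0r f0 mulr0 subr0 /GRing.scale/=.
  by rewrite mulKf ?gt_eqF.
rewrite linear_sum/=; apply: ler_sum => k _; rewrite linearZ/= /GRing.scale/=.
have [ak|/c0->] := boolP (act k); last by rewrite normr0 mul0r.
by rewrite za// mulrC -normrEsg.
Qed.

(** Atoms are sent to the places set free by [hotel], and the diffuse part, as the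
    corresponding steps, to its image by [hotel]. *)
Lemma isomorphic_case : linearly_isomorphic X (L1_unit_interval R).
Proof.
have [s [t [s_inj t_inj st part]]] := hotel_index act.
have e1 n : `|(bump n : Y)| <= 1 by rewrite bump_norm.
pose S := hotel (e := bump : nat -> Y) (m := bump_mean) e1 bump_mean_sum s.
pose v (i : nat + R) : X :=
  match i with inl k => if act k then atom k else 0 | inr r => dens r end.
pose w (i : nat + R) : Y :=
  match i with inl k => if act k then bump (t k) else 0 | inr r => S (ustep u r) end.
pose c (l : seq (R * (nat + R))) k := if act k then coef (lefts l) k else 0.
have c0 l k : ~~ act k -> c l k = 0 by rewrite /c => /negbTE->.
pose M (l : seq (R * (nat + R))) := bound (lefts l).
have vE l : comb v l = comb dens (rights l) + atoms (c l) (M l).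
  rewrite comb_sum; congr +%R; rewrite (comb_coef _ (leqnn _)); apply: eq_bigr => k _ /=.
  by rewrite /c; case: ifP; rewrite ?scaler0 ?scale0r.
have wE l : comb w l = S (comb (ustep u) (rights l)) + \sum_(0 <= k < M l) c l k *: bump (t k).
  rewrite comb_sum; congr +%R.
    exact: (esym (comb_linear S (ustep u) (rights l))).
  rewrite (comb_coef _ (leqnn _)); apply: eq_bigr => k _ /=.
  by rewrite /c; case: ifP; rewrite ?scaler0 ?scale0r.
have wv l : `|comb w l| <= 3 * `|comb v l|.
  rewrite vE wE norm_formula; last exact: c0.
  exact: hotel_upper.
have vw l : `|comb v l| <= 5 * `|comb w l|.
  rewrite vE wE norm_formula; last exact: c0.
  exact: (hotel_lower e1 bump_mean_sum bump_meanE s_inj t_inj st _ _ (c0 l)).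
have dv x : x \in closed_span_pred (range v).
  apply: span_sub (structure_span cK Kitv K0 KL F x) => _ [[k ak ->]|[r Kr ->]].
    by apply: span_gen; exists (inl k) => //=; rewrite ak.
  have -> : diffuse r = theta L *: v (inr r).
    by rewrite /= scalerA divff ?gt_eqF// scale1r ptE.
  by apply/rpredZ/span_gen; exists (inr r).
have mem_w i : w i \in closed_span_pred (range w) by apply: span_gen; exists i.
have dw y : y \in closed_span_pred (range w).
  apply: (@hotel_dense R Y bump bump_mean e1 bump_mean_sum bump_meanE s act t part
    steps (range w) (@steps_dense R)) => [_ [x x01 <-]|k ak].
    have [|r Kr rE] := theta_onto cK Kitv K0 KL (u := x * theta L).
      move: x01; rewrite /= in_itv/= => /andP[h0 h1].
      by rewrite mulr_ge0 ?(ltW mass0)//= ler_piMl// ltW.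
    have <- : u r = x by rewrite /u ptE// rE mulfK// gt_eqF.
    exact: (mem_w (inr r)).
  have := mem_w (inl k); have -> : w (inl k) = if act k then bump (t k) else 0 by [].
  by rewrite ak.
have [f [g [fK gK f1 g1]]] := generators_iso wv vw dv dw.
exists f, g; split => //; [exact: contractive_continuous f1|exact: contractive_continuous g1].
Qed.

End IsomorphicCase.

(** * The theorem *)

(** A dense sequence of the whole space need not meet [B]; for every point y of a
    countable dense set and every k choose, when there is one, a point of [B] within
    2^-k of y. *)
Lemma dense_sequence (R : realType) (T : metricType R) (o : T) (B : set T) :
  separable T -> B o -> exists a : nat -> T,
    (forall n, B (a n)) /\
    forall x (e : R), B x -> 0 < e -> exists n, mdist x (a n) < e.
Proof.
move=> [D /countable_injP[f f_inj] dD] Bo.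
pose near_pt (p : nat * nat) := [set x | B x /\ exists y,
  [/\ D y, f y = p.1 & mdist x y < 2^-1 ^+ p.2]].
(* The pair p codes the point of number p.1 in the countable set, and the
   precision 2^-p.2. *)
pose a i := if unpickle i is Some p then xget o (near_pt p) else o.
exists a; split => [n|x e Bx e0].
  by rewrite /a; case: unpickle => // p; case: xgetP => // y _ [].
have /cvgrPdist_lt/(_ _ (divr_gt0 e0 (ltr0n _ 2)))[k _ /(_ k (leqnn k))] := @half_cvg R.
have k0 : 0 < 2^-1 ^+ k :> R by rewrite exprn_gt0 ?invr_gt0.
rewrite /= sub0r normrN gtr0_norm// => ke.
have [y [/= xy Dy]] : (ball x (2^-1 ^+ k))° `&` D !=set0.
  by apply: dD; [exists x; exact: nbhsx_ballx|exact: open_interior].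
move/interior_subset: xy; rewrite ballEmdist /= => xy.
have near_x : near_pt (f y, k) x by split => //; exists y.
exists (pickle (f y, k)); rewrite /a pickleK; have [_ [y' [Dy' /= fy ay]]] := xgetPex o (ex_intro _ x near_x).
have yy : y' = y by apply: f_inj; rewrite ?inE.
rewrite {y' Dy' fy}yy in ay *; apply: (le_lt_trans (metric_triangle _ y _)).
by rewrite [X in _ + X]metric_sym; lra.
Qed.

Section Free.
Context {R : realType} {T : metricType R}.
Variables (A : set T) (a0 : A).
Hypotheses (tree : is_rtree T) (sepT : separable T) (infA : infinite_set A)
  (brA : branching_points T `<=` closure A).
Local Notation X := (closed_span (range (delta a0)) : completeNormedModType R).
Local Notation lambda := (@lebesgue_measure R).

Lemma line_model : exists (K : set R) (L : R) (E : R -> X),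
  [/\ closed K, K `<=` `[0, L], K 0, K L
    & is_free (fun s t : R => `|s - t|) K E] /\
  [/\ infinite_set K, length_measure (closure A) = 0%E -> lambda K = 0%E
    & (0 < length_measure (closure A))%E -> (0 < lambda K)%E].
Proof.
set o := set_val a0; set B := closure A.
have Bo : B o by apply: subset_closure; exact: set_valP.
have cB : closed B by exact: closed_closure.
have [a [aB aD]] := dense_sequence sepT Bo.
have cK := glued_closed tree (o := o) cB (a := a).
exists (glued o B a), (line_length o a), (glue_map o a (mass a0)); split; split => //.
- by move=> t [].
- exact: glued0.
- have pc : pos o a @ \oo --> line_length o a := @pos_cvg _ _ o a. apply: (closed_cvg (glued o B a) _ _ _ pc) => //.
  by apply: nearW => n; exact: pos_mem.
- by apply: glue_free => //; exact: mass_free.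
- apply: glued_infinite => // finB; apply: infA; apply: sub_finite_set finB.
  exact: subset_closure.
- exact: length_null.
- exact: length_pos.
Qed.
End Free.

Theorem corollary3p4 (R : realType) (T : metricType R) (A : set T) :
  is_rtree T -> separable T ->
  infinite_set A -> branching_points T `<=` closure A ->
  (length_measure (closure A) = 0%E ->
     forall a0 : A, linearly_isometric (lipschitz_free a0) (ell1 R)) /\
  ((0 < length_measure (closure A))%E ->
     forall a0 : A, linearly_isomorphic (lipschitz_free a0) (L1_unit_interval R)).
Proof.
move=> tree sepT infA brA; split => hA a0;
  have [K [L [E [[cK Kitv K0 KL F] [Kinf null pos]]]]] := line_model a0 tree sepT infA brA.
- exact: (isometric_case cK Kitv K0 KL F (null hA) Kinf).
- exact: (isomorphic_case cK Kitv K0 KL F (pos hA)).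
Qed.
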